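(* Let $W$ and $W'$ be Coxeter groups with $\widehat W\cong\widehat{W'}$. Then $W$ and $W'$ have the same number of ends.
   Context: The number of ends of a finitely generated group is the number of ends of any of its Cayley graphs with respect to a finite generating set (it is $0,1,2$ or $\infty$). Coxeter groups are $W_\Gamma=\langle V(\Gamma)\mid v^2,\ (vw)^{m(\{v,w\})}\text{ for }\{v,w\}\in E(\Gamma)\rangle$ for a finite simplicial graph $\Gamma$ with labels in $\mathbb{N}_{\ge2}$; $\widehat{G}$ is profinite completion. *)

(* Defs.v *)
From mathcomp Require Import all_boot.
Set Implicit Arguments. Unset Strict Implicit. Unset Printing Implicit Defensive.

(* list membership in Prop (no decidable equality needed) *)
Fixpoint In (T : Type) (a : T) (l : seq T) : Prop :=
  match l with [::] => False | b :: m => b = a \/ In a m end.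

(* Coxeter graphs: a finite simplicial graph Gamma with labels m >= 2 on    *)
(* the edges (only the labels on edges matter).                             *)
Record coxeter_graph := CoxeterGraph {
  cox_V : finType;
  cox_E : rel cox_V;
  cox_m : cox_V -> cox_V -> nat;
  cox_E_irr : irreflexive cox_E;
  cox_E_sym : symmetric cox_E;
  cox_m_sym : forall v w, cox_m v w = cox_m w v;
  cox_m_ge2 : forall v w, cox_E v w -> 2 <= cox_m v w }.

Definition cox_word (G : coxeter_graph) := seq (cox_V G).

(* The congruence on words generated by the Coxeter relators v^2 and
   (v w)^{m(v,w)} for {v,w} an edge.  Since every generator is an involution,
   the monoid  <V | relators = 1>  is the Coxeter group W_Gamma; its elements
   are the classes of words modulo cox_eq. *)
Inductive cox_eq (G : coxeter_graph) : cox_word G -> cox_word G -> Prop :=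
| ce_refl x : cox_eq x x
| ce_sym x y : cox_eq x y -> cox_eq y x
| ce_trans x y z : cox_eq x y -> cox_eq y z -> cox_eq x z
| ce_inv (u w : cox_word G) (v : cox_V G) :
    cox_eq (u ++ [:: v; v] ++ w) (u ++ w)
| ce_braid (u w : cox_word G) (v v' : cox_V G) : cox_E v v' ->
    cox_eq (u ++ flatten (nseq (cox_m v v') [:: v; v']) ++ w) (u ++ w).

Record gops := GOps {
  g_T : Type;
  g_eq : g_T -> g_T -> Prop;
  g_mul : g_T -> g_T -> g_T;
  g_one : g_T;
  g_inv : g_T -> g_T }.

(* The Coxeter group W_Gamma: words modulo cox_eq, concatenation, empty
   word, reversal (inverse of a product of involutions). *)
Definition cox_gops (G : coxeter_graph) : gops :=
  @GOps (cox_word G) (@cox_eq G) (@cat _) [::] (@rev _).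

Section Profinite.
Variable A : gops.
Local Notation T := (g_T A).
Local Notation eqA := (@g_eq A).
Local Notation mul := (@g_mul A).
Local Notation inv := (@g_inv A).

Definition fi_normal (N : T -> Prop) : Prop :=
  (forall x y, eqA x y -> N x -> N y) /\
  N (g_one A) /\
  (forall x y, N x -> N y -> N (mul x y)) /\
  (forall x, N x -> N (inv x)) /\
  (forall x g, N x -> N (mul (mul (inv g) x) g)) /\
  exists reps : seq T, forall x, exists2 r, In r reps & N (mul x (inv r)).

Definition fin_normal := {N : T -> Prop | fi_normal N}.

(* Profinite completion = inverse limit of the finite quotients A/N:
   compatible families of cosets (represented by elements of A). *)
Record profin := Profin {
  pf_fun : fin_normal -> T;
  pf_compat : forall N M : fin_normal,
    (forall x, proj1_sig N x -> proj1_sig M x) ->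
    proj1_sig M (mul (pf_fun N) (inv (pf_fun M))) }.

Definition pf_eq (x y : profin) : Prop :=
  forall N : fin_normal, proj1_sig N (mul (pf_fun x N) (inv (pf_fun y N))).

Definition pf_is_prod (x y z : profin) : Prop :=
  forall N : fin_normal,
    proj1_sig N (mul (pf_fun z N) (inv (mul (pf_fun x N) (pf_fun y N)))).

(* Kernel of the projection of the completion onto A/N: the basic open
   normal subgroups of the inverse limit topology. *)
Definition pf_ker (N : fin_normal) (x : profin) : Prop := proj1_sig N (pf_fun x N).

End Profinite.

Section ProfiniteMaps.
Variables A B : gops.

Definition pf_hom (F : profin A -> profin B) : Prop :=
  (forall x y, pf_eq x y -> pf_eq (F x) (F y)) /\
  (forall x y z, pf_is_prod x y z -> pf_is_prod (F x) (F y) (F z)).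

(* Continuity of a homomorphism for the inverse limit (profinite) topology:
   the preimage of every basic open subgroup contains a basic open subgroup. *)
Definition pf_cont (F : profin A -> profin B) : Prop :=
  forall N' : fin_normal B, exists N : fin_normal A,
    forall x, pf_ker N x -> pf_ker N' (F x).

End ProfiniteMaps.

Definition profinite_iso (A B : gops) : Prop :=
  exists (F : profin A -> profin B) (F' : profin B -> profin A),
    pf_hom F /\ pf_hom F' /\ pf_cont F /\ pf_cont F' /\
    (forall x, pf_eq (F' (F x)) x) /\ (forall y, pf_eq (F (F' y)) y).

(* Ends of the Cayley graph of W_Gamma w.r.t. the generating set V(Gamma):  *)
(* vertices = classes of words, x adjacent to x v for v in V.               *)
Section Ends.
Variable G : coxeter_graph.
Local Notation word := (cox_word G).

Definition notinK (K : seq word) (z : word) : Prop :=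
  forall k, In k K -> ~ cox_eq z k.

Definition conn_avoid (K : seq word) (x y : word) : Prop :=
  exists s : word, (forall i, i <= size s -> notinK K (x ++ take i s)) /\
                   cox_eq (x ++ s) y.

Definition infinite_comp (K : seq word) (x : word) : Prop :=
  notinK K x /\ forall L : seq word, exists y, conn_avoid K x y /\ notinK L y.

(* the Cayley graph has at least n ends: for some finite vertex set K, the
   complement of K has at least n infinite components.  The number of ends
   is the supremum (in nat + {oo}) of such n. *)
Definition ends_ge (n : nat) : Prop :=
  exists (K : seq word) (xs : seq word),
    [/\ size xs = n,
        (forall x, In x xs -> infinite_comp K x) &
        (forall i j, i < j < n -> ~ conn_avoid K (nth [::] xs i) (nth [::] xs j))].

End Ends.

(* Same number of ends (equality of suprema in nat + {oo}). *)
Definition same_num_ends (G G' : coxeter_graph) : Prop :=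
  forall n, ends_ge G n <-> ends_ge G' n.

(* Main.v *)
Require Import Defs.
From mathcomp Require Import all_boot all_order all_algebra.
From mathcomp Require Import ring zify.
From mathcomp Require Import boolp reals Rstruct trigo.

(**
An infinite Coxeter group W = <V> has more than one end if and only if it splits
over a finite special subgroup: V = A u B with no edge between A - B and B - A,
both differences nonempty, and W_C finite for C = A n B.  If it does not, removing
the elements of W one at a time by increasing length never disconnects the rest,
because the descent set of an element generates a finite subgroup.  Conversely
the half-spaces of the edges of the Bass-Serre tree of W = W_A *_{W_C} W_B give
two ends, and infinitely many unless W is the product of W_C with an infinite
dihedral group <a, b>; in that case W satisfies a law [x^k, y^k] = 1, which
ping-pong rules out otherwise.  Coxeter groups are residually finite, so laws
and infinity pass through the profinite completion.

The splitting passes through it as well.  Let W split over W_C, and let W' act on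
the profinite Bass-Serre tree T of W, whose edge stabilisers are finite.  Every
locally constant function on edges is a coboundary, so Smith theory over F_q
shows that a generator of W' fixes a connected nonempty subtree, and iterating
over a composition series of a finite dihedral group, that the fixed trees of
adjacent generators meet.  If W' does not split, a partition of unity argument
shows that all these trees have a common vertex; W' is dense in the completion of
W, so W_A or W_B would be dense in W, against the separability of special
subgroups.
*)

Set Implicit Arguments. Unset Strict Implicit. Unset Printing Implicit Defensive.
Import Order.TTheory GRing.Theory Num.Theory.

(** * Words and lengths *)

(** At a finite level N the tree T is only seen through the finite graph N \ T, which may have
    cycles. So every statement about the profinite tree is made for locally constant functions, and
    its conclusion may hold only at a finer level.

    Smith theory over F_q treats one prime at a time, and a dihedral group need not be a q-group. In
    dimension one this is harmless: a nonempty connected part of a tree is acyclic over every field.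
    The induction statement [fix_tree] therefore mentions boolean functions only, and the prime may
    change from one step to the next.

    The fixed trees of non-adjacent generators may be disjoint, so no Helly argument yields the
    common vertex. The cohomological argument in its place uses finite edge stabilisers: the
    generators fixing an edge form a spherical set, whose complement stays connected when W' does
    not split.

    Real coefficients serve the positivity of roots. Reduction modulo k takes place in the Z-span of
    the numbers cos (j pi / L), a finitely generated group, in which a nonzero element is not
    divisible by every k. *)

Lemma InP (T : eqType) (x : T) (s : seq T) : reflect (In x s) (x \in s).
Proof.
elim: s => [|y s IH]; first by constructor.
rewrite in_cons; apply: (iffP orP) => -[].
- by move/eqP->; left.
- by move/IH; right.
- by move->; left.
- by move/IH; right.
Qed.

Section Words.
Variable G : coxeter_graph.
Local Notation V := (cox_V G).
Local Notation word := (seq (cox_V G)).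
Implicit Types (x y z u w : word) (s t v : V).

Local Notation "x =c y" := (@cox_eq G x y) (at level 70).

Lemma ce_catl u x y : x =c y -> u ++ x =c u ++ y.
Proof.
elim=> {x y} [x|x y _ +|x y z _ + _ +|p w v|p w v v' e].
- exact: ce_refl.
- exact: ce_sym.
- exact: ce_trans.
- by rewrite !(catA u); apply: ce_inv.
- by rewrite !(catA u); apply: ce_braid.
Qed.

Lemma ce_catr u x y : x =c y -> x ++ u =c y ++ u.
Proof.
elim=> {x y} [x|x y _ +|x y z _ + _ +|p w v|p w v v' e].
- exact: ce_refl.
- exact: ce_sym.
- exact: ce_trans.
- by rewrite -!catA; apply: ce_inv.
- by rewrite -!catA; apply: ce_braid.
Qed.

Lemma ce_cat x x' y y' : x =c x' -> y =c y' -> x ++ y =c x' ++ y'.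
Proof. by move=> h1 h2; apply: ce_trans (ce_catr _ h1) (ce_catl _ h2). Qed.

Lemma ce_rev x y : x =c y -> rev x =c rev y.
Proof.
elim=> {x y} [x|x y _ +|x y z _ + _ +|p w v|p w v v' e].
- exact: ce_refl.
- exact: ce_sym.
- exact: ce_trans.
- by rewrite !rev_cat -catA; apply: ce_inv.
- rewrite !rev_cat -catA.
  have -> : rev (flatten (nseq (cox_m v v') [:: v; v'])) =
            flatten (nseq (cox_m v' v) [:: v'; v]).
    rewrite cox_m_sym; elim: (cox_m _ _) => //= n IH.
    rewrite !rev_cons IH -!cats1 -catA /=.
    by elim: (n) => //= k <-.
  by apply: ce_braid; rewrite cox_E_sym.
Qed.

Lemma ce_revr x : x ++ rev x =c [::].
Proof.
elim/last_ind: x => [|x v IH]; first exact: ce_refl.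
rewrite rev_rcons -cats1 -catA /=.
exact: ce_trans (ce_inv x (rev x) v) IH.
Qed.

Lemma ce_revl x : rev x ++ x =c [::].
Proof. by have := ce_revr (rev x); rewrite revK. Qed.

Lemma ce_revKl x y : rev x ++ (x ++ y) =c y.
Proof. by rewrite catA; apply: (ce_catr y (ce_revl x)). Qed.

Lemma ce_revKr x y : x ++ (rev x ++ y) =c y.
Proof. by rewrite catA; apply: (ce_catr y (ce_revr x)). Qed.

Lemma ce_rKrev x y : (x ++ y) ++ rev y =c x.
Proof. by rewrite -catA -[X in _ =c X]cats0; apply/ce_catl/ce_revr. Qed.

Lemma ce_rrevK x y : (x ++ rev y) ++ y =c x.
Proof. by have := ce_rKrev x (rev y); rewrite revK. Qed.

Lemma ce_cancell u x y : u ++ x =c u ++ y -> x =c y.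
Proof.
move=> /(ce_catl (rev u)) h.
exact: ce_trans (ce_sym (ce_revKl u x)) (ce_trans h (ce_revKl u y)).
Qed.

Lemma ce_cancelr u x y : x ++ u =c y ++ u -> x =c y.
Proof.
move=> /(ce_catr (rev u)) h.
exact: ce_trans (ce_sym (ce_rKrev x u)) (ce_trans h (ce_rKrev y u)).
Qed.

Lemma ce_mover u x y : x ++ u =c y -> x =c y ++ rev u.
Proof.
by move=> h; apply: (@ce_cancelr u); apply: ce_trans h (ce_sym (ce_rrevK y u)).
Qed.

Lemma ce_rev1 x y : x ++ rev y =c [::] <-> x =c y.
Proof.
split=> [/(ce_catr y)|/(ce_catr (rev y)) h]; last exact: ce_trans h (ce_revr y).
by move/(ce_trans (ce_sym (ce_rrevK x y))).
Qed.

Lemma ce_vv v : [:: v; v] =c [::].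
Proof. exact: (ce_inv [::] [::] v). Qed.

Lemma ce_rconsK x v : (x ++ [:: v]) ++ [:: v] =c x.
Proof. exact: (ce_rKrev x [:: v]). Qed.

(** All relators have even length, so elements carry a sign. It forces right multiplication by a
    generator to change [len] by exactly one. *)
Lemma ce_size x y : x =c y -> odd (size x) = odd (size y).
Proof.
elim=> {x y} [x|x y _ +|x y z _ -> _ ->|p w v|p w v v' e] //.
  by rewrite !size_cat /= !oddD /=.
rewrite !size_cat !oddD.
suff -> : odd (size (flatten (nseq (cox_m v v') [:: v; v']))) = false by [].
by elim: (cox_m _ _) => //= n ->.
Qed.

Lemma len_subproof w : exists n, `[< exists2 u, u =c w & size u = n >].
Proof. by exists (size w); apply/asboolP; exists w => //; apply: ce_refl. Qed.

Definition len w := ex_minn (len_subproof w).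

Lemma lenP w : exists2 u, u =c w & size u = len w.
Proof. by rewrite /len; case: ex_minnP => n /asboolP. Qed.

Lemma len_le u w : u =c w -> len w <= size u.
Proof.
by rewrite /len; case: ex_minnP => n _ min h; apply: min; apply/asboolP; exists u.
Qed.

Lemma len_size w : len w <= size w.
Proof. exact/len_le/ce_refl. Qed.

Lemma len_eq x y : x =c y -> len x = len y.
Proof.
have le a b : a =c b -> len a <= len b.
  have [u hu <-] := lenP b => h.
  exact/len_le/(ce_trans hu)/ce_sym.
by move=> h; apply/eqP; rewrite eqn_leq !le //; apply: ce_sym.
Qed.

Lemma len_odd x : odd (len x) = odd (size x).
Proof. by have [u /ce_size + <-] := lenP x. Qed.

Lemma len_cat x y : len (x ++ y) <= len x + len y.
Proof.
have [u hu <-] := lenP x; have [v hv <-] := lenP y.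
by rewrite -size_cat; apply/len_le/ce_cat.
Qed.

Lemma len0 x : len x = 0 -> x =c [::].
Proof. by have [u hu <-] := lenP x => /size0nil u0; rewrite u0 in hu; apply: ce_sym. Qed.

Lemma len_nil : len [::] = 0.
Proof. by apply/eqP; rewrite -leqn0 (len_size [::]). Qed.

Lemma len_rcons x v :
  len (x ++ [:: v]) = (len x).+1 \/ len x = (len (x ++ [:: v])).+1.
Proof.
have h1 : len (x ++ [:: v]) <= (len x).+1.
  by rewrite -addn1; apply: leq_trans (len_cat _ _) (leq_add _ (len_size _)).
have h2 : len x <= (len (x ++ [:: v])).+1.
  rewrite -addn1 -(len_eq (ce_rconsK x v)).
  exact: leq_trans (len_cat _ _) (leq_add _ (len_size [:: v])).
have : odd (len x) != odd (len (x ++ [:: v])).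
  by rewrite !len_odd size_cat oddD /= addbT; case: odd.
case: (ltngtP (len x) (len (x ++ [:: v]))) => [lt _|lt _|->]; last by rewrite eqxx.
- by left; apply/eqP; rewrite eqn_leq h1 lt.
- by right; apply/eqP; rewrite eqn_leq h2 lt.
Qed.

Lemma finite_ball n :
  exists l : seq word, forall x, len x <= n -> exists2 r, r \in l & x =c r.
Proof.
elim: n => [|n [l hl]].
  by exists [:: [::]] => x; rewrite leqn0 => /eqP/len0; exists [::]; rewrite ?mem_head.
exists (l ++ [seq r ++ [:: v] | r <- l, v <- enum V]) => x.
rewrite leq_eqVlt ltnS => /orP[/eqP hx|/hl[r hr e]]; last first.
  by exists r => //; rewrite mem_cat hr.
have [u hu] := lenP x; rewrite hx; case/lastP: u hu => [//|u v] hu.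
rewrite size_rcons => -[su].
have /hl[r hr e] : len u <= n by rewrite -su len_size.
exists (r ++ [:: v]).
  rewrite mem_cat; apply/orP; right.
  by apply/allpairsP; exists (r, v); rewrite /= hr mem_enum.
by apply: ce_trans (ce_sym hu) _; rewrite -cats1; apply: ce_catr.
Qed.

End Words.

(** * The geometric representation *)

Section Chebyshev.
Local Open Scope ring_scope.
Variable R : realType.
Implicit Types (th b : R) (k : nat).

(** The Chebyshev values (U_(k-1), U_(k-2)) at th / 2, started at (U_(-1), U_(-2)) = (0, -1). *)
Definition cheb th k : R * R := iter k (fun p => (th * p.1 - p.2, p.1)) (0, -1).

Lemma chebS th k :
  cheb th k.+1 = (th * (cheb th k).1 - (cheb th k).2, (cheb th k).1).
Proof. by []. Qed.

(** The identity U_(k-1)^2 - U_k U_(k-2) = 1, with U_k eliminated by the recursion. *)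
Lemma cheb_inv th k :
  (cheb th k).1 ^+ 2 + (cheb th k).2 ^+ 2 - th * (cheb th k).1 * (cheb th k).2 = 1.
Proof.
elim: k => [|k IH]; first by rewrite /=; ring.
by rewrite -IH chebS /=; ring.
Qed.

Lemma cheb_sin b k :
  (cheb (2 * cos b) k).1 * sin b = sin (k%:R * b) /\
  (cheb (2 * cos b) k).2 * sin b = sin (k%:R * b - b).
Proof.
elim: k => [|k [IH1 IH2]].
  by rewrite /= !mul0r sin0 add0r sinN mulN1r.
rewrite chebS /= mulrBl -[_ * _ * sin b]mulrA IH1 IH2; split; last first.
  by congr sin; rewrite -[k.+1%:R]natr1; ring.
have -> : k.+1%:R * b = k%:R * b + b by rewrite -natr1; ring.
rewrite sinB sinD; ring.
Qed.

Lemma cheb2 k : (cheb 2 k).1 = k%:R.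
Proof.
suff : (cheb 2 k).1 = k%:R /\ (cheb 2 k).2 = k%:R - 1 by case.
elim: k => [|k [IH1 IH2]]; first by rewrite /= sub0r.
rewrite chebS /= IH1 IH2 -[k.+1%:R]natr1; split; ring.
Qed.

End Chebyshev.

Section GeometricRepresentation.
Local Open Scope ring_scope.
Variables (R : realType) (G : coxeter_graph).
Local Notation V := (cox_V G).
Local Notation word := (seq (cox_V G)).
Local Notation E := (@cox_E G).
Local Notation m := (@cox_m G).
Local Notation "x =c y" := (@cox_eq G x y) (at level 70).
Local Notation vec := {ffun V -> R^o}.
Implicit Types (s t v w : V) (p q r : word) (x y : vec).

(* All angles pi / m(v, w) are multiples of pi / cox_lcm, so that every matrix
   entry lies in the span of the numbers cos (j * pi / cox_lcm). *)
Definition cox_lcm : nat := \prod_(p : V * V | E p.1 p.2) m p.1 p.2.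
(** The default 0 for non-edges gives angle 0 and [th] = 2, the value belonging to m = infinity. *)
Definition cox_ix v w : nat := if E v w then (cox_lcm %/ m v w)%N else 0%N.
Definition ang (i : nat) : R := i%:R * (pi / cox_lcm%:R).
Definition th v w : R := 2 * cos (ang (cox_ix v w)).

Lemma cox_lcm_gt0 : (0 < cox_lcm)%N.
Proof. by apply: prodn_cond_gt0 => -[v w] /= /cox_m_ge2/ltnW. Qed.

Lemma m_dvd_lcm v w : E v w -> (m v w %| cox_lcm)%N.
Proof. by move=> e; rewrite /cox_lcm (bigD1 (v, w)) //= dvdn_mulr. Qed.

Lemma lcm_neq0 : cox_lcm%:R != 0 :> R.
Proof. by rewrite pnatr_eq0 -lt0n cox_lcm_gt0. Qed.

Lemma m_gt0 v w : E v w -> 0 < (m v w)%:R :> R.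
Proof. by move/cox_m_ge2/ltnW; rewrite ltr0n. Qed.

Lemma ang_edge v w : E v w -> ang (cox_ix v w) = pi / (m v w)%:R.
Proof.
move=> e; rewrite /ang /cox_ix e.
have := divnK (m_dvd_lcm e); set q := (_ %/ _)%N => /(congr1 (fun n => n%:R : R)).
rewrite natrM => h; have m0 := m_gt0 e; have l0 := lcm_neq0.
have q0 : q%:R != 0 :> R by apply: contraNneq l0 => q0; rewrite -h q0 mul0r.
by rewrite -h; field; rewrite q0 lt0r_neq0.
Qed.

Lemma th_nonedge v w : ~~ E v w -> th v w = 2.
Proof. by move=> /negbTE e; rewrite /th /ang /cox_ix e mul0r cos0 mulr1. Qed.

Lemma th_sym v w : th v w = th w v.
Proof. by rewrite /th /cox_ix cox_E_sym cox_m_sym. Qed.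

Lemma sin_edge_gt0 v w : E v w -> 0 < sin (pi / (m v w)%:R : R).
Proof.
move=> e; apply: sin_gt0_pi; rewrite divr_gt0 ?pi_gt0 ?m_gt0 //=.
rewrite ltr_pdivrMr ?m_gt0 // ltr_pMr ?pi_gt0 //.
by rewrite ltr1n cox_m_ge2.
Qed.

Lemma cheb_edge v w : E v w -> (cheb (th v w) (m v w)).1 = 0.
Proof.
move=> e; have := (cheb_sin (pi / (m v w)%:R : R) (m v w)).1.
have -> : (m v w)%:R * (pi / (m v w)%:R) = pi :> R.
  by rewrite mulrC divfK ?lt0r_neq0 ?m_gt0.
rewrite sinpi /th (ang_edge e) => /eqP; rewrite mulf_eq0 => /orP[/eqP->//|/eqP h].
by have := sin_edge_gt0 e; rewrite h ltxx.
Qed.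

Lemma cheb_edge_ge0 v w k : (E v w -> (k <= m v w)%N) -> 0 <= (cheb (th v w) k).1.
Proof.
case: (boolP (E v w)) => e; last by rewrite th_nonedge // cheb2 ler0n.
move/(_ isT) => km; have := (cheb_sin (pi / (m v w)%:R : R) k).1.
rewrite /th (ang_edge e) => h.
rewrite -(pmulr_lge0 _ (sin_edge_gt0 e)) h; apply: sin_ge0_pi.
rewrite mulr_ge0 ?divr_ge0 ?pi_ge0 ?ler0n //=.
rewrite mulrCA ger_pMr ?pi_gt0 // ler_pdivrMr ?m_gt0 // mul1r ler_nat //.
Qed.

Lemma th_gt0 v w : (E v w -> m v w <> 2%N) -> 0 < th v w.
Proof.
case: (boolP (E v w)) => e; last by rewrite th_nonedge.
move/(_ isT) => m2; rewrite /th (ang_edge e) mulr_gt0 //.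
apply: cos_gt0_pihalf; have p0 := pi_gt0 R; have m0 := m_gt0 e.
have d0 : 0 < pi / (m v w)%:R :> R by rewrite divr_gt0.
apply/andP; split; first by apply: lt_trans d0; rewrite oppr_lt0 divr_gt0.
rewrite ltr_pM2l // ltf_pV2 ?posrE // ltr_nat ltn_neqAle cox_m_ge2 // andbT.
by rewrite eq_sym; apply/eqP.
Qed.

Definition al s : vec := [ffun u => (u == s)%:R].
(** Cartan matrix entries 2 and -2 cos (pi / m), that is, twice the Tits form; hence no factor 2 in
    [refl]. *)
Definition cf s u : R := if u == s then 2 else - th s u.
Definition form s x : R := \sum_u cf s u * x u.
Definition refl s x : vec := x - form s x *: al s.
Definition act p x : vec := foldr refl x p.

Lemma form_add s x y : form s (x + y) = form s x + form s y.
Proof. by rewrite /form -big_split; apply: eq_bigr => u _; rewrite ffunE mulrDr. Qed.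

Lemma form_scale s a x : form s (a *: x) = a * form s x.
Proof.
by rewrite /form mulr_sumr; apply: eq_bigr => u _; rewrite ffunE mulrCA.
Qed.

Lemma form_al s t : form s (al t) = cf s t.
Proof.
rewrite /form (bigD1 t) //= big1 => [|u /negbTE ut].
  by rewrite addr0 ffunE eqxx mulr1.
by rewrite ffunE ut mulr0.
Qed.

Lemma cf_diag s : cf s s = 2. Proof. by rewrite /cf eqxx. Qed.
Lemma cf_off s t : t != s -> cf s t = - th s t.
Proof. by rewrite /cf => /negbTE->. Qed.

Lemma refl_add s x y : refl s (x + y) = refl s x + refl s y.
Proof. by rewrite /refl form_add scalerDl opprD addrACA. Qed.

Lemma refl_scale s a x : refl s (a *: x) = a *: refl s x.
Proof. by rewrite /refl form_scale -scalerA -scalerBr. Qed.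

Lemma refl_al s : refl s (al s) = - al s.
Proof.
by rewrite /refl form_al cf_diag scaler_nat mulr2n opprD addrA subrr sub0r.
Qed.

Lemma refl_al_off s t : t != s -> refl s (al t) = al t + th s t *: al s.
Proof. by move=> ts; rewrite /refl form_al cf_off // scaleNr opprK. Qed.

Lemma reflK s x : refl s (refl s x) = x.
Proof.
rewrite {2}/refl -scaleNr refl_add refl_scale refl_al {1}/refl.
by rewrite scaleNr scalerN opprK subrK.
Qed.

Lemma act_cat p q x : act (p ++ q) x = act p (act q x).
Proof. by rewrite /act foldr_cat. Qed.

Lemma act_add p x y : act p (x + y) = act p x + act p y.
Proof. by elim: p => //= v w ->; rewrite refl_add. Qed.

Lemma act_scale p a x : act p (a *: x) = a *: act p x.
Proof. by elim: p => //= v w ->; rewrite refl_scale. Qed.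

Lemma act_opp p x : act p (- x) = - act p x.
Proof. by rewrite -scaleN1r act_scale scaleN1r. Qed.

Lemma act_sub p x y : act p (x - y) = act p x - act p y.
Proof. by rewrite act_add act_opp. Qed.

Lemma act_sum p (I : finType) (P : pred I) (F : I -> vec) :
  act p (\sum_(i | P i) F i) = \sum_(i | P i) act p (F i).
Proof.
apply: (big_morph (act p) (act_add p)).
by have := act_scale p 0 0; rewrite !scale0r.
Qed.

Lemma vec_al x : x = \sum_t x t *: al t.
Proof.
apply/ffunP => u; rewrite sum_ffunE (bigD1 u) //= big1 => [|t /negbTE tu].
  by rewrite !ffunE eqxx addr0; apply/esym/mulr1.
by rewrite !ffunE eq_sym tu; apply: mulr0.
Qed.

(** Valid for every vector x. Both coefficients contain the factor X, which vanishes for k = m: this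
    is why the braid relators act trivially. *)
Lemma act_dihedral v w k x : v != w ->
  let X := (cheb (th v w) k).1 in let Y := (cheb (th v w) k).2 in
  let a := form w x in let b := form v x in
  act (flatten (nseq k [:: v; w])) x =
    x - (X * (a * (th v w * X - Y) + b * X)) *: al v
      - (X * (a * X + b * Y)) *: al w.
Proof.
move=> vw /=; elim: k => [|k IH].
  by rewrite /= !mul0r !scale0r !subr0.
have -> : flatten (nseq k.+1 [:: v; w]) = [:: v; w] ++ flatten (nseq k [:: v; w]) by [].
rewrite act_cat IH chebS /=.
have := cheb_inv (th v w) k.
set X := (cheb _ k).1; set Y := (cheb _ k).2; set t := th v w => inv.
set a := form w x; set b := form v x.
have wv : w != v by rewrite eq_sym.
have fw (c d : R) : form w (x - c *: al v - d *: al w) = a + c * t - 2 * d.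
  by rewrite -!scaleNr !form_add !form_scale !form_al cf_diag cf_off // th_sym -/t -/a; ring.
have fv (c d : R) : form v (x - c *: al v - d *: al w) = b - 2 * c + d * t.
  by rewrite -!scaleNr !form_add !form_scale !form_al cf_diag cf_off // -/t -/b; ring.
have rw (c d : R) : refl w (x - c *: al v - d *: al w)
    = x - c *: al v - (a + c * t - d) *: al w.
  rewrite {1}/refl fw -addrA -opprD -scalerDl; congr (_ - _ *: _); ring.
have rv (c d : R) : refl v (x - c *: al v - d *: al w)
    = x - (b - c + d * t) *: al v - d *: al w.
  rewrite {1}/refl fv [LHS]addrAC; congr (_ - _).
  by rewrite -addrA -opprD -scalerDl; congr (_ - _ *: _); ring.
rewrite rw rv; congr (x - _ *: _ - _ *: _).
  apply/eqP; rewrite -subr_eq0; apply/eqP.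
  transitivity ((b + t * a) * (1 - (X ^+ 2 + Y ^+ 2 - t * X * Y))); first by ring.
  by rewrite inv subrr mulr0.
apply/eqP; rewrite -subr_eq0; apply/eqP.
transitivity (a * (1 - (X ^+ 2 + Y ^+ 2 - t * X * Y))); first by ring.
by rewrite inv subrr mulr0.
Qed.

Lemma act_ce p q x : p =c q -> act p x = act q x.
Proof.
move=> h; elim: h x => {p q} [//|p q _ IH x|p q z _ IH1 _ IH2 x|p q v x|p q v v' e x].
- by rewrite IH.
- by rewrite IH1.
- by rewrite !act_cat /= reflK.
- rewrite !act_cat act_dihedral /=.
    by rewrite (cheb_edge e) !mul0r !scale0r !subr0.
  by apply: contraTneq e => ->; rewrite cox_E_irr.
Qed.

Lemma act_revK p x : act (rev p) (act p x) = x.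
Proof. by rewrite -act_cat (act_ce _ (ce_revl p)). Qed.

Lemma act_supp (S : {set V}) p x v : all (mem S) p -> v \notin S -> act p x v = x v.
Proof.
elim: p => //= s p IH /andP[sS pS] vS; rewrite -(IH pS vS) !ffunE.
have /negbTE-> : v != s by apply: contraNneq vS => ->.
by rewrite [_ *: _]mulr0 subr0.
Qed.

End GeometricRepresentation.

(** * Positivity of roots *)

Section AlternatingWords.
Variable G : coxeter_graph.
Local Notation V := (cox_V G).
Local Notation "x =c y" := (@cox_eq G x y) (at level 70).
Implicit Types s t : V.

(* The last letter is t. *)
Fixpoint alt s t k : seq V :=
  if k is k'.+1 then (if odd k' then s else t) :: alt s t k' else [::].

Lemma size_alt s t k : size (alt s t k) = k.
Proof. by elim: k => //= k ->. Qed.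

Lemma alt_double s t k : alt s t k.*2 = flatten (nseq k [:: s; t]).
Proof. by elim: k => //= k <-; rewrite odd_double. Qed.

Lemma alt_rcons s t k : alt s t k.+1 = alt t s k ++ [:: t].
Proof.
elim: k => //= k IH; rewrite -/(alt s t k.+1) -IH /=.
by case: odd.
Qed.

Lemma alt_suffix s t a b : exists2 z, alt s t (a + b) = z ++ alt s t b & size z = a.
Proof.
elim: a => [|a [z e sz]]; first by exists [::].
by exists ((if odd (a + b) then s else t) :: z); rewrite /= ?e ?sz.
Qed.

Lemma ce_cons s (x y : seq V) : x =c y -> s :: x =c s :: y.
Proof. exact: (@ce_catl G [:: s]). Qed.

Lemma ce_consK s (x : seq V) : s :: s :: x =c x.
Proof. exact: (ce_inv [::] x s). Qed.

Lemma alt_braid s t : cox_E s t -> alt s t (cox_m s t) =c alt t s (cox_m s t).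
Proof.
move=> e; set m := cox_m s t.
(* The letters of the relator of length 2m are moved one by one to the other side; the claim is the
   case i = m. *)
suff H i : (i <= m.*2)%N -> alt s t (m.*2 - i) =c alt t s i.
  by have := H m; rewrite -addnn addnK leq_addr; apply.
elim: i => [_|i IH lt].
  by rewrite subn0 alt_double; have := ce_braid [::] [::] e; rewrite cats0.
have := IH (ltnW lt).
have -> : (m.*2 - i = (m.*2 - i.+1).+1)%N by rewrite subnSK.
move=> /=; rewrite oddB // odd_double /=.
case: (odd i) => /=.
  move=> /(ce_cons t) h; exact: ce_trans (ce_sym (ce_consK _ _)) h.
move=> /(ce_cons s) h; exact: ce_trans (ce_sym (ce_consK _ _)) h.
Qed.

End AlternatingWords.

Section Positivity.
Local Open Scope ring_scope.
Variables (R : realType) (G : coxeter_graph).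
Local Notation V := (cox_V G).
Local Notation word := (seq (cox_V G)).
Local Notation E := (@cox_E G).
Local Notation m := (@cox_m G).
Local Notation "x =c y" := (@cox_eq G x y) (at level 70).
Local Notation vec := {ffun V -> R^o}.
Local Notation al := (@al R G).
Local Notation act := (@act R G).
Implicit Types (s t v : V) (p q w x : word).

Definition vge0 (y : vec) := forall u, 0 <= y u :> R.

Lemma act_alt s t k : t != s ->
  act (alt s t k) (al s) =
    (cheb (th R s t) k.+1).1 *: al (if odd k then t else s) +
    (cheb (th R s t) k).1 *: al (if odd k then s else t).
Proof.
move=> ts; elim: k => [|k IH].
  by rewrite /= mulr0 sub0r opprK scale1r scale0r addr0.
rewrite [LHS]/= -/(act _ _) IH (chebS _ k.+1) [(cheb _ k.+1).2]/=.
move: (cheb _ k.+1).1 (cheb _ k).1 => X Y {IH}.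
rewrite refl_add !refl_scale.
have st : s != t by rewrite eq_sym.
have aux (a b : vec) (c : R) : X *: (a + c *: b) + Y *: - b = (c * X - Y) *: b + X *: a.
  by rewrite scalerDr scalerN scalerA scalerBl -addrA addrC mulrC.
rewrite oddS; case: (odd k) => /=; first by rewrite refl_al refl_al_off // aux.
by rewrite refl_al refl_al_off // (th_sym R t s) aux.
Qed.

(** Let t be the last letter of a reduced word of w, and split off from w the longest alternating
    suffix in s and t with additive lengths. Both s and t lengthen the remaining v, so by induction
    v sends [al s] and [al t] to nonnegative vectors, and the suffix sends [al s] to a nonnegative
    combination of these two roots. *)
Lemma pos_root w s : len (w ++ [:: s]) = (len w).+1 -> vge0 (act w (al s)).
Proof.
have [n] : exists n, (len w <= n)%N by exists (len w).
elim: n w s => [|n IH] w s.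
  rewrite leqn0 => /eqP/len0 w0 _ u.
  by rewrite (act_ce _ w0) ffunE ler0n.
move=> wn ws; case: (posnP (len w)) => [/len0 w0 u|wpos].
  by rewrite (act_ce _ w0) ffunE ler0n.
have [u hu su] := lenP w.
case/lastP: u hu su => [|u t]; first by move=> _ e; rewrite -e in wpos.
rewrite -cats1 => hu; rewrite size_cat addn1 => su.
have lu : ((len u).+1 = len w)%N.
  apply/eqP; rewrite eqn_leq -{1}su ltnS len_size /= -(len_eq hu) -addn1.
  exact: leq_trans (len_cat _ _) (leq_add _ (len_size _)).
have ts : t != s.
  apply/eqP => ts; move: ws.
  rewrite -(len_eq (ce_catr _ hu)) -ts (len_eq (ce_rconsK _ _)) -lu => /eqP.
  by rewrite ltn_eqF.
pose P k := `[< exists2 v, w =c v ++ alt s t k & (len v + k = len w)%N >].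
have P1 : P 1%N by apply/asboolP; exists u; rewrite ?addn1 //; apply: ce_sym.
have Pmax k : P k -> (k <= len w)%N by move=> /asboolP[v _ <-]; rewrite leq_addl.
have exP : exists k, P k by exists 1%N.
case: (ex_maxnP exP Pmax) => k /asboolP[v wv lv] kmax.
have k0 : (0 < k)%N by apply: kmax P1.
have lvn : (len v <= n)%N.
  by rewrite -ltnS; apply: leq_trans wn; rewrite -lv -{1}[len v]addn0 ltn_add2l.
have next : len (v ++ [:: if odd k then s else t]) = (len v).+1.
  have [//|e] := len_rcons v (if odd k then s else t).
  suff /kmax : P k.+1 by rewrite ltnn.
  apply/asboolP; exists (v ++ [:: if odd k then s else t]).
    apply: ce_trans wv _; rewrite /= -catA; apply: ce_catl; apply: ce_sym.
    exact: ce_consK.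
  by rewrite addnS -addSn -e.
have first : len (v ++ [:: if odd k then t else s]) = (len v).+1.
  have [//|e] := len_rcons v (if odd k then t else s).
  have : (len w <= len (v ++ [:: if odd k then t else s]) + k.-1)%N.
    rewrite (len_eq wv); case: (k) k0 => // k' _ /=.
    have -> : (if ~~ odd k' then t else s) = (if odd k' then s else t) by case: odd.
    rewrite -[_ :: _]cat1s catA; apply: leq_trans (len_cat _ _) _.
    by rewrite leq_add2l -[X in (_ <= X)%N](size_alt s t k') len_size.
  by rewrite -lv {1}e addSn ltnNge leq_add2l leq_pred.
(* A suffix of m or more letters could be rewritten to end in s, and ws would be shorter than w. So
   k < m, which keeps the Chebyshev coefficients nonnegative. *)
have kE : E s t -> (k.+1 <= m s t)%N.
  move=> e; rewrite ltnNge; apply/negP => mk.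
  have [z ez sz] := alt_suffix s t (k - m s t) (m s t).
  rewrite subnK // in ez.
  have m0 : (0 < m s t)%N by apply: ltnW; apply: cox_m_ge2.
  have w1 : w ++ [:: s] =c v ++ z ++ alt s t (m s t).-1.
    apply: ce_trans (ce_catr _ wv) _; rewrite ez -!catA.
    apply/ce_catl/ce_catl; apply: ce_trans (ce_catr _ (alt_braid e)) _.
    rewrite -{1}(prednK m0) alt_rcons; exact: ce_rconsK.
  have : (len (w ++ [:: s]) < len w)%N.
    rewrite (len_eq w1) -lv; apply: leq_ltn_trans (len_cat _ _) _.
    rewrite ltn_add2l; apply: leq_ltn_trans (len_size _) _.
    by rewrite size_cat size_alt sz -ltn_subRL subKn // prednK.
  by rewrite ws ltnNge leqnSn.
have vs : vge0 (act v (al s)).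
  by apply: IH => //; case: (odd k) next first.
have vt : vge0 (act v (al t)).
  by apply: IH => //; case: (odd k) next first.
move=> u'; rewrite (act_ce _ wv) act_cat act_alt // act_add !act_scale 2!ffunE.
have X1 : 0 <= (cheb (th R s t) k.+1).1 by apply: cheb_edge_ge0.
have X0 : 0 <= (cheb (th R s t) k).1 by apply: cheb_edge_ge0 => /kE/ltnW.
rewrite [X in _ + X]ffunE.
by rewrite addr_ge0 // mulr_ge0 //; case: odd.
Qed.

Lemma neg_root w s : len w = (len (w ++ [:: s])).+1 -> vge0 (- act w (al s)).
Proof.
move=> h; have e : act w (al s) = - act (w ++ [:: s]) (al s).
  by rewrite act_cat /= refl_al act_opp opprK.
rewrite e opprK; apply: pos_root.
by rewrite (len_eq (ce_rconsK w s)).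
Qed.

Lemma act_al_neq0 w s : ~ (vge0 (act w (al s)) /\ vge0 (- act w (al s))).
Proof.
move=> [p n]; have e : act w (al s) = 0.
  apply/ffunP => u; rewrite [RHS]ffunE; apply/eqP; rewrite eq_le p andbT.
  by have := n u; rewrite ffunE oppr_ge0.
have := act_revK w (al s); rewrite e.
have -> : act (rev w) 0 = 0 by have := act_scale (rev w) 0 (0 : vec); rewrite !scale0r.
by move/ffunP/(_ s); rewrite !ffunE eqxx => /eqP; rewrite eq_sym oner_eq0.
Qed.

Lemma pos_rootP w s : vge0 (act w (al s)) -> len (w ++ [:: s]) = (len w).+1.
Proof. by case: (len_rcons w s) => // /neg_root n p; case: (@act_al_neq0 w s). Qed.

Lemma neg_rootP w s : vge0 (- act w (al s)) -> len w = (len (w ++ [:: s])).+1.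
Proof. by case: (len_rcons w s) => // /pos_root p n; case: (@act_al_neq0 w s). Qed.

Lemma act_span (S : {set V}) x w s : all (mem S) x -> s \in S ->
  act (w ++ x) (al s) = \sum_(t in S) act x (al s) t *: act w (al t).
Proof.
move=> xS sS; rewrite act_cat {1}(vec_al (act x (al s))) act_sum.
rewrite (bigID (mem S)) /= [X in _ + X]big1 ?addr0 => [|t tS].
  by apply: eq_bigr => t _; rewrite act_scale.
rewrite (act_supp _ xS tS) ffunE; have /negbTE-> : t != s by apply: contraNneq tS => ->.
by rewrite scale0r; have := act_scale w 0 (0 : vec); rewrite !scale0r.
Qed.

Lemma vge0_span (S : {set V}) (c : V -> R) (F : V -> vec) :
  (forall t, t \in S -> 0 <= c t) -> (forall t, t \in S -> vge0 (F t)) ->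
  vge0 (\sum_(t in S) c t *: F t).
Proof.
move=> c0 F0 u; rewrite sum_ffunE; apply: sumr_ge0 => t tS.
by rewrite ffunE; apply: mulr_ge0; [apply: c0|apply: F0].
Qed.

(** The vector w x al_s combines the positive roots w al_t, t in S, with the coordinates of x al_s,
    all of one sign. So s lengthens w x exactly when it lengthens x. *)
Lemma len_up (S : {set V}) w x :
  (forall t, t \in S -> len (w ++ [:: t]) = (len w).+1) -> all (mem S) x ->
  len (w ++ x) = (len w + len x)%N.
Proof.
move=> up; elim/last_ind: x => [|x s IH].
  by rewrite cats0 len_nil addn0.
rewrite all_rcons => /andP[sS xS]; rewrite -cats1 catA.
have eq : act (w ++ x) (al s) = _ := act_span w xS sS.
have wS t : t \in S -> vge0 (act w (al t)) by move=> tS; apply/pos_root/up.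
case: (len_rcons x s) => e.
  rewrite pos_rootP ?IH // ?e ?addnS // eq; apply: vge0_span => // t _.
  exact: pos_root.
suff : len (w ++ x) = (len ((w ++ x) ++ [:: s])).+1.
  by rewrite IH // e addnS => -[].
apply: neg_rootP; rewrite eq -sumrN.
under eq_bigr do rewrite -scaleNr.
apply: vge0_span => // t _.
by have := neg_root e t; rewrite ffunE.
Qed.

(** The same expansion with all w al_t negative: s shortens w x exactly when it lengthens x. *)
Lemma len_down (S : {set V}) w x :
  (forall t, t \in S -> len w = (len (w ++ [:: t])).+1) -> all (mem S) x ->
  (len (w ++ x) + len x)%N = len w.
Proof.
move=> down; elim/last_ind: x => [|x s IH].
  by rewrite cats0 len_nil addn0.
rewrite all_rcons => /andP[sS xS]; rewrite -cats1 catA.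
have eq : act (w ++ x) (al s) = _ := act_span w xS sS.
have wS t : t \in S -> vge0 (- act w (al t)) by move=> tS; apply/neg_root/down.
case: (len_rcons x s) => e.
  have := IH xS; rewrite (@neg_rootP (w ++ x) s) ?e ?addSn ?addnS //.
  rewrite eq -sumrN; under eq_bigr do rewrite -scalerN.
  by apply: vge0_span => // t _; apply: pos_root.
rewrite (@pos_rootP (w ++ x) s) ?addSn -?addnS -?e ?IH //.
rewrite eq; under eq_bigr do rewrite -[_ *: _]opprK -scaleNr -scalerN.
apply: vge0_span => // t _.
by have := neg_root e t; rewrite ffunE.
Qed.

End Positivity.

(** * Residual finiteness *)

Section FinitelyGenerated.
Local Open Scope ring_scope.

(** Induction on the number of generators, without a basis. A generator rationally dependent on the
    earlier ones is removed after scaling by its denominator; for an independent one, the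
    coefficient of g n in r is determined and restricts k. *)
Lemma fg_not_divisible (R : numDomainType) (g : nat -> R) n (r : R) : r != 0 ->
  exists2 k, (0 < k)%N & forall c : nat -> int,
    r <> k%:R * \sum_(i < n) (c i)%:~R * g i.
Proof.
elim: n r => [|n IH] r r0.
  by exists 1%N => // c; rewrite big_ord0 mulr0; apply/eqP.
have [[d d0 [e de]]|indep] := pselect (exists2 d : int, d != 0 &
    exists e : nat -> int, d%:~R * g n = \sum_(i < n) (e i)%:~R * g i).
  have [|k k0 hk] := IH (d%:~R * r); first by rewrite mulf_neq0 ?intr_eq0.
  exists k => // c rc; apply: (hk (fun i => d * c i + c n * e i)).
  rewrite rc big_ord_recr /= mulrCA mulrDr (mulrCA d%:~R (c n)%:~R) de !mulr_sumr.
  rewrite -big_split mulr_sumr; apply: eq_bigr => i _ /=.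
  by rewrite rmorphD !rmorphM /=; ring.
have [[d d0 [b db]]|nodep] := pselect (exists2 d : int, d != 0 &
    exists b : nat -> int, d%:~R * r = \sum_(i < n.+1) (b i)%:~R * g i); last first.
  exists 1%N => // c rc; apply: nodep; exists 1 => //; exists c.
  by rewrite rc !mul1r.
have key k (c : nat -> int) : r = k%:R * (\sum_(i < n.+1) (c i)%:~R * g i) ->
    b n = k%:Z * d * c n.
  move=> rc; apply/eqP; rewrite -subr_eq0; apply/negPn/negP => dn0; apply: indep.
  exists (b n - k%:Z * d * c n) => //; exists (fun i => k%:Z * d * c i - b i).
  have : d%:~R * r = d%:~R * (k%:R * (\sum_(i < n.+1) (c i)%:~R * g i)) by rewrite -rc.
  rewrite db !big_ord_recr /= mulrDr mulrDr !mulr_sumr.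
  set A := \sum_(i < n) _; set B := \sum_(i < n) _ => h.
  transitivity (B - A); last first.
    rewrite /A /B -sumrB; apply: eq_bigr => i _.
    by rewrite rmorphB !rmorphM /= -pmulrn; ring.
  rewrite rmorphB !rmorphM /= -pmulrn mulrBl.
  apply/eqP; rewrite subr_eq -addrA -[_ == _]/(_ == _); apply/eqP.
  rewrite -[LHS](addKr A) h; ring.
have [bn0|bn0] := eqVneq (b n) 0.
  have [k k0 hk] := IH r r0; exists k => // c rc; apply: (hk c).
  have := key k c rc; rewrite bn0 => /eqP; rewrite eq_sym !mulf_eq0 (negPf d0) orbF.
  have -> : (k%:Z == 0) = false by case: (k) k0.
  move=> /eqP cn0.
  by rewrite {1}rc big_ord_recr /= cn0 mul0r addr0.
(* The equation b n = k d c n makes k divide the nonzero integer b n, which this k exceeds. *)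
exists `|b n|%N.+1 => // c /key e.
have /dvdn_leq : (`|b n|.+1 %| `|b n|)%N.
  by apply/dvdnP; exists `|(d * c n)%R|%N; rewrite {1}e -mulrA abszM mulnC.
by rewrite absz_gt0 bn0 ltnn => /(_ isT).
Qed.

End FinitelyGenerated.

Lemma finite_classes (T : Type) (I : finType) (cl : T -> I) :
  exists reps : seq T, forall x, exists2 r, In r reps & cl r = cl x.
Proof.
suff [reps hr] : exists reps : seq T,
    forall x, cl x \in enum I -> exists2 r, In r reps & cl r = cl x.
  by exists reps => x; apply: hr; rewrite mem_enum.
elim: (enum I) => [|i s [reps IH]]; first by exists [::].
have [[y yi]|no] := pselect (exists y, cl y = i).
  exists (y :: reps) => x; rewrite in_cons => /orP[/eqP xi|/IH[r rr e]].
    by exists y; rewrite ?yi ?xi //; left.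
  by exists r => //; right.
exists reps => x; rewrite in_cons => /orP[/eqP xi|/IH //].
by case: no; exists x.
Qed.

Section CongruenceQuotients.
Local Open Scope ring_scope.
Variables (R : realType) (G : coxeter_graph).
Local Notation V := (cox_V G).
Local Notation word := (seq (cox_V G)).
Local Notation "x =c y" := (@cox_eq G x y) (at level 70).
Local Notation vec := {ffun V -> R^o}.
Local Notation al := (@al R G).
Local Notation act := (@act R G).
Local Notation ang := (@ang R G).
Local Notation L := (cox_lcm G).
Implicit Types (s t v : V) (p q w : word) (x y : vec) (r : R).

(** A finitely generated group of reals, stable under multiplication by each [th v t] because 2 cos
    a cos b = cos (a + b) + cos (a - b). The range j < 2L is a full period. *)
Definition lattice r :=
  exists c : nat -> int, r = \sum_(j < L.*2) (c j)%:~R * cos (ang j).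

Lemma lattice0 : lattice 0.
Proof. by exists (fun=> 0); rewrite big1 // => j _; rewrite mul0r. Qed.

Lemma latticeD r r' : lattice r -> lattice r' -> lattice (r + r').
Proof.
move=> [c ->] [c' ->]; exists (fun j => c j + c' j).
by rewrite -big_split; apply: eq_bigr => j _; rewrite rmorphD mulrDl.
Qed.

Lemma latticeZ (n : int) r : lattice r -> lattice (n%:~R * r).
Proof.
move=> [c ->]; exists (fun j => n * c j).
by rewrite mulr_sumr; apply: eq_bigr => j _; rewrite rmorphM mulrA.
Qed.

Lemma latticeN r : lattice r -> lattice (- r).
Proof. by move=> /(latticeZ (-1)); rewrite rmorphN1 mulN1r. Qed.

Lemma lattice_sum (I : finType) (P : pred I) (F : I -> R) :
  (forall i, P i -> lattice (F i)) -> lattice (\sum_(i | P i) F i).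
Proof. by move=> h; apply: big_ind => //; [exact: lattice0|exact: latticeD]. Qed.

Lemma ang_period (i : nat) : cos (ang (i + L.*2)) = cos (ang i).
Proof.
rewrite /ang natrD mulrDl -muln2 natrM.
have -> : L%:R * 2 * (pi / L%:R) = pi *+ 2 :> R.
  by rewrite mulr2n; have := lcm_neq0 R G => l0; field.
by rewrite cosD2pi.
Qed.

Lemma lattice_cos (i : nat) : lattice (cos (ang i)).
Proof.
have L0 : (0 < L.*2)%N by rewrite double_gt0 cox_lcm_gt0.
rewrite (divn_eq i L.*2); elim: (i %/ _)%N => [|n IH]; last first.
  by rewrite mulSn -addnA addnC ang_period.
exists (fun j => (j == i %% L.*2)%N%:Z).
rewrite mul0n add0n (bigD1 (Ordinal (ltn_pmod i L0))) //= eqxx mul1r.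
rewrite big1 ?addr0 // => j; rewrite -val_eqE /= => /negbTE->.
by rewrite mul0r.
Qed.

Lemma lattice1 : lattice 1.
Proof. by have := lattice_cos 0; rewrite /ang mul0r cos0. Qed.

Lemma lattice_th v t r : lattice r -> lattice (th R v t * r).
Proof.
move=> [c ->]; rewrite mulr_sumr; apply: lattice_sum => j _.
rewrite mulrCA; apply: latticeZ; rewrite /th.
set i := cox_ix v t.
have -> : 2 * cos (ang i) * cos (ang j) = cos (ang i + ang j) + cos (ang i - ang j).
  by rewrite cosD cosB; ring.
apply: latticeD; first by rewrite /ang -mulrDl -natrD; apply: lattice_cos.
case: (leqP i j) => ij; last first.
  have -> : ang i - ang j = ang (i - j) by rewrite /ang natrB ?mulrBl // ltnW.
  exact: lattice_cos.
rewrite -cosN opprB; have -> : ang j - ang i = ang (j - i) by rewrite /ang natrB ?mulrBl.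
exact: lattice_cos.
Qed.

Definition vlattice x := forall u, lattice (x u).

Lemma vlattice_act p x : vlattice x -> vlattice (act p x).
Proof.
move=> hx; elim: p => //= s p IH u.
rewrite !ffunE [_ *: _]mulrC; case: (u == s); last first.
  by rewrite mul0r oppr0 addr0; apply: IH.
rewrite mul1r; apply: latticeD (IH u) _; apply: latticeN.
apply: lattice_sum => t _; rewrite /cf; case: eqP => _.
  exact: (@latticeZ 2).
by rewrite mulNr; apply/latticeN/lattice_th.
Qed.

Definition klattice (k : nat) r := exists2 r', lattice r' & r = k%:R * r'.

Lemma klattice0 k : klattice k 0.
Proof. by exists 0; rewrite ?mulr0 //; apply: lattice0. Qed.

Lemma klatticeD k r r' : klattice k r -> klattice k r' -> klattice k (r + r').
Proof.
by move=> [a la ->] [b lb ->]; exists (a + b); rewrite ?mulrDr //; apply: latticeD.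
Qed.

Lemma klatticeZ k (n : int) r : klattice k r -> klattice k (n%:~R * r).
Proof. by move=> [a la ->]; exists (n%:~R * a); rewrite 1?mulrCA //; apply: latticeZ. Qed.

Lemma klatticeN k r : klattice k r -> klattice k (- r).
Proof. by move=> /(klatticeZ (-1)); rewrite rmorphN1 mulN1r. Qed.

Lemma klattice_sum k (I : finType) (P : pred I) (F : I -> R) :
  (forall i, P i -> klattice k (F i)) -> klattice k (\sum_(i | P i) F i).
Proof. by move=> h; apply: big_ind => //; [exact: klattice0|exact: klatticeD]. Qed.

Lemma klattice_act k p x : (forall u, klattice k (x u)) -> forall u, klattice k (act p x u).
Proof.
move=> hx; have /choice[y hy] : forall u, exists r', lattice r' /\ x u = k%:R * r'.
  by move=> u; have [a la e] := hx u; exists a.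
have -> : x = (k%:R : R) *: ([ffun u => y u] : vec).
  by apply/ffunP => u; rewrite !ffunE (hy u).2.
move=> u; rewrite act_scale ffunE; exists (act p [ffun u => y u] u) => //.
by apply: vlattice_act => v; rewrite ffunE; case: (hy v).
Qed.

Definition congr_kernel (k : nat) w :=
  forall x, vlattice x -> forall u, klattice k (act w x u - x u).

(** A word is recorded by its action on the finitely many generators [b d] of the lattice vectors,
    with integer coordinates reduced modulo k. These coordinates are chosen, not unique: equal
    residues imply congruence, and that direction suffices. *)
Lemma congr_class k : (0 < k)%N -> exists (I : finType) (cl : word -> I),
  forall p q, cl p = cl q ->
    forall x, vlattice x -> forall u, klattice k (act p x u - act q x u).
Proof.
case: k => // k _.
pose b (d : V * 'I_(L.*2)) : vec := cos (ang d.2) *: al d.1.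
have bL d : vlattice (b d).
  move=> u; rewrite !ffunE; case: (u == _) => /=.
    by rewrite [_ *: _]mulr1; apply: lattice_cos.
  by rewrite [_ *: _]mulr0; apply: lattice0.
have /choice[c hc] : forall z : word * (V * 'I_(L.*2)) * V, exists c : nat -> int,
    act z.1.1 (b z.1.2) z.2 = \sum_(j < L.*2) (c j)%:~R * cos (ang j).
  by case=> [[p d] u]; apply: (vlattice_act p (bL d)).
exists {ffun (V * 'I_(L.*2)) * V * 'I_(L.*2) -> 'I_k.+1}.
exists (fun p => [ffun z : V * 'I_(L.*2) * V * 'I_(L.*2) =>
  inord `|(c (p, z.1.1, z.1.2) z.2 %% k.+1%:Z)%Z|]) => p q /ffunP cl.
have base d u : klattice k.+1 (act p (b d) u - act q (b d) u).
  rewrite (hc (p, d, u)) (hc (q, d, u)) -sumrB; apply: klattice_sum => j _.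
  rewrite -mulrBl -rmorphB; have := cl (d, u, j); rewrite !ffunE /= => /(congr1 (@nat_of_ord _)).
  set a := c _ j; set a' := c _ j.
  have lt (z : int) : (`|(z %% k.+1%:Z)%Z| < k.+1)%N.
    by rewrite -ltz_nat gez0_abs ?modz_ge0 // ltz_pmod.
  rewrite !inordK // => e.
  have : (a %% k.+1%:Z = a' %% k.+1%:Z)%Z.
    by rewrite -[LHS]gez0_abs ?modz_ge0 // -[RHS]gez0_abs ?modz_ge0 // e.
  move/eqP; rewrite eqz_mod_dvd => /dvdzP[z ->].
  exists (z%:~R * cos (ang j)); first exact/latticeZ/lattice_cos.
  by rewrite rmorphM /= mulrCA mulrA.
move=> x /choice[e he] u.
have xe : x = \sum_(d : V * 'I_(L.*2)) ((e d.1 d.2)%:~R : R) *: b d.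
  rewrite {1}(vec_al x).
  rewrite -(pair_bigA _ (fun t (j : 'I_(L.*2)) => ((e t j)%:~R : R) *: b (t, j))) /=.
  apply: eq_bigr => t _; rewrite he scaler_suml; apply: eq_bigr => j _.
  by rewrite /b scalerA.
rewrite xe !act_sum !sum_ffunE -sumrB; apply: klattice_sum => d _.
have scaleE (a : R) (y z : vec) : (a *: y) u - (a *: z) u = a * (y u - z u).
  by rewrite 2!ffunE -scalerBr.
by rewrite (act_scale p) (act_scale q) scaleE; apply/klatticeZ/base.
Qed.

Lemma congr_kernel_normal k : (0 < k)%N -> @fi_normal (cox_gops G) (congr_kernel k).
Proof.
move=> k0; split; [|split; [|split; [|split; [|split]]]].
- by move=> p q e h x hx u; rewrite -(act_ce _ e); apply: h.
- by move=> x hx u /=; rewrite subrr; apply: klattice0.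
- move=> p q hp hq x hx u; rewrite /= act_cat.
  rewrite -[X in klattice _ X](subrKA (act q x u)).
  by apply: klatticeD; [apply/hp/vlattice_act|apply: hq].
- move=> p hp x hx u /=.
  have := hp _ (vlattice_act (rev p) hx) u; rewrite -act_cat (act_ce _ (ce_revr p)) /=.
  by move/klatticeN; rewrite opprB.
- move=> p g hp x hx u; rewrite /= -catA !act_cat.
  have -> : x u = act (rev g) (act g x) u by rewrite act_revK.
  have -> : act (rev g) (act p (act g x)) u - act (rev g) (act g x) u =
            act (rev g) (act p (act g x) - act g x) u by rewrite act_sub [RHS]ffunE [in RHS]ffunE.
  apply: klattice_act => v; rewrite ffunE [X in _ + X]ffunE; exact/hp/vlattice_act.
- have [I [cl hcl]] := congr_class k0.
  have [reps hr] := finite_classes cl; exists reps => p; have [r rin e] := hr p.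
  exists r => // x hx u; rewrite /= act_cat.
  have -> : x u = act r (act (rev r) x) u.
    by rewrite -act_cat (act_ce _ (ce_revr r)).
  by apply: hcl; [rewrite e|apply: vlattice_act].
Qed.

Lemma vlattice_al s : vlattice (al s).
Proof.
move=> u; rewrite ffunE; case: (u == s); [exact: lattice1|exact: lattice0].
Qed.

Lemma not_klattice r : r != 0 -> exists2 k, (0 < k)%N & ~ klattice k r.
Proof.
move=> r0; have [k k0 hk] := fg_not_divisible (fun j => cos (ang j)) L.*2 r0.
by exists k => // -[_ [c ->]]; apply: hk.
Qed.

(** If s is the last letter of a reduced word of w, then w al_s is a negative root. Its coordinate
    at s is at most 0, that of al_s is 1, and some k does not divide the difference. *)
Lemma congruence_residually_finite w : ~ w =c [::] -> exists2 N, @fi_normal (cox_gops G) N & ~ N w.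
Proof.
move=> w1; have [u hu su] := lenP w.
case/lastP: u hu su => [/ce_sym//|u s] hu; rewrite size_rcons => su.
have ws : len w = (len (w ++ [:: s])).+1.
  case: (len_rcons w s) => // e.
  have : (len (w ++ [:: s]) <= size u)%N.
    rewrite -(len_eq (ce_catr _ hu)) -cats1 (len_eq (ce_rconsK _ _)).
    exact: len_size.
  by rewrite e -su ltnNge leqnSn.
have := neg_root R ws s; rewrite ffunE oppr_ge0 => le0.
have [|k k0 hk] := @not_klattice (act w (al s) s - al s s).
  by rewrite ffunE eqxx lt_eqF // subr_lt0 (le_lt_trans le0).
exists (congr_kernel k); first exact: congr_kernel_normal.
by move=> h; apply/hk/h/vlattice_al.
Qed.

(** For u in W_A the vector u b al_b has coordinate -1 at b, since u leaves that coordinate alone.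
    The difference with al_b is -2 for all u at once, so one k serves them all. *)
Lemma congruence_special_separable (A : {set V}) b : b \notin A ->
  exists2 N, @fi_normal (cox_gops G) N & forall u, all (mem A) u -> ~ N (u ++ [:: b]).
Proof.
move=> bA; have [|k k0 hk] := @not_klattice (-2); first by rewrite oppr_eq0 pnatr_eq0.
exists (congr_kernel k); first exact: congr_kernel_normal.
move=> u uA /(_ _ (vlattice_al b) b); rewrite act_cat /= refl_al (act_supp _ uA bA).
by rewrite !ffunE eqxx -opprD.
Qed.

End CongruenceQuotients.

(** * Special subgroups and descent sets *)

Section SpecialSubgroups.
Variable G : coxeter_graph.
Local Notation V := (cox_V G).
Local Notation word := (seq (cox_V G)).
Local Notation "x =c y" := (@cox_eq G x y) (at level 70).
Local Notation R := (Rdefinitions.R : realType).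
Implicit Types (s t v a : V) (p q w x u : word) (S : {set V}).

Definition in_special S x := exists2 u, all (mem S) u & x =c u.

Definition spherical S :=
  exists l : seq word, forall u, all (mem S) u -> exists2 r, r \in l & u =c r.

Lemma residually_finite w :
  ~ w =c [::] -> exists2 N, @fi_normal (cox_gops G) N & ~ N w.
Proof. exact: (congruence_residually_finite R). Qed.

Lemma special_separable S b : b \notin S ->
  exists2 N, @fi_normal (cox_gops G) N & forall u, all (mem S) u -> ~ N (u ++ [:: b]).
Proof. exact: (congruence_special_separable R). Qed.

Lemma up_set_len S w x :
  (forall t, t \in S -> len (w ++ [:: t]) = (len w).+1) -> all (mem S) x ->
  len (w ++ x) = len w + len x.
Proof. exact: (len_up R). Qed.

(** Lengths subtract as in [len_down], which puts W_S into the ball of radius [len w]. *)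
Lemma descent_spherical S w :
  (forall t, t \in S -> len w = (len (w ++ [:: t])).+1) -> spherical S.
Proof.
move=> h; have [l hl] := finite_ball G (len w); exists l => u uS.
by apply: hl; rewrite -(len_down R h uS) leq_addl.
Qed.

Local Open Scope ring_scope.

Lemma not_in_special S s p : s \notin S -> act p (al R s) s != 1 -> ~ in_special S p.
Proof.
move=> sS h [u uS e]; move: h.
by rewrite (act_ce _ e) (act_supp _ uS sS) ffunE eqxx => /eqP.
Qed.

Lemma oppr1_neq1 : -1 != 1 :> R.
Proof. by rewrite lt_eqF // (@lt_trans _ _ 0) // oppr_lt0. Qed.

Lemma gen_not_in_special S a : a \notin S -> ~ in_special S [:: a].
Proof.
move=> aS; apply: (not_in_special aS).
by rewrite /= refl_al !ffunE eqxx oppr1_neq1.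
Qed.

Lemma gen2_not_in_special S a v : v != a -> v \notin S -> ~ in_special S [:: a; v].
Proof.
move=> va vS; apply: (not_in_special vS).
rewrite [act _ _]/= refl_al -scaleN1r refl_scale refl_al_off // !ffunE eqxx (negPf va).
by rewrite [_ *: 0]mulr0 addr0 [_ *: 1]mulr1 oppr1_neq1.
Qed.

(** The coordinate at a of a v a al_a is 1 - c^2, where c = 2 cos (pi / m), or 2 without an edge; c
    > 0 because m is not 2. *)
Lemma gen3_not_in_special S a v : v != a -> (cox_E a v -> cox_m a v <> 2%N) ->
  a \notin S -> ~ in_special S [:: a; v; a].
Proof.
move=> va m2 aS; apply: (not_in_special aS).
have av : a != v by rewrite eq_sym.
rewrite [act _ _]/= refl_al -scaleN1r !refl_scale refl_al_off // refl_add refl_scale.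
rewrite refl_al refl_al_off // !ffunE eqxx (negPf av).
have := th_gt0 R m2; rewrite (th_sym R v a); set c := th R a v => c0.
have -> : -1 *: (- (1 : R^o) + c *: ((0 : R^o) + c *: (1 : R^o))) = 1 - c * c.
  by rewrite /GRing.scale /=; ring.
by rewrite lt_eqF // ltrBlDr ltrDl mulr_gt0.
Qed.

End SpecialSubgroups.

(** * Connectedness outside balls *)

Section Connectivity.
Variable G : coxeter_graph.
Local Notation V := (cox_V G).
Local Notation word := (seq (cox_V G)).
Local Notation "x =c y" := (@cox_eq G x y) (at level 70).
Implicit Types (u v t : V) (s w x y z : word) (P Q : word -> Prop).

Definition ce_closed P := forall x y, x =c y -> P x -> P y.

Definition conn P x y :=
  exists s, (forall i, i <= size s -> P (x ++ take i s)) /\ x ++ s =c y.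

Lemma conn_start P x y : conn P x y -> P x.
Proof. by move=> [s [/(_ 0 isT)]]; rewrite take0 cats0. Qed.

Lemma conn_ce P x y : P x -> x =c y -> conn P x y.
Proof.
by move=> Px e; exists [::]; rewrite cats0; split=> // i _; rewrite cats0.
Qed.

Lemma conn_step P x t : P x -> P (x ++ [:: t]) -> conn P x (x ++ [:: t]).
Proof.
move=> Px Pt; exists [:: t]; split; last exact: ce_refl.
by case=> [|i] _ /=; rewrite ?cats0 ?take_oversize.
Qed.

Lemma conn_mono P Q x y : (forall z, P z -> Q z) -> conn P x y -> conn Q x y.
Proof. by move=> PQ [s [h e]]; exists s; split=> // i /h/PQ. Qed.

Lemma conn_trans P x y z : ce_closed P -> conn P x y -> conn P y z -> conn P x z.
Proof.
move=> cP [s [hs es]] [r [hr er]]; exists (s ++ r); split=> [i|]; last first.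
  by rewrite catA; apply: ce_trans (ce_catr _ es) er.
rewrite take_cat; case: ltnP => [lt _|ge]; first exact/hs/ltnW.
rewrite size_cat => le; rewrite catA.
apply: (cP (y ++ take (i - size s) r)); first exact/ce_catr/ce_sym.
by apply: hr; rewrite leq_subLR.
Qed.

Lemma conn_sym P x y : ce_closed P -> conn P x y -> conn P y x.
Proof.
move=> cP [s [hs es]]; exists (rev s); split=> [i|]; last first.
  by apply: ce_trans (ce_catr _ (ce_sym es)) (ce_rKrev x s).
rewrite size_rev => le; apply: (cP (x ++ take (size s - i) s)); last exact/hs/leq_subr.
apply: ce_sym; apply: ce_trans (ce_catr _ (ce_sym es)) _; rewrite take_rev.
by rewrite -{1}(cat_take_drop (size s - i) s) catA; apply: ce_rKrev.
Qed.

Definition separation (A B : {set V}) :=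
  [/\ A :|: B = setT,
      forall u v, cox_E u v -> (u \in A /\ v \in A) \/ (u \in B /\ v \in B),
      exists2 a, a \in A & a \notin B,
      exists2 b, b \in B & b \notin A &
      spherical (A :&: B)].

Definition separable := exists A B, separation A B.

(** Otherwise a level set of c and its complement, both enlarged by S, would form a separation with
    intersection S. *)
Lemma unseparable_const (T : Type) (c : V -> T) (S : {set V}) :
  ~ separable -> spherical S ->
  (forall u v, u \notin S -> v \notin S -> cox_E u v -> c u = c v) ->
  forall u v, u \notin S -> v \notin S -> c u = c v.
Proof.
move=> nsep sph loc u v uS vS; apply: contrapT => uv; apply: nsep.
exists (S :|: [set x | `[< c x = c u >]]), (S :|: [set x | ~~ `[< c x = c u >]]).
split.
- by apply/setP => x; rewrite !inE; case: asboolP; rewrite !orbT.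
- move=> x y e; rewrite !inE.
  have [xS|xS] := boolP (x \in S); have [yS|yS] := boolP (y \in S) => /=.
  + by left.
  + by case: asboolP; [left|right].
  + by case: asboolP; [left|right].
  + by rewrite (loc x y xS yS e); case: asboolP; [left|right].
- by exists u; rewrite !inE (negPf uS) /=; case: asboolP.
- by exists v; rewrite !inE (negPf vS) /=; case: asboolP => // /esym.
- suff -> : (S :|: [set x | `[< c x = c u >]]) :&: (S :|: [set x | ~~ `[< c x = c u >]]) = S by [].
  by apply/setP => x; rewrite !inE; case: (x \in S) => //=; case: asboolP.
Qed.

(* The coset w<u, v> is a finite cycle through w; cutting it at w leaves a path
   of elements longer than w joining the neighbours wu and wv. *)
Lemma dihedral_link w u v : cox_E u v ->
  len (w ++ [:: u]) = (len w).+1 -> len (w ++ [:: v]) = (len w).+1 ->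
  conn (fun z => len w < len z) (w ++ [:: u]) (w ++ [:: v]).
Proof.
move=> e hu hv.
have up t : t \in [set u; v] -> len (w ++ [:: t]) = (len w).+1.
  by rewrite !inE => /orP[]/eqP->.
pose F j := flatten (nseq j [:: u; v]).
have FS j : F j.+1 = [:: u] ++ flatten (nseq j [:: v; u]) ++ [:: v].
  by rewrite /F /=; congr cons; elim: j => //= j ->.
have size_F j : size (F j) = j.*2 by elim: j => //= j ->.
have take_F j k : k <= j -> take k.*2 (F j) = F k.
  by elim: j k => [|j IH] [|k] //= kj; rewrite -/(F j) IH.
have all_F j : all (mem [set u; v]) (F j).
  by elim: j => //= j ->; rewrite !inE !eqxx orbT.
have exF : exists j, `[< 0 < j /\ F j =c [::] >].
  exists (cox_m u v); apply/asboolP; split; first exact/ltnW/cox_m_ge2.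
  by have := ce_braid [::] [::] e; rewrite cats0.
(* The exponent j + 1 is the order of uv, taken as a minimum instead of as m. Proper prefixes of
   even length are then nontrivial by minimality, those of odd length by parity. *)
case: (ex_minnP exF) => -[|j] /asboolP[//] _ Fj jmin.
have nontriv i : 0 < i -> i < j.+1.*2 -> len w < len (w ++ take i (F j.+1)).
  move=> i0 ij; have := all_F j.+1; rewrite -{1}(cat_take_drop i (F j.+1)) all_cat.
  move=> /andP[ai _]; rewrite (up_set_len up ai) -[X in X < _]addn0 ltn_add2l lt0n.
  apply/negP => /eqP/len0 ti.
  have := ce_size ti; rewrite size_takel ?size_F 1?ltnW //= => oi.
  have ei : i = i./2.*2 by rewrite -[LHS]odd_double_half oi.
  have ij2 : i./2 < j.+1 by rewrite -ltn_double -ei.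
  have Fi : F i./2 =c [::] by rewrite -(take_F j.+1 _ (ltnW ij2)) -ei.
  have /jmin : `[< 0 < i./2 /\ F i./2 =c [::] >] by apply/asboolP; split=> //; lia.
  by rewrite ltnNge -ltnS ij2.
exists (flatten (nseq j [:: v; u])); rewrite -catA; split=> [i ile|].
  have sj : size (flatten (nseq j [:: v; u])) = j.*2 by elim: (j) => //= n ->.
  have -> : (w ++ [:: u]) ++ take i (flatten (nseq j [:: v; u])) = w ++ take i.+1 (F j.+1).
    by rewrite FS -catA /= takel_cat.
  by apply: nontriv => //; rewrite sj in ile; lia.
apply: ce_catl; apply: (@ce_cancelr _ [:: v]); rewrite -catA -FS.
exact: ce_trans Fj (ce_sym (ce_vv v)).
Qed.

Definition connected P := forall x y, P x -> P y -> conn P x y.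

(* A path through w enters and leaves it through neighbours longer than w; these
   are linked off w because the descent set of w is spherical, so does not
   separate the graph. *)
Lemma connected_remove P w : ~ separable -> ce_closed P -> P w ->
  (forall z, P z -> len w <= len z) -> (forall z, len w < len z -> P z) ->
  connected P -> connected (fun z => P z /\ ~ z =c w).
Proof.
move=> nsep cP Pw Pge Plt con; set P' := fun z => P z /\ ~ z =c w.
have cP' : ce_closed P'.
  move=> x y e [Px xw]; split; first exact: cP e Px.
  by move=> yw; apply/xw/(ce_trans e).
have longP' z : len w < len z -> P' z.
  by move=> h; split; [exact: Plt|move=> /len_eq e; rewrite e ltnn in h].
pose S := [set t | len w == (len (w ++ [:: t])).+1].
have sphS : spherical S by apply: (@descent_spherical _ _ w) => t; rewrite inE => /eqP.
have upS t : t \notin S -> len (w ++ [:: t]) = (len w).+1.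
  by rewrite inE => /eqP h; case: (len_rcons w t).
have link t t' : t \notin S -> t' \notin S -> conn P' (w ++ [:: t]) (w ++ [:: t']).
  move=> tS t'S; pose c u := `[< conn P' (w ++ [:: t]) (w ++ [:: u]) >].
  have ct : c t.
    apply/asboolP/conn_ce; last exact: ce_refl.
    by apply: longP'; rewrite upS.
  suff e : c t = c t' by apply/asboolP; rewrite -/(c t') -e.
  apply: (unseparable_const nsep sphS) => // u v uS vS e.
  have uv : conn P' (w ++ [:: u]) (w ++ [:: v]).
    by apply: conn_mono longP' _; apply: dihedral_link => //; apply: upS.
  apply/asboolP/asboolP => h; apply: conn_trans h _ => //.
  exact: conn_sym.
have nbr x t : P x -> x ++ [:: t] =c w -> t \notin S /\ x =c w ++ [:: t].
  move=> Px e; have xe := ce_mover e; split=> //.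
  rewrite inE -(len_eq xe); apply/eqP => h; have := Pge x Px.
  by rewrite h ltnn.
move=> x y P'x P'y; have [s [hs es]] := con x y P'x.1 P'y.1.
have [n] : exists n, size s <= n by exists (size s).
elim: n s x P'x hs es => [|n IH] [|t s] x P'x hs es //.
- by move=> _; apply: conn_ce => //; rewrite cats0 in es.
- by move=> _; apply: conn_ce => //; rewrite cats0 in es.
rewrite /= ltnS => sn.
have tl : forall i, i <= size s -> P ((x ++ [:: t]) ++ take i s).
  by move=> i le; have := hs i.+1 le; rewrite /= -cat1s catA.
have es' : (x ++ [:: t]) ++ s =c y by rewrite -catA.
have [xw|xw] := pselect (x ++ [:: t] =c w); last first.
  have P't : P' (x ++ [:: t]).
    by split=> //; have := tl 0 isT; rewrite take0 cats0.
  exact: conn_trans cP' (conn_step P'x P't) (IH _ _ P't tl es' sn).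
case: s tl es' sn {hs es} => [|t' s] tl es' sn.
  by case: P'y => _ []; apply: ce_trans xw; apply: ce_sym; rewrite cats0 in es'.
have [tS xwt] := nbr x t P'x.1 xw.
have Pt' : P (w ++ [:: t']).
  apply: (cP ((x ++ [:: t]) ++ [:: t'])); first exact: ce_catr.
  by have := tl 1 isT; rewrite /= take0.
have [t'S _] := nbr (w ++ [:: t']) t' Pt' (ce_rconsK w t').
have P't' : P' (w ++ [:: t']) by apply: longP'; rewrite upS.
apply: (conn_trans cP' (conn_ce P'x xwt)).
apply: (conn_trans cP' (link _ _ tS t'S)).
apply: (IH s) => //; last exact: ltnW.
  move=> i le; apply: (cP ((x ++ [:: t]) ++ [:: t'] ++ take i s)).
    by rewrite catA; apply/ce_catr/ce_catr.
  by apply: (tl i.+1).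
by apply: ce_trans es'; apply: ce_sym; rewrite -(cat1s t') catA; apply/ce_catr/ce_catr.
Qed.

Lemma connected_outside_ball n : ~ separable -> connected (fun z => n <= len z).
Proof.
move=> nsep; elim: n => [|n IH].
  move=> x y _ _; exists (rev x ++ y); split=> //; exact: ce_revKr.
have [l hl] := finite_ball G n.
(* The elements of length n represented in the list are dropped from the region of length at least
   n. With a list covering the ball of radius n, this is the region of length at least n + 1. *)
pose P (l : seq word) z := n <= len z /\ forall r, r \in l -> len r = n -> ~ z =c r.
have cP l' : ce_closed (P l').
  move=> x y e [h1 h2]; split=> [|r rl rn yr]; first by rewrite -(len_eq e).
  exact: (h2 r rl rn (ce_trans e yr)).
suff conP l' : connected (P l').
  have -> : (fun z => is_true (n < len z)) = P l; last exact: conP.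
  apply/funext => z; rewrite propeqE; split=> [lt|[le h]].
    by split=> [|r _ rn /len_eq e]; [exact: ltnW|rewrite e rn ltnn in lt].
  rewrite ltn_neqAle le andbT; apply/eqP => e.
  have [|r rl zr] := hl z; first by rewrite -e.
  by apply: (h r rl _ zr); rewrite -(len_eq zr).
elim: l' => [|r l' IHl].
  have -> // : P [::] = (fun z => is_true (n <= len z)).
  by apply/funext => z; rewrite propeqE; split=> [[]|].
have [[Pr rn]|nP] := pselect (P l' r /\ len r = n).
  have -> : P (r :: l') = (fun z => P l' z /\ ~ z =c r).
    apply/funext => z; rewrite propeqE; split=> [[le h]|[[le h] zr]].
      split; last by apply: h; rewrite ?mem_head.
      by split=> // r' r'l; apply: h; rewrite in_cons r'l orbT.
    by split=> // r'; rewrite in_cons => /orP[/eqP->|/h].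
  apply: connected_remove => //; first by move=> z [le _]; rewrite rn.
  move=> z lt; split=> [|r' _ r'n /len_eq e]; first by rewrite -rn ltnW.
  by rewrite e r'n rn ltnn in lt.
have -> // : P (r :: l') = P l'.
apply/funext => z; rewrite propeqE; split=> [[le h]|[le h]].
  by split=> // r' r'l; apply: h; rewrite in_cons r'l orbT.
split=> // r'; rewrite in_cons => /orP[/eqP-> rn zr|/h //].
by apply: nP; split=> //; apply: cP zr _.
Qed.

Lemma unseparable_ends n : ~ separable -> ends_ge G n -> n <= 1.
Proof.
move=> nsep [K [xs [sx inf dis]]]; rewrite leqNgt; apply/negP => n2.
have [L hL] := finite_ball G (\max_(k <- K) size k).
have far i : i < n -> exists2 y, conn (notinK K) (nth [::] xs i) y &
    \max_(k <- K) size k < len y.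
  move=> ni; have xi : In (nth [::] xs i) xs by apply/InP/mem_nth; rewrite sx.
  have [_ /(_ L)[y [cy yL]]] := inf _ xi; exists y => //.
  rewrite ltnNge; apply/negP => /hL[r rL yr]; apply: (yL r) => //; exact/InP.
have cK : ce_closed (notinK K).
  by move=> x y e h k kK yk; apply: (h k kK); apply: ce_trans e yk.
have [y0 c0 l0] := far 0 (ltnW n2); have [y1 c1 l1] := far 1 n2.
apply: (dis 0 1) => //; apply: (conn_trans cK c0).
apply: conn_trans cK _ (conn_sym cK c1).
apply: conn_mono (connected_outside_ball _ l0 l1) => // z lz k /InP kK /len_eq zk.
move: lz; rewrite ltnNge zk (leq_trans (len_size k)) //.
exact: (leq_bigmax_seq (P := xpredT) (F := size)).
Qed.

End Connectivity.

(** * Primitives of functions on the edges of the Bass-Serre tree *)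

Section Primitive.
Variable G : coxeter_graph.
Local Notation V := (cox_V G).
Local Notation word := (seq (cox_V G)).
Local Notation "x =c y" := (@cox_eq G x y) (at level 70).

(** Functions on W / W_S: on the two kinds of vertices of the Bass-Serre tree for S = A and S = B,
    on its edges for S = A n B. The edge of x joins the vertices xW_A and xW_B. *)
Definition rinvar (T : Type) (S : {set V}) (f : word -> T) :=
  forall x v, v \in S -> f (x ++ [:: v]) = f x.
Definition ce_invar (T : Type) (f : word -> T) := forall x y, x =c y -> f x = f y.

Lemma rinvar_cat (T : Type) (S : {set V}) (f : word -> T) x u :
  rinvar S f -> all (mem S) u -> f (x ++ u) = f x.
Proof.
move=> fS; elim/last_ind: u => [|u v IH]; first by rewrite cats0.
by rewrite all_rcons -cats1 catA => /andP[vS /IH <-]; apply: fS.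
Qed.

Lemma in_special_invar (T : Type) (S : {set V}) (f : word -> T) x u :
  ce_invar f -> rinvar S f -> in_special S u -> f (x ++ u) = f x.
Proof. by move=> cf fS [w wS /(ce_catl x)/cf->]; apply: rinvar_cat fS wS. Qed.

Lemma in_special_ce (S : {set V}) (x y : word) : x =c y -> in_special S x -> in_special S y.
Proof. by move=> e [u uS xu]; exists u => //; apply: ce_trans (ce_sym e) xu. Qed.

Lemma in_special_cat (S : {set V}) (x y : word) :
  in_special S x -> in_special S y -> in_special S (x ++ y).
Proof.
by move=> [u uS xu] [w wS yw]; exists (u ++ w); [rewrite all_cat uS|apply: ce_cat].
Qed.

Lemma in_special_rev (S : {set V}) (x : word) : in_special S x -> in_special S (rev x).
Proof. by move=> [u uS xu]; exists (rev u); [rewrite all_rev|apply: ce_rev]. Qed.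

Lemma in_special_sub (S S' : {set V}) (x : word) :
  S \subset S' -> in_special S x -> in_special S' x.
Proof.
move=> /subsetP sub [u uS xu]; exists u => //.
by apply/allP => v /(allP uS) /=; apply: sub.
Qed.

Lemma in_special1 (S : {set V}) v : v \in S -> in_special S [:: v].
Proof. by move=> vS; exists [:: v]; rewrite /= ?vS //; apply: ce_refl. Qed.

Lemma in_special_mull (S : {set V}) (x y : word) :
  in_special S x -> in_special S (x ++ y) -> in_special S y.
Proof.
move=> hx hxy; apply: in_special_ce (ce_revKl x y) _.
exact: in_special_cat (in_special_rev hx) hxy.
Qed.

Lemma in_special_mulr (S : {set V}) (x y : word) :
  in_special S y -> in_special S (x ++ y) -> in_special S x.
Proof.
move=> hy hxy; apply: in_special_ce (ce_rKrev x y) _.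
exact: in_special_cat hxy (in_special_rev hy).
Qed.

Variables A B : {set V}.
Hypothesis cover : A :|: B = setT.
Hypothesis edges : forall u v, cox_E u v -> (u \in A /\ v \in A) \/ (u \in B /\ v \in B).

(** Connectedness of the tree: each letter of x lies in A or in B, hence keeps one end of the
    current edge in place. *)
Lemma rinvar_const (T : Type) (fA fB : word -> T) :
  rinvar A fA -> rinvar B fB -> (forall x, fA x = fB x) -> forall x, fA x = fA [::].
Proof.
move=> hA hB e; elim/last_ind => [//|x v IH]; rewrite -cats1.
have : v \in A :|: B by rewrite cover inE.
by rewrite inE => /orP[/hA->|/hB h] //; rewrite e h -e.
Qed.

Local Open Scope ring_scope.
Variables (K : zmodType) (h : word -> K).

(** The integral of h along the path of A-vertices spelled by a word, reversed here so that its last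
    letter comes first. A letter of A stays at the vertex xW_A; any other letter v passes through
    xW_B and crosses the edges of x and of xv. *)
Fixpoint primitive_rev (r : word) : K :=
  if r is v :: r' then
    primitive_rev r' + (if v \in A then 0 else h (rev r') - h (rev r))
  else 0.

Definition primitive x := primitive_rev (rev x).

Lemma primitive_rcons x v :
  primitive (x ++ [:: v]) =
  primitive x + (if v \in A then 0 else h x - h (x ++ [:: v])).
Proof. by rewrite /primitive cats1 rev_rcons /= rev_cons revK. Qed.

Hypotheses (ch : ce_invar h) (hC : rinvar (A :&: B) h).

Lemma primitive_rinvarA : rinvar A primitive.
Proof. by move=> x v vA; rewrite primitive_rcons vA addr0. Qed.

Lemma primitive_rinvarB : rinvar B (fun x => primitive x + h x).
Proof.
move=> x v vB; rewrite primitive_rcons; case: ifP => vA.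
  by rewrite addr0 hC // inE vA.
by rewrite -addrA subrK.
Qed.

(* Every relator lies in A or in B, where one of the two primitives is constant. *)
Lemma primitive_ce : ce_invar primitive.
Proof.
have relator u r w : r =c [::] -> (all (mem A) r \/ all (mem B) r) ->
    primitive (u ++ r ++ w) = primitive (u ++ w).
  move=> r1 hr; have eh z : h (u ++ r ++ z) = h (u ++ z).
    by apply: ch; apply: ce_catl; apply: (ce_catr z r1).
  elim/last_ind: w => [|w v IH]; last first.
    rewrite -cats1 !catA !primitive_rcons -!catA IH eh.
    by rewrite (eh (w ++ [:: v])).
  rewrite !cats0; case: hr => hr; first exact: (rinvar_cat u primitive_rinvarA hr).
  have := rinvar_cat u primitive_rinvarB hr; have := eh [::]; rewrite !cats0 => ->.
  exact: addIr.
move=> x y; elim=> {x y} [//|x y _ -> //|x y z _ -> _ -> //|u w v|u w v v' e].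
  apply: (relator u [:: v; v] w); first exact: ce_vv.
  have : v \in A :|: B by rewrite cover inE.
  by rewrite inE => /orP[] vS; [left|right]; rewrite /= vS.
apply: relator; first by have := ce_braid [::] [::] e; rewrite !cats0.
have all_nseq S n : v \in S -> v' \in S -> all (mem S) (flatten (nseq n [:: v; v'])).
  by move=> vS v'S; elim: n => //= n ->; rewrite vS v'S.
by case: (edges e) => -[vS v'S]; [left|right]; apply: all_nseq.
Qed.

End Primitive.

(** * Ends from disjoint infinite sets with finite boundary *)

Section EndsFromSets.
Variable G : coxeter_graph.
Local Notation V := (cox_V G).
Local Notation word := (seq (cox_V G)).
Local Notation "x =c y" := (@cox_eq G x y) (at level 70).

Lemma notinK_ce (K : seq word) : ce_closed (notinK K).
Proof. by move=> x y e h k kK yk; apply: (h k kK); apply: ce_trans e yk. Qed.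

Lemma notinK_cat (K L : seq word) x : notinK (K ++ L) x <-> notinK K x /\ notinK L x.
Proof.
split=> [h|[h1 h2] k /InP]; last by rewrite mem_cat => /orP[]/InP; [apply: h1|apply: h2].
by split=> k /InP kK; apply: h; apply/InP; rewrite mem_cat kK ?orbT.
Qed.

Definition infinite_set (X : word -> Prop) := forall l, exists2 x, X x & notinK l x.

Lemma infinite_of_seq (X : word -> Prop) (f : nat -> word) :
  (forall i, X (f i)) -> (forall i j, i < j -> ~ f i =c f j) -> infinite_set X.
Proof.
move=> Xf inj l; apply: contrapT => no.
have /choice[g hg] : forall i, exists r, r \in l /\ f i =c r.
  move=> i; apply: contrapT => nor; apply: no; exists (f i) => // k /InP kl fk.
  by apply: nor; exists k.
have ginj : injective g.
  move=> i j gij; have [_ ei] := hg i; have [_ ej] := hg j; rewrite -gij in ej.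
  have e := ce_trans ei (ce_sym ej).
  by case: (ltngtP i j) => // lt; [case: (inj i j lt)|case: (inj j i lt); apply: ce_sym].
have gl : {subset [seq g i | i <- iota 0 (size l).+1] <= l}.
  by move=> z /mapP[i _ ->]; case: (hg i).
have gu : uniq [seq g i | i <- iota 0 (size l).+1] by rewrite map_inj_uniq ?iota_uniq.
by have := uniq_leq_size gu gl; rewrite size_map size_iota ltnn.
Qed.

(** A component of the complement of K' that meets X i stays inside it. Every component reaches a
    neighbour of K', so there are finitely many of them, and one inside the infinite set X i must be
    infinite. *)
Lemma ends_ge_of_sets n (X : nat -> word -> Prop) (K : seq word) :
  (forall i, i < n -> ce_closed (X i)) ->
  (forall i, i < n -> infinite_set (X i)) ->
  (forall i, i < n -> forall x v, notinK K x -> X i x -> X i (x ++ [:: v])) ->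
  (forall i j, i < j < n -> forall x, X i x -> X j x -> False) ->
  ends_ge G n.
Proof.
(* The identity is added to K so that the path from x back to the identity has to meet the removed
   set. *)
move=> cX iX bX dX; pose K' := [::] :: K.
have sK x : notinK K' x -> notinK K x by move=> h k kK; apply: h; right.
have stay i x y : i < n -> conn (notinK K') x y -> X i x -> X i y.
  move=> ni [s [hs es]] Xx; apply: (cX i ni _ _ es).
  suff H j : j <= size s -> X i (x ++ take j s) by rewrite -(take_size s); apply: H.
  elim: j => [|j IH] lt; first by rewrite take0 cats0.
  case: s lt hs IH {es} => // v0 s lt hs IH.
  rewrite (take_nth v0) // -cats1 catA; apply: bX => //; last exact/IH/ltnW.
  exact/sK/hs/ltnW.
have comp i : i < n -> exists2 x, X i x & infinite_comp K' x.
  move=> ni; apply: contrapT => no.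
  have /choice[L hL] : forall x, exists L : seq word, X i x ->
      forall y, conn (notinK K') x y -> ~ notinK L y.
    move=> x; apply: contrapT => noL; apply: no; exists x.
      by apply: contrapT => nX; apply: noL; exists [::].
    split.
      apply: contrapT => nK; apply: noL; exists [::] => _ y /conn_start/nK [].
    move=> l; apply: contrapT => nol; apply: noL; exists l => _ y cy yl.
    by apply: nol; exists y.
  pose N := [seq k ++ [:: v] | k <- K', v <- enum V].
  have [x Xx] := iX i ni (K' ++ flatten [seq L z | z <- N]).
  rewrite notinK_cat => -[xK xL].
  have exj : exists j, `[< ~ notinK K' (x ++ take j (rev x)) >].
    exists (size (rev x)); apply/asboolP; rewrite take_size => /(_ [::] (or_introl erefl)).
    by apply; apply: ce_revr.
  case: (ex_minnP exj) => -[|j] /asboolP hj jmin.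
    by apply: hj; rewrite take0 cats0.
  have jlt : j < size (rev x).
    rewrite ltnNge; apply/negP => ge.
    have : `[< ~ notinK K' (x ++ take j (rev x)) >].
      by apply/asboolP; move: hj; rewrite !take_oversize // ltnW.
    by move/jmin; rewrite ltnn.
  have [v0 v0x] : exists v0 : V, True by case: (rev x) jlt => // v0; exists v0.
  have cz : conn (notinK K') x (x ++ take j (rev x)).
    exists (take j (rev x)); split; last exact: ce_refl.
    rewrite size_take jlt => m mj; rewrite take_takel //.
    apply: contrapT => h; have : `[< ~ notinK K' (x ++ take m (rev x)) >] by apply/asboolP.
    by move/jmin; rewrite ltnNge (leq_trans mj).
  set z := x ++ take j (rev x) in cz.
  move: hj; rewrite (take_nth v0) // -cats1 catA -/z; set v := nth v0 _ _ => hj.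
  have [k kK zk] : exists2 k, k \in K' & z ++ [:: v] =c k.
    apply: contrapT => nok; apply: hj => k /InP kK zk; apply: nok; by exists k.
  have zr : z =c k ++ [:: v] := ce_mover zk.
  have rN : k ++ [:: v] \in N by apply/allpairsP; exists (k, v); rewrite /= kK mem_enum.
  have cKK := @notinK_ce K'.
  have crx : conn (notinK K') (k ++ [:: v]) x.
    have cxr := conn_trans cKK cz (conn_ce (conn_start (conn_sym cKK cz)) zr).
    exact: conn_sym.
  have Xr : X i (k ++ [:: v]) by apply: stay ni (conn_sym cKK crx) Xx.
  apply: (hL _ Xr x crx) => l /InP lL; apply: xL; apply/InP.
  by apply/flattenP; exists (L (k ++ [:: v])) => //; apply/mapP; exists (k ++ [:: v]).
have /choice[c hc] : forall i, exists x, i < n -> X i x /\ infinite_comp K' x.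
  move=> i; case: (boolP (i < n)) => [ni|]; last by exists [::].
  by have [x Xx ix] := comp i ni; exists x.
have nthc i : i < n -> nth [::] [seq c i | i <- iota 0 n] i = c i.
  by move=> ni; rewrite (nth_map 0) ?size_iota // nth_iota.
exists K', [seq c i | i <- iota 0 n]; split=> [|x|i j /andP[ij jn]].
- by rewrite size_map size_iota.
- by move=> /InP/mapP[i]; rewrite mem_iota => /andP[_ /hc[_ h]] ->.
- have ni := ltn_trans ij jn; rewrite !nthc // => /(stay i _ _ ni)/(_ (hc i ni).1) Xi.
  by apply: (dX i j _ _ Xi (hc j jn).1); rewrite ij.
Qed.

End EndsFromSets.

(** * Ping-pong *)

Section PingPong.
Variable G : coxeter_graph.
Local Notation V := (cox_V G).
Local Notation word := (seq (cox_V G)).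
Local Notation "x =c y" := (@cox_eq G x y) (at level 70).
Implicit Types (A B : {set V}) (a b v : V) (x y z p q : word).

Lemma separation_sym A B : separation A B -> separation B A.
Proof.
move=> [cov e [a aA aB] [b bB bA] sph]; split.
- by rewrite setUC.
- by move=> u v /e[]; [right|left].
- by exists b.
- by exists a.
- by rewrite setIC.
Qed.

Definition pow x k : word := flatten (nseq k x).

Lemma powS x k : pow x k.+1 = x ++ pow x k. Proof. by []. Qed.

Lemma pow_add x i j : pow x (i + j) = pow x i ++ pow x j.
Proof. by rewrite /pow nseqD flatten_cat. Qed.

(* The B-side of the edge A <- C -> B of the Bass-Serre tree of W = A *_C B,
   obtained as the primitive of the indicator function of C. *)
Definition halfspace A B x : bool := primitive A (fun y => `[< in_special (A :&: B) y >]) x.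

Section Half.
Variables A B : {set V}.
Hypothesis sepAB : separation A B.
Local Notation C := (A :&: B).
Local Notation inC x := (in_special C x).
Local Notation Q := (halfspace A B).
Local Notation QB x := (Q x (+) `[< inC x >]).

Lemma inC_ce : ce_invar (fun y => `[< inC y >]).
Proof.
move=> x y e; apply/asboolP/asboolP; apply: in_special_ce => //; exact: ce_sym.
Qed.

Lemma inC_rinvar : rinvar C (fun y => `[< inC y >]).
Proof.
move=> x v vC; have hv := in_special1 vC.
by apply/asboolP/asboolP => h; [exact: in_special_mulr hv h|exact: in_special_cat].
Qed.

Lemma half_ce : ce_invar Q.
Proof. by case: sepAB => cov e _ _ _; apply: (primitive_ce cov e inC_ce inC_rinvar). Qed.

(** [Q] is a function on A-vertices and [QB] one on B-vertices; they differ across the base edge C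
    only. Here [bool] is the group of order two. *)
Lemma half_rinvarA : rinvar A Q.
Proof. exact: primitive_rinvarA. Qed.

Lemma half_rinvarB : rinvar B (fun x => QB x).
Proof. exact: (primitive_rinvarB inC_rinvar). Qed.

Lemma halfB_ce : ce_invar (fun x => QB x).
Proof. by move=> x y e; rewrite (half_ce e) (inC_ce e). Qed.

Lemma subCA : C \subset A. Proof. exact: subsetIl. Qed.
Lemma subCB : C \subset B. Proof. exact: subsetIr. Qed.

Lemma inC_nil : inC [::]. Proof. by exists [::] => //; apply: ce_refl. Qed.

Lemma half_A x : in_special A x -> Q x = false.
Proof. exact: (@in_special_invar _ _ _ _ [::] _ half_ce half_rinvarA). Qed.

Lemma half_B x : in_special B x -> QB x = true.
Proof.
move=> xB; rewrite (@in_special_invar _ _ _ _ [::] _ halfB_ce half_rinvarB xB).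
by have /asboolP-> := inC_nil.
Qed.

Lemma half_BC x : in_special B x -> ~ inC x -> Q x.
Proof. by move=> /half_B + /asboolPn/negbTE h; rewrite h addbF => ->. Qed.

Lemma halfBE x : ~ inC x -> QB x = Q x.
Proof. by move=> /asboolPn/negbTE->; rewrite addbF. Qed.

Lemma shift_rinvar (S : {set V}) (f : word -> bool) p :
  rinvar S f -> rinvar S (fun x => f (p ++ x)).
Proof. by move=> h x v vS; rewrite catA h. Qed.

(** The half-spaces Q and p^-1 Q are disjoint: the product of their indicators agrees with its
    B-version across every edge, so it is constant, and it vanishes at the identity. *)
Lemma ping_A p x : in_special A p -> ~ inC p -> Q x -> Q (p ++ x) = false.
Proof.
move=> pA pC Qx; case: sepAB => cov _ _ _ _.
have pr : rinvar A (fun x => Q x && Q (p ++ x)).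
  by move=> z v vA; rewrite half_rinvarA // (shift_rinvar _ half_rinvarA).
have qr : rinvar B (fun x => QB x && QB (p ++ x)).
  by move=> z v vB; rewrite half_rinvarB // (shift_rinvar _ half_rinvarB).
have key z : Q z && Q (p ++ z) = QB z && QB (p ++ z).
  have [zC|zC] := pselect (inC z).
    have zA := in_special_sub subCA zC.
    have pz : ~ inC (p ++ z) by move=> h; apply/pC/(in_special_mulr zC h).
    by rewrite (halfBE pz) (half_A zA) (half_A (in_special_cat pA zA)) !andbF.
  have [pz|pz] := pselect (inC (p ++ z)); last by rewrite !halfBE.
  have pzA := in_special_sub subCA pz.
  by rewrite (halfBE zC) (half_A (in_special_mull pA pzA)).
by have := rinvar_const cov pr qr key x; rewrite Qx /= => ->.
Qed.

(** The argument of [ping_A] for the complement of Q; the product vanishes at the identity because p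
    lies in Q. *)
Lemma ping_B p x : in_special B p -> ~ inC p -> Q x = false -> Q (p ++ x).
Proof.
move=> pB pC Qx; case: sepAB => cov _ _ _ _.
have pr : rinvar A (fun x => ~~ Q x && ~~ Q (p ++ x)).
  by move=> z v vA; rewrite half_rinvarA // (shift_rinvar _ half_rinvarA).
have qr : rinvar B (fun x => ~~ QB x && ~~ QB (p ++ x)).
  by move=> z v vB; rewrite half_rinvarB // (shift_rinvar _ half_rinvarB).
have key z : ~~ Q z && ~~ Q (p ++ z) = ~~ QB z && ~~ QB (p ++ z).
  have [zC|zC] := pselect (inC z).
    have zB := in_special_sub subCB zC.
    have pz : ~ inC (p ++ z) by move=> h; apply/pC/(in_special_mulr zC h).
    rewrite (half_B zB) /=.
    by rewrite (half_BC (in_special_cat pB zB) pz) andbF.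
  have [pz|pz] := pselect (inC (p ++ z)); last by rewrite !halfBE.
  have pzB := in_special_sub subCB pz.
  by rewrite (half_B pzB) andbF (half_BC (in_special_mull pB pzB) zC).
have := rinvar_const cov pr qr key x; rewrite Qx cats0 (half_BC pB pC) andbF /=.
by move/negbFE.
Qed.

Lemma half_step x v : Q x <> Q (x ++ [:: v]) -> inC x \/ inC (x ++ [:: v]).
Proof.
move=> ne; apply: contrapT => /not_orP[h1 h2]; apply: ne.
have : v \in A :|: B by case: sepAB => ->; rewrite inE.
rewrite inE => /orP[/half_rinvarA-> //|/half_rinvarB].
by move=> /(_ x); rewrite !halfBE.
Qed.

Lemma half_boundary p : exists K : seq word, forall x v, notinK K x ->
  Q (rev p ++ x) -> Q (rev p ++ (x ++ [:: v])).
Proof.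
case: sepAB => _ _ _ _ [l hl].
have hl' x : inC x -> exists2 r, r \in l & x =c r.
  by move=> [u /hl[r rl ur] xu]; exists r => //; apply: ce_trans xu ur.
exists ([seq p ++ r | r <- l] ++ [seq p ++ r ++ [:: v] | r <- l, v <- enum V]).
move=> x v; rewrite notinK_cat => -[x1 x2] Qx; apply: contrapT => nQ.
have [|/hl'[r rl e]|/hl'[r rl e]] := @half_step (rev p ++ x) v.
- by rewrite -catA => e; apply: nQ; rewrite -e.
- apply: (x1 (p ++ r)); first by apply/InP/map_f.
  apply: ce_trans (ce_catl p e); exact: ce_sym (ce_revKr p x).
- apply: (x2 (p ++ r ++ [:: v])).
    by apply/InP/allpairsP; exists (r, v); rewrite /= rl mem_enum.
  have /(ce_catl p) := ce_mover e.
  by apply: ce_trans; apply: ce_sym (ce_revKr p x).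
Qed.

Variables (a b : V).
Hypotheses (aA : a \in A) (aB : a \notin B) (bB : b \in B) (bA : b \notin A).

Lemma aC : ~ inC [:: a].
Proof. by apply: gen_not_in_special; rewrite inE (negPf aB) andbF. Qed.
Lemma bC : ~ inC [:: b].
Proof. by apply: gen_not_in_special; rewrite inE (negPf bA). Qed.

Lemma ping_b p x : in_special A p -> ~ inC p -> Q x -> Q ([:: b] ++ (p ++ x)).
Proof. by move=> pA pC Qx; apply: ping_B (in_special1 bB) bC _; apply: ping_A. Qed.

Lemma ping_pow p k x : in_special A p -> ~ inC p -> Q x -> Q (pow (b :: p) k ++ x).
Proof.
move=> pA pC; elim: k => //= k IH Qx; rewrite -catA.
exact: (ping_b pA pC (IH Qx)).
Qed.

Lemma half_pow k : Q (pow [:: b; a] k) = (0 < k).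
Proof.
case: k => [|k]; first exact/half_A/(in_special_sub subCA)/inC_nil.
rewrite -addn1 pow_add addn1 /=; apply: ping_pow; [exact: in_special1|exact: aC|].
apply: (ping_B (p := [:: b]) (in_special1 bB) bC).
exact/half_A/in_special1.
Qed.

Lemma pow_inj i j : i < j -> ~ pow [:: b; a] i =c pow [:: b; a] j.
Proof.
move=> ij; rewrite -(subnKC (ltnW ij)) pow_add -[X in X =c _]cats0.
by move=> /ce_cancell/half_ce; rewrite half_pow subn_gt0 ij (half_pow 0).
Qed.

Lemma half_infinite p : infinite_set (fun x => Q (rev p ++ x)).
Proof.
apply: (@infinite_of_seq _ _ (fun i => p ++ pow [:: b; a] i.+1)) => [i|i j ij].
  by rewrite (half_ce (ce_revKl p _)) half_pow.
by move=> /ce_cancell; apply: pow_inj.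
Qed.

Lemma half_shift_ce p : ce_closed (fun x => Q (rev p ++ x)).
Proof. by move=> x y /(ce_catl (rev p))/half_ce->. Qed.

Lemma half_ends n (p : nat -> word) :
  (forall i j, i < j < n -> forall x, Q (rev (p i) ++ x) -> Q (rev (p j) ++ x) -> False) ->
  ends_ge G n.
Proof.
move=> dis; have /choice[K hK] := fun i => half_boundary (p i).
apply: (@ends_ge_of_sets _ _ (fun i x => Q (rev (p i) ++ x)) (flatten [seq K i | i <- iota 0 n])).
- by move=> i _; apply: half_shift_ce.
- by move=> i _; apply: half_infinite.
- move=> i ni x v xK; apply: hK => k /InP kK; apply: xK; apply/InP.
  by apply/flattenP; exists (K i) => //; apply: map_f; rewrite mem_iota.
- exact: dis.
Qed.

Lemma separation_ends2 : ends_ge G 2.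
Proof.
apply: (half_ends (p := fun i => if i is 0 then [::] else [:: a])).
move=> i j /andP[ij j2] x; have [-> ->] : i = 0 /\ j = 1 by lia.
by move=> /= /(ping_A (in_special1 aA) aC) /= ->.
Qed.

Section Free.
Variables p p' : word.
Hypotheses (pA : in_special A p) (pC : ~ inC p).
Hypotheses (pA' : in_special A p') (pC' : ~ inC p') (ppC : ~ inC (rev p ++ p')).

Lemma ping_disjoint x : Q (rev (b :: p) ++ x) -> Q (rev (b :: p') ++ x) -> False.
Proof.
move=> Q1 Q2; have pp : in_special A (rev p ++ p').
  exact: in_special_cat (in_special_rev pA) pA'.
have := ping_A pp ppC Q2.
rewrite (@half_ce _ (rev (b :: p) ++ x)) ?Q1 //.
have -> : rev (b :: p) = rev p ++ [:: b] by rewrite rev_cons cats1.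
have -> : rev (b :: p') = rev p' ++ [:: b] by rewrite rev_cons cats1.
rewrite -!catA; apply: ce_catl; exact: ce_revKr.
Qed.

(** The half-spaces h^i h' Q are pairwise disjoint: for i < j the j-th lies in h^(i+1) Q, and hQ
    does not meet h'Q. *)
Lemma free_ends n : ends_ge G n.
Proof.
pose h := b :: p; pose h' := b :: p'.
apply: (half_ends (p := fun i => pow h i ++ h')) => i j /andP[ij _] x Q1 Q2.
pose y := rev (pow h i) ++ x.
have Q1y : Q (rev h' ++ y) by rewrite /y catA -rev_cat.
apply: (@ping_disjoint y) => //.
pose z := rev (pow h (j - i).-1 ++ h') ++ rev h ++ y.
have Qz : Q z.
  have -> // : z = rev (pow h j ++ h') ++ x.
  rewrite /z /y !rev_cat -!catA; congr (_ ++ _).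
  rewrite [RHS](_ : _ = rev (pow h i ++ h ++ pow h (j - i).-1) ++ x).
    by rewrite !rev_cat -!catA.
  by congr (rev _ ++ _); rewrite -powS -pow_add; congr pow; lia.
rewrite (@half_ce _ (pow h (j - i).-1 ++ h' ++ z)); last first.
  rewrite /z rev_cat -!catA; apply: ce_sym.
  apply: ce_trans (ce_catl _ (ce_revKr h' _)) _; exact: ce_revKr.
apply: ping_pow => //; exact: (ping_b pA' pC' Qz).
Qed.

(** Applied to b, which lies in Q, the two sides of the law would land in the disjoint sets hQ and
    h'Q. *)
Lemma free_no_law k : 0 < k ->
  ~ (forall x y, pow x k ++ pow y k =c pow y k ++ pow x k).
Proof.
case: k => // k _ law; pose h := b :: p; pose h' := b :: p'.
have Qb : Q [:: b] by apply: half_BC bC; apply: in_special1.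
have e := ce_catr [:: b] (law h h').
have assoc x y z : (pow x k.+1 ++ y) ++ z = x ++ (pow x k ++ (y ++ z)) by rewrite powS -!catA.
apply: (@ping_disjoint ((pow h k.+1 ++ pow h' k.+1) ++ [:: b])).
  rewrite (assoc h) (half_ce (ce_revKl h _)).
  by apply: ping_pow => //; apply: ping_pow.
rewrite (half_ce (ce_catl _ e)) (assoc h') (half_ce (ce_revKl h' _)).
by apply: ping_pow => //; apply: ping_pow.
Qed.

End Free.

End Half.

(** The case W_A = W_C x <a>: A-vertices have valency two, and the three cosets of W_C that
    ping-pong requires do not exist. When both sides are of this kind the tree is a line. *)
Definition half_degenerate A B :=
  exists a, [/\ a \in A, a \notin B &
    forall v, v \in A -> v = a \/ [/\ v \in B, cox_E a v & cox_m a v = 2]].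

(** The elements 1, p, p' represent three cosets of W_C: p = a, and p' = v for another v outside B,
    or p' = va for v in C not commuting with a, since then ava is not in W_C. *)
Lemma not_degenerate_words A B a : a \in A -> a \notin B -> ~ half_degenerate A B ->
  exists p p' : word, [/\ in_special A p, ~ in_special (A :&: B) p,
    in_special A p', ~ in_special (A :&: B) p' & ~ in_special (A :&: B) (rev p ++ p')].
Proof.
move=> aA aB nd; have aC : a \notin A :&: B by rewrite inE (negPf aB) andbF.
have [v [vA va hv]] : exists v, [/\ v \in A, v != a &
    ~ [/\ v \in B, cox_E a v & cox_m a v = 2]].
  apply: contrapT => no; apply: nd; exists a; split=> // v vA.
  case: (eqVneq v a) => [|va]; [by left|right].
  by apply: contrapT => h; apply: no; exists v.
have a1 := gen_not_in_special aC; exists [:: a].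
have [vB|vB] := boolP (v \in B); last first.
  have vC : v \notin A :&: B by rewrite inE (negPf vB) andbF.
  exists [:: v]; split; try exact: in_special1; try exact: gen_not_in_special.
  exact: gen2_not_in_special.
exists [:: v; a]; split=> //; first exact: in_special1.
- exact: (in_special_cat (in_special1 vA) (in_special1 aA)).
- by apply: gen2_not_in_special; rewrite 1?eq_sym.
- by apply: gen3_not_in_special => // e m2; apply: hv.
Qed.

Lemma not_degenerate_ends A B n : separation A B -> ~ half_degenerate A B -> ends_ge G n.
Proof.
move=> sep nd; case: (sep) => _ _ [a aA aB] [b bB bA] _.
have [p [p' [pA pC pA' pC' ppC]]] := not_degenerate_words aA aB nd.
exact: (free_ends sep aA aB bB bA pA pC pA' pC' ppC).
Qed.

Lemma not_degenerate_no_law A B k : separation A B -> ~ half_degenerate A B -> 0 < k ->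
  ~ (forall x y, pow x k ++ pow y k =c pow y k ++ pow x k).
Proof.
move=> sep nd; case: (sep) => _ _ [a aA aB] [b bB bA] _.
have [p [p' [pA pC pA' pC' ppC]]] := not_degenerate_words aA aB nd.
exact: (free_no_law sep bB bA pA pC pA' pC' ppC).
Qed.

Lemma separable_ends2 : separable G -> ends_ge G 2.
Proof.
move=> [A [B sep]]; case: (sep) => _ _ [a aA aB] [b bB bA] _.
exact: (separation_ends2 sep aA aB bB bA).
Qed.

End PingPong.

(** * Virtually cyclic Coxeter groups *)

Section Commutation.
Variable G : coxeter_graph.
Local Notation V := (cox_V G).
Local Notation word := (seq (cox_V G)).
Local Notation "x =c y" := (@cox_eq G x y) (at level 70).
Implicit Types (x y z : word).

Definition ce_commute x y := x ++ y =c y ++ x.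

Lemma ce_commute_sym x y : ce_commute x y -> ce_commute y x.
Proof. exact: ce_sym. Qed.

Lemma ce_commute_nil x : ce_commute x [::].
Proof. by rewrite /ce_commute cats0; apply: ce_refl. Qed.

Lemma ce_commute_cat x y z : ce_commute x y -> ce_commute x z -> ce_commute x (y ++ z).
Proof.
move=> /(ce_catr z) h1 /(ce_catl y) h2; rewrite /ce_commute -catA.
by apply: ce_trans _ h2; rewrite !catA.
Qed.

Lemma ce_commute_ce x x' y y' : x =c x' -> y =c y' -> ce_commute x y -> ce_commute x' y'.
Proof.
move=> ex ey h; apply: ce_trans (ce_cat (ce_sym ex) (ce_sym ey)) _.
exact: ce_trans h (ce_cat ey ex).
Qed.

Lemma ce_commute_rev x y : ce_commute x y -> ce_commute x (rev y).
Proof.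
move=> h; apply: (@ce_cancell _ y); apply: ce_sym; apply: ce_trans (ce_revKr y x) _.
have := ce_catr (rev y) h; rewrite -!catA => e; apply: ce_trans _ e.
by apply: ce_sym; rewrite catA; apply: ce_rKrev.
Qed.

Lemma ce_commute_pow x y k : ce_commute x y -> ce_commute x (pow y k).
Proof.
move=> h; elim: k => [|k IH]; first exact: ce_commute_nil.
exact: ce_commute_cat.
Qed.

Lemma pow_ce x y k : x =c y -> pow x k =c pow y k.
Proof.
move=> h; elim: k => [|k IH]; first exact: ce_refl.
by rewrite !powS; apply: ce_cat.
Qed.

Lemma pow_cat x y k : ce_commute x y -> pow (x ++ y) k =c pow x k ++ pow y k.
Proof.
move=> h; elim: k => [|k IH]; first exact: ce_refl.
rewrite !powS -!catA; apply: ce_catl; apply: ce_trans (ce_catl y IH) _.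
rewrite !catA; apply: ce_catr; apply: ce_sym.
exact/ce_commute_sym/ce_commute_pow/ce_commute_sym.
Qed.

Lemma pow_mul x i j : pow x (i * j) = pow (pow x i) j.
Proof. by elim: j => [|j IH]; rewrite ?muln0 // mulnS pow_add IH. Qed.

Lemma pow_nil_ce x k : x =c [::] -> pow x k =c [::].
Proof.
move=> h; elim: k => [|k IH]; first exact: ce_refl.
by rewrite powS; apply: ce_trans (ce_cat h IH) (ce_refl _).
Qed.

Lemma powSr x k : pow x k.+1 = pow x k ++ x.
Proof. by rewrite -addn1 pow_add /pow /= cats0. Qed.

Lemma all_pow (S : {set V}) x k : all (mem S) x -> all (mem S) (pow x k).
Proof. by move=> h; elim: k => // k IH; rewrite powS all_cat h. Qed.

(** Two of the powers x^0, ..., x^n with n the size of l coincide, so the order of x is at most n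
    and divides n!. *)
Lemma spherical_exponent (S : {set V}) : spherical S ->
  exists2 M, 0 < M & forall x, all (mem S) x -> pow x M =c [::].
Proof.
move=> [l hl]; exists (size l)`!; rewrite ?fact_gt0 // => x xS.
have /choice[g hg] : forall i, exists r, r \in l /\ pow x i =c r.
  by move=> i; have [r rl e] := hl _ (all_pow i xS); exists r.
have [ij|no] := pselect (exists i j, [/\ i < j, j <= size l & pow x i =c pow x j]); last first.
  have gl : {subset [seq g i | i <- iota 0 (size l).+1] <= l}.
    by move=> z /mapP[i _ ->]; case: (hg i).
  have gu : uniq [seq g i | i <- iota 0 (size l).+1].
    rewrite map_inj_in_uniq ?iota_uniq // => i j; rewrite !mem_iota !add0n !ltnS /=.
    move=> il jl gij; have [_ ei] := hg i; have [_ ej] := hg j; rewrite -gij in ej.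
    have e := ce_trans ei (ce_sym ej).
    case: (ltngtP i j) => // lt; case: no; [by exists i, j|].
    by exists j, i; split=> //; apply: ce_sym.
  by have := uniq_leq_size gu gl; rewrite size_map size_iota ltnn.
case: ij => i [j [ij jl e]].
have /dvdnP[q ->] : j - i %| (size l)`! by apply: dvdn_fact; lia.
rewrite mulnC pow_mul; apply: pow_nil_ce; apply: ce_sym.
by apply: (@ce_cancell _ (pow x i)); rewrite cats0 -pow_add subnKC // ltnW.
Qed.

End Commutation.

Section Degenerate.
Variable G : coxeter_graph.
Local Notation V := (cox_V G).
Local Notation word := (seq (cox_V G)).
Local Notation "x =c y" := (@cox_eq G x y) (at level 70).
Implicit Types (u v : V) (c w x y z : word).

Variables (A B : {set V}) (a b : V).
Hypothesis sep : separation A B.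
Hypotheses (aA : a \in A) (aB : a \notin B) (bB : b \in B) (bA : b \notin A).
Hypothesis degA : forall v, v \in A -> v = a \/ [/\ v \in B, cox_E a v & cox_m a v = 2].
Hypothesis degB : forall v, v \in B -> v = b \/ [/\ v \in A, cox_E b v & cox_m b v = 2].
Local Notation C := (A :&: B).

Lemma letters v : [\/ v = a, v = b | v \in C].
Proof.
have : v \in A :|: B by case: sep => ->; rewrite inE.
rewrite inE => /orP[vA|vB].
  case: (degA vA) => [->|[vB _ _]]; first by constructor 1.
  by constructor 3; rewrite inE vA.
case: (degB vB) => [->|[vA _ _]]; first by constructor 2.
by constructor 3; rewrite inE vA.
Qed.

Lemma ab_neq : a != b. Proof. by apply: contraNneq bA => <-. Qed.

Lemma commute_gen v u : v \in C -> u = a \/ u = b -> ce_commute [:: v] [:: u].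
Proof.
rewrite inE => /andP[vA vB] hu.
have [e m2] : cox_E u v /\ cox_m u v = 2.
  case: hu => ->.
    by case: (degA vA) => [va|[]//]; move: aB; rewrite -va vB.
  by case: (degB vB) => [vb|[]//]; move: bA; rewrite -vb vA.
have := ce_braid [::] [::] e; rewrite m2 /= => h.
exact/ce_sym/(@ce_mover _ [:: u; v] [:: u; v] [::]).
Qed.

Lemma commute_special c u : all (mem C) c -> u = a \/ u = b -> ce_commute c [:: u].
Proof.
move=> + hu; elim: c => [|v c IH]; first by move=> _; apply/ce_commute_sym/ce_commute_nil.
move=> /= /andP[vC cC]; rewrite -cat1s; apply/ce_commute_sym/ce_commute_cat.
  exact/ce_commute_sym/commute_gen.
exact/ce_commute_sym/IH.
Qed.

(* Starts with b if d holds, and with a otherwise. *)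
Fixpoint ray (d : bool) k : word :=
  if k is k'.+1 then ray d k' ++ [:: if odd k' (+) d then b else a] else [::].

Lemma ray_last d k u : u = a \/ u = b -> exists d' k', ray d k ++ [:: u] =c ray d' k'.
Proof.
move=> hu; have [e|ne] := eqVneq u (if odd k (+) d then b else a).
  by exists d, k.+1; rewrite /= -e; apply: ce_refl.
case: k ne => [|k] ne.
  exists (~~ d), 1; case: d hu ne => /= -[->|->]; rewrite ?eqxx // => _; exact: ce_refl.
exists d, k; rewrite /=.
have -> : u = (if odd k (+) d then b else a).
  by case: hu ne => ->; rewrite /= addNb; case: (_ (+) _) => //=; rewrite ?eqxx.
exact: ce_rconsK.
Qed.

Lemma normal_form w : exists d k c, all (mem C) c /\ w =c ray d k ++ c.
Proof.
elim/last_ind: w => [|w v [d [k [c [cC e]]]]].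
  by exists false, 0, [::]; split=> //; apply: ce_refl.
rewrite -cats1.
have ab : v = a \/ v = b -> exists d k c, all (mem C) c /\ w ++ [:: v] =c ray d k ++ c.
  move=> hv; have [d' [k' e']] := ray_last d k hv; exists d', k', c; split=> //.
  apply: ce_trans (ce_catr _ e) _; rewrite -catA.
  apply: ce_trans (ce_catl _ (commute_special cC hv)) _.
  by rewrite catA; apply: ce_catr.
case: (letters v) => [va|vb|vC]; [by apply: ab; left|by apply: ab; right|].
exists d, k, (c ++ [:: v]); rewrite all_cat cC /= vC; split=> //.
by rewrite catA; apply: ce_catr.
Qed.

Local Open Scope ring_scope.

(* W acts on the line Z through its infinite dihedral quotient <a, b>; the boolean
   records the orientation. *)
Definition line_step (p : bool * int) v : bool * int :=
  if v == a then (~~ p.1, if p.1 then p.2 - 1 else p.2 + 1)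
  else if v == b then (~~ p.1, if p.1 then p.2 + 1 else p.2 - 1) else p.

Lemma line_stepK p v : line_step (line_step p v) v = p.
Proof.
rewrite /line_step; case: p => -[] n; case: eqP => _ //=; rewrite ?addrK ?subrK //.
  by case: eqP => _ //=; rewrite ?addrK ?subrK.
by case: eqP => _ //=; rewrite ?addrK ?subrK.
Qed.

Lemma line_step_special p v : v \in C -> line_step p v = p.
Proof.
rewrite inE /line_step => /andP[vA vB].
have /negbTE-> : v != a by apply: contraNneq aB => <-.
by have /negbTE-> : v != b by apply: contraNneq bA => <-.
Qed.

Lemma walk_special p c : all (mem C) c -> foldl line_step p c = p.
Proof. by elim: c p => //= v c IH p /andP[/line_step_special-> /IH]. Qed.

Lemma walk_ce p x y : x =c y -> foldl line_step p x = foldl line_step p y.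
Proof.
move=> h; elim: h p => {x y} [//|x y _ IH p|x y z _ IH1 _ IH2 p|x y v p|x y v v' e p].
- by rewrite IH.
- by rewrite IH1.
- by rewrite !foldl_cat /= line_stepK.
- rewrite !foldl_cat; congr foldl; move: (foldl line_step p x) => {}p.
  have special : v \in C -> v' \in C ->
      foldl line_step p (flatten (nseq (cox_m v v') [:: v; v'])) = p.
    move=> vC v'C; apply: walk_special; elim: (cox_m v v') => //= n ->.
    by rewrite vC v'C.
  have m2 u t : cox_E u t -> t \in C -> u = a \/ u = b -> cox_m u t = 2.
    rewrite inE => _ /andP[tA tB] [->|->].
      by case: (degA tA) => [ta|[]//]; move: aB; rewrite -ta tB.
    by case: (degB tB) => [tb|[]//]; move: bA; rewrite -tb tA.
  have noab : ~ cox_E a b.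
    case: sep => _ edges _ _ _ /edges[[_]|[]]; first by rewrite (negPf bA).
    by rewrite (negPf aB).
  have mix : v \in C -> v' = a \/ v' = b ->
      foldl line_step p (flatten (nseq (cox_m v v') [:: v; v'])) = p.
    move=> vC h; rewrite cox_m_sym (m2 v' v) 1?cox_E_sym //= !(line_step_special _ vC).
    exact: line_stepK.
  have mix' : v' \in C -> v = a \/ v = b ->
      foldl line_step p (flatten (nseq (cox_m v v') [:: v; v'])) = p.
    by move=> vC h; rewrite (m2 v v') //= !(line_step_special _ vC) line_stepK.
  case: (letters v) (letters v') => [va|vb|vC] [va'|vb'|vC'].
  + by move: e; rewrite va va' cox_E_irr.
  + by case: noab; rewrite -va -vb'.
  + by apply: mix' => //; left.
  + by case: noab; rewrite -vb -va' cox_E_sym.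
  + by move: e; rewrite vb vb' cox_E_irr.
  + by apply: mix' => //; right.
  + by apply: mix => //; left.
  + by apply: mix => //; right.
  + exact: special.
Qed.

Definition pos w : int := (foldl line_step (false, 0) w).2.

Lemma pos_ce x y : x =c y -> pos x = pos y.
Proof. by move=> /walk_ce h; rewrite /pos h. Qed.

Lemma pos_special x c : all (mem C) c -> pos (x ++ c) = pos x.
Proof. by move=> cC; rewrite /pos foldl_cat walk_special. Qed.

Lemma pos_ray d k : pos (ray d k) = if d then - k%:Z else k%:Z.
Proof.
suff H : foldl line_step (false, 0) (ray d k) = (odd k, if d then - k%:Z else k%:Z).
  by rewrite /pos H.
elim: k => [|k IH]; first by case: d.
rewrite [ray _ _]/= foldl_cat IH /= /line_step /=.
have ba := ab_neq; rewrite eq_sym in ba.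
by case: d {IH}; case: (odd k); rewrite /= ?eqxx ?(negPf ba); congr (_, _); lia.
Qed.

Local Close Scope ring_scope.

(** Beyond the positions met by K, an element lies on one of two rays up to W_C, and each ray is
    connected there. Of three infinite components, two would contain the tail of the same ray. *)
Lemma degenerate_ends n : ends_ge G n -> n <= 2.
Proof.
move=> [K [xs [sx inf dis]]]; rewrite leqNgt; apply/negP => n3.
pose N := \max_(k <- K) `|pos k|%N.
pose P z := N < `|pos z|%N.
have cP : ce_closed P by move=> x y /pos_ce; rewrite /P => ->.
have PK z : P z -> notinK K z.
  move=> Pz k /InP kK /pos_ce zk; move: Pz; rewrite /P zk ltnNge.
  by rewrite (leq_bigmax_seq (P := xpredT) (F := fun k => `|pos k|%N)).
have [l hl] : spherical C by case: sep.
(* Representatives of all elements within distance N of position 0; an infinite component leaves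
   this list, hence reaches a ray beyond N. *)
pose L := [seq q ++ r | q <- [seq ray d k | d <- [:: true; false], k <- iota 0 N.+1], r <- l].
have P_ray d k : N < k -> P (ray d k) by rewrite /P pos_ray; case: d; rewrite ?abszN.
have cK : ce_closed (notinK K) := @notinK_ce _ _.
have drop_special d k c : N < k -> all (mem C) c ->
    conn (notinK K) (ray d k ++ c) (ray d k).
  move=> Nk cC; exists (rev c); split=> [i _|]; last exact: ce_rKrev.
  apply: PK; rewrite /P -catA pos_special; first exact: P_ray.
  rewrite all_cat cC /=; have : all (mem C) (rev c) by rewrite all_rev.
  by rewrite -{1}(cat_take_drop i (rev c)) all_cat => /andP[].
have along d k j : N < k -> conn (notinK K) (ray d k) (ray d (k + j)).
  move=> Nk; elim: j => [|j IH].
    by rewrite addn0; apply: conn_ce; [apply/PK/P_ray|apply: ce_refl].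
  rewrite addnS; apply: (conn_trans cK IH); apply: conn_step; apply/PK.
    by apply: P_ray; rewrite ltn_addr.
  by apply: (P_ray d (k + j).+1); rewrite ltnS ltnW // ltn_addr.
have same d k k' : N < k -> N < k' -> conn (notinK K) (ray d k) (ray d k').
  move=> Nk Nk'; case: (leqP k k') => [le|/ltnW le].
    by have := along d k (k' - k) Nk; rewrite subnKC.
  by apply: conn_sym => //; have := along d k' (k - k') Nk'; rewrite subnKC.
have /choice[d hd] : forall i, exists d, i < n ->
    exists2 k, N < k & conn (notinK K) (nth [::] xs i) (ray d k).
  move=> i; case: (boolP (i < n)) => [ni|]; last by exists true.
  have xi : In (nth [::] xs i) xs by apply/InP/mem_nth; rewrite sx.
  have [_ /(_ L)[y [cy yL]]] := inf _ xi; have [d [k [c [cC e]]]] := normal_form y.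
  have Nk : N < k.
    rewrite ltnNge; apply/negP => kN; have [r rl cr] := hl c cC.
    apply: (yL (ray d k ++ r)); last exact: ce_trans e (ce_catl _ cr).
    apply/InP/allpairsP; exists (ray d k, r); split; [|exact: rl|by []].
    apply/allpairsP; exists (d, k); rewrite mem_iota add0n ltnS kN; split=> //.
    by case: d {e}.
  exists d => _; exists k => //.
  have Ny : notinK K y := conn_start (conn_sym cK cy).
  exact: conn_trans cK (conn_trans cK cy (conn_ce Ny e)) (drop_special _ _ _ Nk cC).
have clash i j : i < j -> j < n -> d i = d j -> False.
  move=> ij jn dij; have [k Nk ck] := hd i (ltn_trans ij jn).
  have [k' Nk' ck'] := hd j jn; rewrite -dij in ck'.
  apply: (dis i j); rewrite ?ij //.
  exact: conn_trans cK (conn_trans cK ck (same _ _ _ Nk Nk')) (conn_sym cK ck').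
have := clash 0 1 isT (ltnW n3); have := clash 0 2 isT n3; have := clash 1 2 isT n3.
by case: (d 0) (d 1) (d 2) => -[] [] h1 h2 h3; (case: h1 || case: h2 || case: h3).
Qed.

Lemma ray_odd k d : odd k -> rev (ray d k) = ray d k.
Proof.
have ray_cons j e : ray e j.+1 = (if e then b else a) :: ray (~~ e) j.
  elim: j => [|j IH]; first by case: e.
  rewrite [LHS]/= -/(ray e j.+1) IH cat_cons; congr cons; rewrite /=; congr (_ ++ _).
  by rewrite addNb addbN.
elim/ltn_ind: k d => -[|[|k]] IH d // ok.
have okk : odd k by move: ok; rewrite /= negbK.
have -> : ray d k.+2 = (if d then b else a) :: ray (~~ d) k ++ [:: if d then b else a].
  by rewrite ray_cons /= okk; case: d.
by rewrite rev_cons rev_cat /= IH // -cats1.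
Qed.

Lemma ray_even j d : ray d j.*2 = pow (if d then [:: b; a] else [:: a; b]) j.
Proof.
elim: j => // j IH; rewrite doubleS powSr -IH /= odd_double -catA.
by case: d {IH}.
Qed.

(** Write x = r c with r a ray and c in W_C commuting with it. The exponent M kills c. An odd ray is
    a palindrome, hence an involution, and the factor 2 kills it; an even ray is a power of ab or of
    its inverse. *)
Lemma degenerate_law : exists2 k, 0 < k &
  forall x y, ce_commute (pow x k) (pow y k).
Proof.
have [M M0 hM] : exists2 M, 0 < M & forall x, all (mem C) x -> pow x M =c [::].
  by apply: spherical_exponent; case: sep.
pose t := [:: a; b]; exists (2 * M); first by rewrite muln_gt0.
have translation x : exists i, pow x (2 * M) =c pow t i \/ pow x (2 * M) =c rev (pow t i).
  have [d [k [c [cC e]]]] := normal_form x.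
  have com : ce_commute (ray d k) c.
    apply: ce_commute_sym; elim: k {e} => [|k IH]; first exact: ce_commute_nil.
    apply: ce_commute_cat IH _; apply: commute_special => //.
    by case: (_ (+) _); [right|left].
  have e' : pow x (2 * M) =c pow (ray d k) (2 * M).
    apply: ce_trans (pow_ce _ e) _; apply: ce_trans (pow_cat _ com) _.
    rewrite -[X in _ =c X]cats0; apply: ce_catl; rewrite mulnC pow_mul.
    exact/pow_nil_ce/hM.
  case: (boolP (odd k)) => ok.
    exists 0; left; apply: ce_trans e' _; rewrite pow_mul; apply: pow_nil_ce.
    rewrite /pow /= cats0 -{2}(ray_odd d ok); exact: ce_revr.
  have ek : k = k./2.*2 by rewrite -[LHS]odd_double_half (negPf ok).
  rewrite ek ray_even -pow_mul in e'; exists (k./2 * (2 * M)).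
  case: d {e com} e' => e'; [right|by left].
  apply: ce_trans e' _; move: (_ * _) => i.
  have -> : pow [:: b; a] i = rev (pow t i); last exact: ce_refl.
  by elim: i => // i IH; rewrite powS IH powSr rev_cat.
have tt i j : ce_commute (pow t i) (pow t j).
  by rewrite /ce_commute -!pow_add addnC; apply: ce_refl.
move=> x y; have [i hx] := translation x; have [j hy] := translation y.
have ttr i' j' : ce_commute (pow t i') (rev (pow t j')) := ce_commute_rev (tt i' j').
case: hx => /ce_sym hx; case: hy => /ce_sym hy; apply: (ce_commute_ce hx hy) => //.
  exact/ce_commute_sym.
exact/ce_commute_rev/ce_commute_sym.
Qed.

End Degenerate.

Section DegenerateOrNot.
Variable G : coxeter_graph.
Implicit Types A B : {set cox_V G}.

Lemma half_degenerate_ends A B n : separation A B ->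
  half_degenerate A B -> half_degenerate B A -> ends_ge G n -> n <= 2.
Proof.
by move=> sep [a [aA aB dA]] [b [bB bA dB]]; apply: (degenerate_ends sep aA aB bB bA dA dB).
Qed.

Lemma half_degenerate_law A B : separation A B ->
  half_degenerate A B -> half_degenerate B A -> exists2 k, 0 < k &
  forall x y : seq (cox_V G), ce_commute (pow x k) (pow y k).
Proof.
by move=> sep [a [aA aB dA]] [b [bB bA dB]]; apply: (degenerate_law sep aB bA dA dB).
Qed.

End DegenerateOrNot.

(** * Orbits of prime period *)

Section Orbits.
Variables (T : Type) (R : T -> T -> Prop).
Hypotheses (Rrefl : forall x, R x x) (Rsym : forall x y, R x y -> R y x).
Hypothesis Rtrans : forall x y z, R x y -> R y z -> R x z.
Variables (s : T -> T) (q : nat).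
Hypotheses (Rs : forall x y, R x y -> R (s x) (s y)) (q_pr : prime q).

Lemma R_iter i x y : R x y -> R (iter i s x) (iter i s y).
Proof. by elim: i => //= i IH /IH/Rs. Qed.

Lemma R_iter_mul d k x : R x (iter d s x) -> R x (iter (k * d) s x).
Proof.
move=> h; elim: k => [|k IH]; first exact: Rrefl.
by rewrite mulSn iterD; apply: Rtrans h (R_iter d IH).
Qed.

(** By Bezout, a period d prime to q forces the period one: an orbit has one or q points. *)
Lemma R_coprime d x : R x (iter q s x) -> 0 < d -> d < q -> R x (iter d s x) -> R x (s x).
Proof.
move=> hq d0 dq hd; have q0 := prime_gt0 q_pr.
have : gcdn d q = 1.
  by apply/eqP; rewrite -/(coprime d q) coprime_sym prime_coprime // gtnNdvd.
case: (egcdnP q d0) => km kn e _ g; rewrite g addn1 in e.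
have h1 := R_iter_mul km hd; have h2 := R_iter_mul kn hq; rewrite e /= in h1.
exact: Rtrans h1 (Rs (Rsym h2)).
Qed.

Definition orbit_of x : T -> Prop := fun y => exists i, R y (iter i s x).

(** The choice depends on the orbit P alone, x0 being a mere default, so all points of an orbit
    share their base point. *)
Definition orbit_rep (P : T -> Prop) (x0 : T) : T :=
  if pselect (exists y, P y) is left e then projT1 (cid e) else x0.

Lemma orbit_repP x x0 : orbit_of x (orbit_rep (orbit_of x) x0).
Proof.
rewrite /orbit_rep; case: pselect => [e|[]]; first by case: cid.
by exists x, 0; apply: Rrefl.
Qed.

Lemma orbit_repE P x0 x1 : (exists y, P y) -> orbit_rep P x0 = orbit_rep P x1.
Proof. by rewrite /orbit_rep; case: pselect. Qed.

Lemma orbit_ex x : exists i, `[< R (orbit_rep (orbit_of x) x) (iter i s x) >].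
Proof. by have [i h] := orbit_repP x x; exists i; apply/asboolP. Qed.

(* Number of steps from x to the chosen base point of its orbit. *)
Definition orbit_idx x : nat := ex_minn (orbit_ex x).

Lemma orbit_idx_eq x y : orbit_of x = orbit_of y ->
  orbit_rep (orbit_of x) x = orbit_rep (orbit_of y) y.
Proof. by move=> e; rewrite -e; apply: orbit_repE; exists x, 0; apply: Rrefl. Qed.

Lemma orbit_idxP x : R (orbit_rep (orbit_of x) x) (iter (orbit_idx x) s x).
Proof. by rewrite /orbit_idx; case: ex_minnP => i /asboolP. Qed.

Lemma orbit_idx_min x i :
  R (orbit_rep (orbit_of x) x) (iter i s x) -> orbit_idx x <= i.
Proof.
by rewrite /orbit_idx; case: ex_minnP => j _ min h; apply: min; apply/asboolP.
Qed.

Lemma orbit_of_R x y : R x y -> orbit_of x = orbit_of y.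
Proof.
move=> xy; apply/funext => z; rewrite propeqE; split=> -[i h]; exists i.
  exact: Rtrans h (R_iter i xy).
exact: Rtrans h (R_iter i (Rsym xy)).
Qed.

Lemma orbit_idx_R x y : R x y -> orbit_idx x = orbit_idx y.
Proof.
move=> xy; have e := orbit_idx_eq (orbit_of_R xy).
apply/eqP; rewrite eqn_leq; apply/andP; split; apply: orbit_idx_min.
  by rewrite e; apply: Rtrans (orbit_idxP y) (R_iter _ (Rsym xy)).
by rewrite -e; apply: Rtrans (orbit_idxP x) (R_iter _ xy).
Qed.

Definition periodic x := R x (iter q s x).
Definition free x := periodic x /\ ~ R x (s x).

Lemma periodic_s x : periodic x -> periodic (s x).
Proof. by rewrite /periodic -iterSr; apply: Rs. Qed.

Lemma periodic_iter i x : periodic x -> periodic (iter i s x).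
Proof. by elim: i => //= i IH /IH/periodic_s. Qed.

Lemma fixed_iter i x : R x (s x) -> R (iter i s x) (s (iter i s x)).
Proof. by move=> h; rewrite -iterS iterSr; apply: R_iter. Qed.

Lemma free_iter i x : i <= q -> free x -> free (iter i s x).
Proof.
move=> iq [px fx]; split; first exact: periodic_iter.
move=> /(fixed_iter (q - i)); rewrite -iterD subnK // => h; apply: fx.
exact: Rtrans px (Rtrans h (Rs (Rsym px))).
Qed.

Lemma orbit_of_s x : periodic x -> orbit_of (s x) = orbit_of x.
Proof.
move=> px; apply/funext => z; rewrite propeqE; split=> -[i h].
  by exists i.+1; rewrite iterSr.
exists (i + q.-1); rewrite iterD -iterSr prednK ?prime_gt0 //.
exact: Rtrans h (R_iter i px).
Qed.

Lemma orbit_idx_lt x : periodic x -> orbit_idx x < q.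
Proof.
move=> px; have q0 := prime_gt0 q_pr.
apply: leq_ltn_trans (ltn_pmod (orbit_idx x) q0); apply: orbit_idx_min.
apply: Rtrans (orbit_idxP x) _; rewrite {1}(divn_eq (orbit_idx x) q) addnC iterD.
apply: R_iter; apply: Rsym; exact: R_iter_mul.
Qed.

Lemma orbit_idx_s x : free x ->
  orbit_idx (s x) = if orbit_idx x is j.+1 then j else q.-1.
Proof.
move=> fx; have [px nfx] := fx; have q0 := prime_gt0 q_pr.
have e := orbit_idx_eq (orbit_of_s px).
have := orbit_idxP x; case E : (orbit_idx x) => [|j] /= h.
  apply/eqP; rewrite eqn_leq; apply/andP; split.
    apply: orbit_idx_min; rewrite e -iterSr prednK //; exact: Rtrans h px.
  rewrite leqNgt; apply/negP => lt; apply: nfx.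
  apply: (@R_coprime (orbit_idx (s x)).+1) => //; first by rewrite -ltn_predRL.
  apply: Rtrans (Rsym h) _; rewrite -e iterSr; exact: orbit_idxP.
apply/eqP; rewrite eqn_leq; apply/andP; split.
  by apply: orbit_idx_min; rewrite e -iterSr.
rewrite -ltnS -E; apply: orbit_idx_min; rewrite -e iterSr; exact: orbit_idxP.
Qed.

Lemma orbit_idx_iter0 x i : free x -> i < q ->
  (orbit_idx (iter i s x) == 0) = (i == orbit_idx x).
Proof.
move=> fx; have lt := orbit_idx_lt fx.1.
have H : i < q -> orbit_idx (iter i s x) =
    if i <= orbit_idx x then orbit_idx x - i else orbit_idx x + q - i.
  elim: i => [|i IH] iq; first by rewrite subn0.
  rewrite iterS (orbit_idx_s (free_iter (ltnW (ltnW iq)) fx)) IH; last exact: ltnW.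
  have -> m : (if m is j.+1 then j else q.-1) = if m == 0 then q.-1 else m.-1.
    by case: m.
  by case: (leqP i (orbit_idx x)); case: ifP; case: ifP; lia.
by move=> iq; rewrite H //; case: ifP; lia.
Qed.

Local Open Scope ring_scope.
Variable K : zmodType.
Implicit Types h : T -> K.

Definition Rinvar h := forall x y, R x y -> h x = h y.

Lemma free_R x y : R x y -> free x -> free y.
Proof.
move=> xy [px fx]; split.
  exact: Rtrans (Rsym xy) (Rtrans px (R_iter q xy)).
by move=> fy; apply: fx; apply: Rtrans xy (Rtrans fy (Rs (Rsym xy))).
Qed.

(** The witness is h at the base point of each free orbit and 0 elsewhere: exactly one of the q
    iterates is a base point. At a fixed point its sum is zero, hence the condition on h there. *)
Lemma orbit_trace h : Rinvar h -> (forall x, h (s x) = h x) ->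
  exists2 l, Rinvar l & forall x, periodic x -> (R x (s x) -> h x = 0) ->
    \sum_(i < q) l (iter i s x) = h x.
Proof.
move=> Rh sh; exists (fun x => if `[< free x >] && (orbit_idx x == 0%N) then h x else 0).
  move=> x y xy; rewrite (Rh _ _ xy) (orbit_idx_R xy); congr (if _ && _ then _ else _).
  by apply/asboolP/asboolP; apply: free_R; [|exact: Rsym].
move=> x px h0; have [fx|nfx] := pselect (R x (s x)).
  rewrite big1 ?h0 // => i _; case: asboolP => // -[_ []]; exact: fixed_iter.
have Fx : free x by [].
have hi i : h (iter i s x) = h x by elim: i => //= i <-.
rewrite (bigD1 (Ordinal (orbit_idx_lt px))) //= hi.
have /asboolP-> := free_iter (ltnW (orbit_idx_lt px)) Fx.
rewrite orbit_idx_iter0 ?eqxx ?orbit_idx_lt //= big1 ?addr0 // => i.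
by rewrite -val_eqE /= orbit_idx_iter0 // => /negbTE->; rewrite andbF.
Qed.

(** Additive Hilbert 90: l sums h from x up to the base point of its orbit, excluded. The vanishing
    trace enters where the orbit wraps around. *)
Lemma orbit_hilbert90 h : Rinvar h ->
  exists2 l, Rinvar l & forall x, free x ->
    \sum_(i < q) h (iter i s x) = 0 -> l x - l (s x) = h x.
Proof.
move=> Rh; exists (fun x => \sum_(i < orbit_idx x) h (iter i s x)).
  move=> x y xy; rewrite (orbit_idx_R xy); apply: eq_bigr => i _.
  exact/Rh/R_iter.
move=> x fx; have q0 := prime_gt0 q_pr; rewrite orbit_idx_s //.
have shift n : \sum_(i < n) h (iter i s (s x)) = \sum_(i < n.+1) h (iter i s x) - h x.
  rewrite big_ord_recl addrC addKr; apply: eq_bigr => i _.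
  by rewrite /= /bump /= -iterSr.
case: (orbit_idx x) => [|j].
  by rewrite shift prednK // => ->; rewrite big_ord0 !sub0r opprK.
by rewrite shift subKr.
Qed.

End Orbits.

(** * Finite levels of the profinite completion *)

Section Levels.
Variable G : coxeter_graph.
Local Notation V := (cox_V G).
Local Notation word := (seq (cox_V G)).
Local Notation "x =c y" := (@cox_eq G x y) (at level 70).
Local Notation level := (fin_normal (cox_gops G)).
Implicit Types (u x y z w : word) (N M : level).

Definition eqN N x y := proj1_sig N (x ++ rev y).
Definition finer M N := forall x, proj1_sig M x -> proj1_sig N x.

Lemma lev_ce N x y : x =c y -> proj1_sig N x -> proj1_sig N y.
Proof. by case: N => N /= [h _]; apply: h. Qed.

Lemma lev1 N : proj1_sig N [::].
Proof. by case: N => N /= [_ [h _]]. Qed.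

Lemma levM N x y : proj1_sig N x -> proj1_sig N y -> proj1_sig N (x ++ y).
Proof. by case: N => N /= [_ [_ [h _]]]; apply: h. Qed.

Lemma levV N x : proj1_sig N x -> proj1_sig N (rev x).
Proof. by case: N => N /= [_ [_ [_ [h _]]]]; apply: h. Qed.

Lemma levJ N x g : proj1_sig N x -> proj1_sig N (rev g ++ (x ++ g)).
Proof. by rewrite catA; case: N => N /= [_ [_ [_ [_ [h _]]]]]; apply: h. Qed.

Lemma levJV N x g : proj1_sig N x -> proj1_sig N (g ++ (x ++ rev g)).
Proof. by move=> /(levJ (rev g)); rewrite revK. Qed.

Lemma ce_eqN N x y : x =c y -> eqN N x y.
Proof. by move=> /ce_rev1 h; apply: lev_ce (ce_sym h) (lev1 N). Qed.

Lemma eqN_refl N x : eqN N x x.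
Proof. exact/ce_eqN/ce_refl. Qed.

Lemma eqN_sym N x y : eqN N x y -> eqN N y x.
Proof. by move/levV; rewrite rev_cat revK. Qed.

Lemma eqN_trans N x y z : eqN N x y -> eqN N y z -> eqN N x z.
Proof.
move=> h1 h2; apply: lev_ce (levM h1 h2); rewrite -catA.
exact/ce_catl/ce_revKl.
Qed.

Lemma eqN_catr N u x y : eqN N x y -> eqN N (x ++ u) (y ++ u).
Proof.
apply: lev_ce; rewrite rev_cat -catA; apply/ce_catl/ce_sym; exact: ce_revKr.
Qed.

Lemma eqN_catl N u x y : eqN N x y -> eqN N (u ++ x) (u ++ y).
Proof. by move=> /(levJV u); rewrite /eqN rev_cat -!catA. Qed.

Lemma eqN_cat N x x' y y' : eqN N x x' -> eqN N y y' -> eqN N (x ++ y) (x' ++ y').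
Proof. by move=> h1 h2; apply: eqN_trans (eqN_catr _ h1) (eqN_catl _ h2). Qed.

Lemma eqN_lP N x y : eqN N x y <-> proj1_sig N (rev y ++ x).
Proof.
split=> [/(levJ y)|/(levJV y)]; apply: lev_ce; first exact/ce_catl/ce_rrevK.
rewrite -!catA; exact: ce_revKr.
Qed.

Lemma eqN_cancell N u x y : eqN N (u ++ x) (u ++ y) -> eqN N x y.
Proof.
move=> /(eqN_catl (rev u)) h; apply: eqN_trans (ce_eqN N (ce_sym (ce_revKl u x))) _.
exact: eqN_trans h (ce_eqN N (ce_revKl u y)).
Qed.

Lemma eqN_cancelr N u x y : eqN N (x ++ u) (y ++ u) -> eqN N x y.
Proof.
move=> /(eqN_catr (rev u)) h; apply: eqN_trans (ce_eqN N (ce_sym (ce_rKrev x u))) _.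
exact: eqN_trans h (ce_eqN N (ce_rKrev y u)).
Qed.

Lemma eqN_finer M N x y : finer M N -> eqN M x y -> eqN N x y.
Proof. by move=> h /h. Qed.

Lemma finer_trans N M L : finer N M -> finer M L -> finer N L.
Proof. by move=> h1 h2 x /h1/h2. Qed.

Lemma level_reps N : exists l : seq word, forall x, exists2 r, r \in l & eqN N x r.
Proof.
case: N => N hN; have [_ [_ [_ [_ [_ [l hl]]]]]] := hN; exists l => x.
by have [r /InP rl h] := hl x; exists r.
Qed.

Lemma level_classes N : exists (I : finType) (cl : word -> I),
  (forall x y, cl x = cl y -> eqN N x y).
Proof.
have [l hl] := level_reps N.
have /choice[r hr] : forall x, exists r, r \in l /\ eqN N x r.
  by move=> x; have [r rl e] := hl x; exists r.
exists (seq_sub l), (fun x => SeqSub (hr x).1) => x y /(congr1 val) /= e.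
by apply: eqN_trans (hr x).2 _; rewrite e; apply: eqN_sym (hr y).2.
Qed.

Lemma mk_level (N : word -> Prop) (I : finType) (cl : word -> I) :
  (forall x y, x =c y -> N x -> N y) -> N [::] ->
  (forall x y, N x -> N y -> N (x ++ y)) -> (forall x, N x -> N (rev x)) ->
  (forall x g, N x -> N (rev g ++ (x ++ g))) ->
  (forall x y, cl x = cl y -> N (x ++ rev y)) -> @fi_normal (cox_gops G) N.
Proof.
move=> h1 h2 h3 h4 h5 h6; split=> //; split=> //; split=> //; split=> //; split.
  by move=> x g /= /(h5 x g); rewrite catA.
have [l hl] := finite_classes cl; exists l => x; have [r rl e] := hl x.
by exists r => //; apply: h6.
Qed.

Lemma level_inter N M : exists L, finer L N /\ finer L M.
Proof.
have [I [f hf]] := level_classes N; have [J [g hg]] := level_classes M.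
have h : @fi_normal (cox_gops G) (fun x => proj1_sig N x /\ proj1_sig M x).
  apply: (@mk_level _ _ (fun x => (f x, g x))).
  - by move=> x y e [] /(lev_ce e) ? /(lev_ce e).
  - by split; apply: lev1.
  - by move=> x y [? ?] [? ?]; split; apply: levM.
  - by move=> x [? ?]; split; apply: levV.
  - by move=> x u [? ?]; split; apply: levJ.
  - by move=> x y [/hf ? /hg].
by exists (exist _ _ h); split=> x [].
Qed.

Lemma level_inters (I : finType) (N : I -> level) N0 :
  exists2 M, finer M N0 & forall i, finer M (N i).
Proof.
suff H (s : seq I) : exists2 M, finer M N0 & forall i, i \in s -> finer M (N i).
  by have [M h0 h] := H (enum I); exists M => // i; apply: h; rewrite mem_enum.
elim: s => [|i s [M h0 hM]]; first by exists N0.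
have [L [h1 h2]] := level_inter M (N i); exists L; first exact: finer_trans h1 h0.
by move=> j; rewrite in_cons => /orP[/eqP->//|/hM]; apply: finer_trans.
Qed.

Lemma ex_level : exists N : level, True.
Proof.
by exists (exist _ (fun=> True) (@mk_level (fun=> True) unit (fun=> tt)
  (fun _ _ _ h => h) I (fun _ _ _ h => h) (fun _ h => h) (fun _ _ h => h) (fun _ _ _ => I))).
Qed.

(* Locally constant functions of level N on the cosets of the special subgroup S. *)
Definition LC (T : Type) N (S : {set V}) (f : word -> T) :=
  (forall x y, eqN N x y -> f x = f y) /\ rinvar S f.

(** Same point of the finite set N \ W / W_S, the level N picture of the vertices or edges of the
    profinite tree. *)
Definition eqc N (S : {set V}) x y := exists2 u, all (mem S) u & eqN N y (x ++ u).

Lemma eqc_refl N S x : eqc N S x x.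
Proof. by exists [::] => //; rewrite cats0; apply: eqN_refl. Qed.

Lemma eqN_eqc N S x y : eqN N x y -> eqc N S x y.
Proof. by move=> h; exists [::] => //; rewrite cats0; apply: eqN_sym. Qed.

Lemma eqc_sym N S x y : eqc N S x y -> eqc N S y x.
Proof.
move=> [u uS h]; exists (rev u); first by rewrite all_rev.
apply: eqN_sym; apply: eqN_trans (eqN_catr _ h) _; exact/ce_eqN/ce_rKrev.
Qed.

Lemma eqc_trans N S x y z : eqc N S x y -> eqc N S y z -> eqc N S x z.
Proof.
move=> [u uS h] [w wS h']; exists (u ++ w); first by rewrite all_cat uS.
by apply: eqN_trans h' _; rewrite catA; apply: eqN_catr.
Qed.

Lemma eqc_catl N S p x y : eqc N S x y -> eqc N S (p ++ x) (p ++ y).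
Proof. by move=> [u uS h]; exists u => //; rewrite -catA; apply: eqN_catl. Qed.

Lemma eqc_finer M N S x y : finer M N -> eqc M S x y -> eqc N S x y.
Proof. by move=> h [u uS e]; exists u => //; apply: eqN_finer e. Qed.

Lemma eqc_sub N (S S' : {set V}) x y : S \subset S' -> eqc N S x y -> eqc N S' x y.
Proof.
move=> /subsetP sub [u uS e]; exists u => //.
by apply/allP => v /(allP uS) /=; apply: sub.
Qed.

Lemma LC_eqc (T : Type) N S (f : word -> T) x y : LC N S f -> eqc N S x y -> f x = f y.
Proof. by move=> [h1 h2] [u uS /h1->]; rewrite (rinvar_cat _ h2 uS). Qed.

Lemma LC_of_eqc (T : Type) N S (f : word -> T) :
  (forall x y, eqc N S x y -> f x = f y) -> LC N S f.
Proof.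
move=> h; split=> [x y e|x v vS]; first exact/h/eqN_eqc.
by apply/esym/h; exists [:: v]; rewrite /= ?vS //; apply: eqN_refl.
Qed.

Lemma LC_finer (T : Type) M N S (f : word -> T) : finer M N -> LC N S f -> LC M S f.
Proof. by move=> h [h1 h2]; split=> // x y /(eqN_finer h)/h1. Qed.

Lemma LC_sub (T : Type) N (S S' : {set V}) (f : word -> T) :
  S' \subset S -> LC N S f -> LC N S' f.
Proof. by move=> /subsetP h [h1 h2]; split=> // x v /h; apply: h2. Qed.

Lemma LC_ce (T : Type) N S (f : word -> T) : LC N S f -> ce_invar f.
Proof. by move=> [h _] x y /(ce_eqN N)/h. Qed.

Lemma LC_comp (T T' : Type) N S (f : word -> T) (g : T -> T') :
  LC N S f -> LC N S (fun x => g (f x)).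
Proof. by move=> [h1 h2]; split=> [x y /h1->|x v /(h2 x)->]. Qed.

Lemma LC_comp2 (T T' T'' : Type) N S (f : word -> T) (f' : word -> T') (g : T -> T' -> T'') :
  LC N S f -> LC N S f' -> LC N S (fun x => g (f x) (f' x)).
Proof.
move=> [h1 h2] [h1' h2']; split=> [x y e|x v vS]; first by rewrite (h1 _ _ e) (h1' _ _ e).
by rewrite h2 // h2'.
Qed.

Local Open Scope ring_scope.

Lemma LC_sum (K : zmodType) (I : finType) N S (P : pred I) (f : I -> word -> K) :
  (forall i, LC N S (f i)) -> LC N S (fun x => \sum_(i | P i) f i x).
Proof.
move=> h; split=> [x y e|x v vS]; apply: eq_bigr => i _; first by apply: (h i).1.
exact: (h i).2.
Qed.

Variables A B : {set V}.
Hypothesis cover : A :|: B = setT.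
Hypothesis edges : forall u v : V, cox_E u v -> (u \in A /\ v \in A) \/ (u \in B /\ v \in B).
Local Notation C := (A :&: B).

(* The primitive of h varies by an additive character chi under left translation by
   N; the level is lowered to the largest normal subgroup on which chi vanishes. *)
Lemma LC_primitive (K : finZmodType) N (h : word -> K) : LC N C h ->
  exists M (kA kB : word -> K), [/\ finer M N, LC M A kA, LC M B kB &
    forall x, h x = kB x - kA x].
Proof.
move=> hN; have ch := LC_ce hN; have hC := hN.2.
pose kA := primitive A h; pose kB x := kA x + h x.
have ckA : ce_invar kA := primitive_ce cover edges ch hC.
have rA : rinvar A kA by apply: primitive_rinvarA.
have rB : rinvar B kB := primitive_rinvarB hC.
have chi n x y : proj1_sig N n -> kA (n ++ x) - kA x = kA (n ++ y) - kA y.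
  move=> Nn; have hn z : h (n ++ z) = h z.
    by apply: hN.1; apply: lev_ce Nn; rewrite -catA -[X in X =c _]cats0;
      apply/ce_catl/ce_sym/ce_revr.
  have r1 : rinvar A (fun z => kA (n ++ z) - kA z) by move=> z v vA; rewrite catA !rA.
  have r2 : rinvar B (fun z => kB (n ++ z) - kB z) by move=> z v vB; rewrite catA !rB.
  have key z : kA (n ++ z) - kA z = kB (n ++ z) - kB z.
    by rewrite /kB hn opprD addrACA subrr addr0.
  have cst := rinvar_const cover r1 r2 key.
  by rewrite cst [RHS]cst.
(* kA (x n) - kA x is the value of chi at x n x^-1 *)
have chiJ n x : proj1_sig N n -> forall z, kA (x ++ n ++ rev x ++ z) - kA z = kA (x ++ n) - kA x.
  move=> Nn z; have Nn' : proj1_sig N (x ++ (n ++ rev x)) by apply: levJV.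
  have := chi _ z x Nn'; rewrite -!catA => ->; congr (_ - _); apply: ckA.
  by rewrite -[X in _ =c X]cats0 -catA; apply/ce_catl/ce_catl/ce_revl.
pose Mp n := proj1_sig N n /\ forall x, kA (x ++ n) = kA x.
have [I [cl hcl]] := level_classes N; have [l hl] := level_reps N.
have hM : @fi_normal (cox_gops G) Mp.
  (* Finiteness of K makes this a map to a finite type. If x and y have the same image, n = x y^-1
     satisfies kA (r n) = kA r for each of the finitely many representatives r, and chi extends this
     to every z. *)
  apply: (@mk_level _ _ (fun x => (cl x, [ffun i : 'I_(size l) => kA (nth [::] l i ++ x)]))).
  - move=> x y e [Nx hx]; split; first exact: lev_ce Nx.
    by move=> z; rewrite -(hx z); apply: ckA; apply/ce_catl/ce_sym.
  - by split=> [|x]; [exact: lev1|rewrite cats0].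
  - by move=> x y [Nx hx] [Ny hy]; split=> [|z]; [exact: levM|rewrite catA hy hx].
  - move=> x [Nx hx]; split=> [|z]; first exact: levV.
    by rewrite -(hx (z ++ rev x)); apply: ckA; apply: ce_rrevK.
  - move=> x g [Nx hx]; split=> [|z]; first exact: levJ.
    have := chiJ x (z ++ rev g) Nx z; rewrite hx subrr => /subr0_eq <-.
    by rewrite rev_cat revK -!catA; apply: ckA; do 3 apply: ce_catl;
      rewrite -[X in X =c _]cats0; apply/ce_catl/ce_sym/ce_revl.
  - move=> x y [exy /ffunP e]; have Nn := hcl x y exy; split=> // z.
    set n := x ++ rev y in Nn *.
    have [r rl zr] := hl z.
    have kr : kA (r ++ n) = kA r.
      have ir : (index r l < size l)%N by rewrite index_mem.
      have := e (Ordinal ir); rewrite !ffunE /= nth_index // => exy'.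
      have := chiJ n r Nn (r ++ y).
      have -> : kA (r ++ n ++ rev r ++ r ++ y) = kA (r ++ x).
        apply: ckA; apply: ce_catl; rewrite /n -catA; apply: ce_trans (ce_catl x _) _.
          exact: (ce_catl _ (ce_revKl r y)).
        by rewrite -[X in _ =c X]cats0; apply/ce_catl/ce_revl.
      by rewrite exy' subrr => /esym/subr0_eq.
    have zz p : z ++ p =c (z ++ rev r) ++ (r ++ p).
      by rewrite -catA; apply/ce_catl/ce_sym/ce_revKl.
    have := chi _ (r ++ n) r zr; rewrite -(ckA _ _ (zz n)) kr => /addIr ->.
    by apply: ckA; apply: ce_rrevK.
exists (exist _ Mp hM), kA, kB.
have fM : finer (exist _ Mp hM) N by move=> x [].
have kAM : LC (exist _ Mp hM) A kA.
  split=> // x y /eqN_lP [_ /(_ y) <-]; apply: ckA; apply: ce_sym; exact: ce_revKr.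
split=> //; last by move=> x; rewrite /kB addrC addKr.
split=> // x y e; rewrite /kB (kAM.1 _ _ e); congr (_ + _).
exact: hN.1 _ _ (eqN_finer fM e).
Qed.

End Levels.

(** * Fixed subtrees of the profinite Bass-Serre tree *)

Lemma subr_swap (K : zmodType) (a b c d : K) : (d - c = b - a -> a - c = b - d)%R.
Proof.
move=> e; have -> : (b = d - c + a)%R by rewrite e subrK.
by rewrite [RHS]addrAC (addrAC d) subrr sub0r addrC.
Qed.

Section Smith.
Variables G G' : coxeter_graph.
Local Notation V := (cox_V G).
Local Notation word := (seq (cox_V G)).
Local Notation word' := (seq (cox_V G')).
Local Notation "x =c y" := (@cox_eq _ x y) (at level 70).
Local Notation level := (fin_normal (cox_gops G)).
Implicit Types (x y z : word) (p r : word') (F : seq word') (N M : level) (S : {set V}).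

(** A homomorphism from W' to the completion of W, seen through its finite levels: [phi N] is
    multiplicative on words and respects the relations of W' modulo N. *)
Variable phi : level -> word' -> word.
Hypothesis phi_cat : forall N p r, phi N (p ++ r) = phi N p ++ phi N r.
Hypothesis phi_nil : forall N, phi N [::] = [::].
Hypothesis phi_ce : forall N p r, p =c r -> eqN N (phi N p) (phi N r).
Hypothesis phi_finer : forall M N p, finer M N -> eqN N (phi M p) (phi N p).

Variables A B : {set V}.
Hypothesis cover : A :|: B = setT.
Hypothesis edges : forall u v : V, cox_E u v -> (u \in A /\ v \in A) \/ (u \in B /\ v \in B).
Local Notation C := (A :&: B).

Lemma phi_revKr N p y : eqN N (phi N p ++ (phi N (rev p) ++ y)) y.
Proof.
rewrite catA -phi_cat; have /(eqN_catr y) := phi_ce N (ce_revr p).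
by rewrite phi_nil.
Qed.

Lemma phi_revKl N p y : eqN N (phi N (rev p) ++ (phi N p ++ y)) y.
Proof. by have := phi_revKr N (rev p) y; rewrite revK. Qed.

Definition Fix N S x p := eqc N S x (phi N p ++ x).

Lemma Fix_nil N S x : Fix N S x [::].
Proof. by rewrite /Fix phi_nil; apply: eqc_refl. Qed.

Lemma Fix_cat N S x p r : Fix N S x p -> Fix N S x r -> Fix N S x (p ++ r).
Proof.
rewrite /Fix phi_cat -catA => hp hr.
exact: eqc_trans hp (eqc_catl _ hr).
Qed.

Lemma Fix_ce N S x p r : p =c r -> Fix N S x p -> Fix N S x r.
Proof. by move=> /(phi_ce N) e h; apply: eqc_trans h (eqN_eqc _ (eqN_catr x e)). Qed.

Lemma Fix_rev N S x p : Fix N S x p -> Fix N S x (rev p).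
Proof.
move=> /(eqc_catl (phi N (rev p)))/eqc_sym; rewrite catA -phi_cat.
by apply: eqc_trans; have := Fix_ce (ce_sym (ce_revl p)) (Fix_nil N S x).
Qed.

Lemma Fix_pow N S x p k : Fix N S x p -> Fix N S x (pow p k).
Proof.
move=> h; elim: k => [|k IH]; first exact: Fix_nil.
by rewrite powS; apply: Fix_cat.
Qed.

Lemma Fix_finer M N S x p : finer M N -> Fix M S x p -> Fix N S x p.
Proof.
move=> h /(eqc_finer h) e; apply: eqc_trans e _.
exact/eqN_eqc/eqN_catr/phi_finer.
Qed.

Lemma Fix_sub N S S' x p : S \subset S' -> Fix N S x p -> Fix N S' x p.
Proof. exact: eqc_sub. Qed.

Lemma Fix_eqc N S x y p : eqc N S x y -> Fix N S x p -> Fix N S y p.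
Proof.
move=> e h; apply: eqc_trans (eqc_sym e) _; apply: eqc_trans h _; exact: eqc_catl.
Qed.

Lemma Fix_conj N S x p r : Fix N S x (rev r ++ (p ++ r)) -> Fix N S (phi N r ++ x) p.
Proof.
rewrite /Fix phi_cat -catA => /(eqc_catl (phi N r)); rewrite phi_cat.
move=> e; apply: eqc_trans e _; apply: eqN_eqc; rewrite -!catA.
exact: phi_revKr.
Qed.

Definition FixF N S F x := forall p, p \in F -> Fix N S x p.

Lemma FixF_finer M N S F x : finer M N -> FixF M S F x -> FixF N S F x.
Proof. by move=> h hF p /hF/(Fix_finer h). Qed.

Lemma FixF_sub N S S' F x : S \subset S' -> FixF N S F x -> FixF N S' F x.
Proof. by move=> h hF p /hF/(Fix_sub h). Qed.

(* The F-fixed part of the profinite Bass-Serre tree is nonempty and connected. *)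
Definition fix_nonempty F := forall N, exists x, FixF N A F x \/ FixF N B F x.

(** A cell fixed at level N need not come from a fixed cell of the limit. Constancy is therefore
    asserted on the vertices fixed at some finer level M, as compactness would give. *)
Definition fix_connected F := forall N (fA fB : word -> bool),
  LC N A fA -> LC N B fB -> (forall x, FixF N C F x -> fA x = fB x) ->
  exists c M, finer M N /\ forall x,
    (FixF M A F x -> fA x = c) /\ (FixF M B F x -> fB x = c).

Definition fix_tree F := fix_nonempty F /\ fix_connected F.

Lemma fix_connected_fin (K : finType) F N (fA fB : word -> K) : fix_tree F ->
  LC N A fA -> LC N B fB -> (forall x, FixF N C F x -> fA x = fB x) ->
  exists c M, finer M N /\ forall x,
    (FixF M A F x -> fA x = c) /\ (FixF M B F x -> fB x = c).
Proof.
move=> [ne con] hA hB hC.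
have test t : exists cM : bool * level, finer cM.2 N /\ forall x,
    (FixF cM.2 A F x -> (fA x == t) = cM.1) /\ (FixF cM.2 B F x -> (fB x == t) = cM.1).
  have [||x /hC->|c [M hM]] // := con N (fun x => fA x == t) (fun x => fB x == t).
  - exact: (LC_comp (fun k : K => k == t) hA).
  - exact: (LC_comp (fun k : K => k == t) hB).
  - by exists (c, M).
have /choice[cM hcM] := test.
have [M hMN hM] := level_inters (fun t => (cM t).2) N.
have eqA x t : FixF M A F x -> (fA x == t) = (cM t).1.
  by move=> h; apply: ((hcM t).2 x).1; apply: FixF_finer h.
have eqB x t : FixF M B F x -> (fB x == t) = (cM t).1.
  by move=> h; apply: ((hcM t).2 x).2; apply: FixF_finer h.
have [x0 hx0] := ne M.
exists (if pselect (FixF M A F x0) is left _ then fA x0 else fB x0), M.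
split=> // x; case: pselect => [h0|n0].
  by split=> h; apply/eqP; rewrite (eqA, eqB) // -(eqA x0).
have {hx0}h0 : FixF M B F x0 by case: hx0.
by split=> h; apply/eqP; rewrite (eqA, eqB) // -(eqB x0).
Qed.

Lemma FixF_weaken F F' : (forall N S x, FixF N S F' x -> FixF N S F x) ->
  (forall N S x, FixF N S F x -> FixF N S F' x) -> fix_tree F -> fix_tree F'.
Proof.
move=> h1 h2 [ne con]; split=> [N|N fA fB hA hB hC].
  by have [x [] h] := ne N; exists x; [left|right]; apply: h2.
have [|c [M [hM h]]] := con N fA fB hA hB; first by move=> x /h2/hC.
exists c, M; split=> // x; have [hxA hxB] := h x.
by split=> /h1; [apply: hxA|apply: hxB].
Qed.

Lemma fix_tree_nil : fix_tree [::].
Proof.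
split=> [N|N fA fB hA hB hC]; first by exists [::]; left.
have e x : fA x = fB x by apply: hC.
have cst := rinvar_const cover hA.2 hB.2 e.
by exists (fA [::]), N; split=> // x; rewrite -e cst.
Qed.

Section SmithStep.
Variables (F : seq word') (s : word') (q : nat).
Hypotheses (treeF : fix_tree F) (q_pr : prime q).
Hypothesis normF : forall N S x, FixF N S F x -> FixF N S F (phi N s ++ x).
Hypothesis perF : forall N S x, FixF N S F x -> Fix N S x (pow s q).

Let K := 'F_q.
Local Notation actN N := (fun x => phi N s ++ x).

Lemma iter_act N i x : iter i (actN N) x = phi N (pow s i) ++ x.
Proof.
elim: i => [|i IH]; first by rewrite /= /pow /= phi_nil.
by rewrite iterS IH powS phi_cat catA.
Qed.

Lemma actN_eqc N S x y : eqc N S x y -> eqc N S (actN N x) (actN N y).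
Proof. exact: eqc_catl. Qed.

Lemma FixF_iter N S i x : FixF N S F x -> FixF N S F (iter i (actN N) x).
Proof. by elim: i => //= i IH /IH/normF. Qed.

Lemma periodicF N S x : FixF N S F x -> periodic (eqc N S) (actN N) q x.
Proof. by move=> /perF; rewrite /periodic iter_act. Qed.

Lemma LC_iter (T : Type) M N S (f : word -> T) i x : finer M N -> LC N S f ->
  f (iter i (actN M) x) = f (iter i (actN N) x).
Proof.
move=> h hf; rewrite !iter_act; apply: hf.1; apply: eqN_catr; exact: phi_finer.
Qed.

Lemma LC_act (T : Type) M N S (f : word -> T) x : finer M N -> LC N S f ->
  f (actN M x) = f (actN N x).
Proof. exact: (@LC_iter _ _ _ _ _ 1). Qed.

Lemma LC_iter_LC (T : Type) N S (f : word -> T) i : LC N S f ->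
  LC N S (fun x => f (iter i (actN N) x)).
Proof.
move=> hf; apply: LC_of_eqc => x y e; apply: (LC_eqc hf).
by rewrite !iter_act; apply: eqc_catl.
Qed.

Lemma Fix_act N S x : Fix N S (actN N x) s <-> Fix N S x s.
Proof.
split=> [/(eqc_catl (phi N (rev s)))|]; last exact: eqc_catl.
move=> e; apply: eqc_trans (eqN_eqc _ (eqN_sym (phi_revKl N s x))) _.
exact: eqc_trans e (eqN_eqc _ (phi_revKl N s _)).
Qed.

Lemma Fix_iter N S x i : Fix N S x s -> eqc N S x (iter i (actN N) x).
Proof. by move=> /(Fix_pow i); rewrite iter_act. Qed.

Lemma FixF_cons N S x : FixF N S (s :: F) x <-> Fix N S x s /\ FixF N S F x.
Proof.
split=> [h|[h1 h2] p]; last by rewrite in_cons => /orP[/eqP->|/h2].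
by split=> [|p pF]; apply: h; rewrite ?mem_head // in_cons pF orbT.
Qed.

Local Open Scope ring_scope.

Lemma q_char (k : K) : k *+ q = 0.
Proof. by rewrite -mulr_natr pchar_Fp_0 // mulr0. Qed.

Definition trunc N S (f : word -> bool) x : K := if `[< Fix N S x s >] && f x then 1 else 0.

Lemma trunc_LC N S f : LC N S f -> LC N S (trunc N S f).
Proof.
move=> hf; apply: LC_of_eqc => x y e; rewrite /trunc (LC_eqc hf e).
by congr (if _ && _ then _ else _); apply/asboolP/asboolP; apply: Fix_eqc => //; apply: eqc_sym.
Qed.

Lemma trunc_act N S f x : LC N S f -> trunc N S f (actN N x) = trunc N S f x.
Proof.
move=> hf; rewrite /trunc; case: asboolP => [/Fix_act h|h]; last first.
  by case: asboolP => // /Fix_act.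
by have /asboolP-> := h; rewrite (LC_eqc hf h).
Qed.

(** Restricted to s-fixed vertices and extended by 0, f becomes t. Its coboundary is s-invariant and
    vanishes on fixed edges, so it is the trace of some l, and l is the coboundary of some k. Then t
    minus the trace of k has no coboundary on the F-fixed tree, hence is constant there. At an
    s-fixed vertex the trace of k is q k = 0, so t is this constant. *)
Lemma smith_connected : fix_connected (s :: F).
Proof.
move=> N fA fB hA hB hC; pose tA := trunc N A fA; pose tB := trunc N B fB.
have tA_LC := trunc_LC hA; have tB_LC := trunc_LC hB.
pose h x := tB x - tA x.
have hLC : LC N C h.
  apply: (LC_comp2 (fun a b => a - b)); first exact: LC_sub (subsetIr A B) tB_LC.
  exact: LC_sub (subsetIl A B) tA_LC.
have hact x : h (actN N x) = h x by rewrite /h /tB /tA !trunc_act.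
have [l lR hl] := orbit_trace (@eqc_refl _ N C) (@eqc_sym _ N C) (@eqc_trans _ N C)
  (@actN_eqc N C) q_pr (fun x y e => LC_eqc hLC e) hact.
have lN : LC N C l by apply: LC_of_eqc.
have suml x : FixF N C F x -> \sum_(i < q) l (iter i (actN N) x) = h x.
  move=> hx; apply: hl; first exact: periodicF.
  move=> fx; have e : fA x = fB x by apply: hC; apply/FixF_cons.
  rewrite /h /tB /tA /trunc e.
  have /asboolP-> : Fix N A x s := Fix_sub (subsetIl A B) fx.
  by have /asboolP-> : Fix N B x s := Fix_sub (subsetIr A B) fx; rewrite subrr.
have [M [kA [kB [MN kA_LC kB_LC lk]]]] := LC_primitive cover edges lN.
pose g (t k : word -> K) x := t x - \sum_(i < q) k (iter i (actN M) x).
have g_LC S t k : LC N S t -> LC M S k -> LC M S (g t k).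
  move=> tL kL; apply: (LC_comp2 (fun a b => a - b)); first exact: LC_finer tL.
  by apply: LC_sum => i; apply: LC_iter_LC.
have gAB x : FixF M C F x -> g tA kA x = g tB kB x.
  move=> hx; apply: subr_swap; rewrite -[RHS](suml x (FixF_finer MN hx)) -sumrB.
  by apply: eq_bigr => i _; rewrite -(LC_iter _ _ MN lN) lk.
have [c [L [LM hL]]] := fix_connected_fin treeF (g_LC _ _ _ tA_LC kA_LC)
  (g_LC _ _ _ tB_LC kB_LC) gAB.
have LN := finer_trans LM MN.
have gfix S t f k x : LC M S k -> t = trunc N S f -> FixF L S (s :: F) x ->
    g t k x = if f x then 1 else 0.
  move=> kL -> /FixF_cons[fx _]; have fM := Fix_finer LM fx.
  rewrite /g (eq_bigr (fun=> k x)) => [|i _]; last exact/esym/(LC_eqc kL)/Fix_iter.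
  rewrite sumr_const card_ord q_char subr0 /trunc.
  by have /asboolP-> := Fix_finer LN fx.
have val (b : bool) : (if b then 1 else 0) = c -> b = (c == 1).
  by move=> <-; case: b; rewrite ?eqxx // eq_sym oner_eq0.
exists (c == 1), L; split=> // x; have [cA cB] := hL x.
split=> hx; have [_ hF] := (FixF_cons _ _ _).1 hx; apply: val.
  by rewrite -(cA hF) (gfix A tA fA).
by rewrite -(cB hF) (gfix B tB fB).
Qed.

(** Without s-fixed vertices, 1 is the trace of some k on the F-fixed vertices. The coboundary of k
    has trace zero, so it is l - l s by Hilbert 90, with l the coboundary of some p. Then k - (p - p
    s) is a constant c on the F-fixed tree, and its trace is both q c = 0 and 1. *)
Lemma smith_nonempty : fix_nonempty (s :: F).
Proof.
move=> N; apply: contrapT => no.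
have nA x : FixF N A F x -> ~ Fix N A x s.
  by move=> hF h; apply: no; exists x; left; apply/FixF_cons.
have nB x : FixF N B F x -> ~ Fix N B x s.
  by move=> hF h; apply: no; exists x; right; apply/FixF_cons.
have unit_trace S : (forall x, FixF N S F x -> ~ Fix N S x s) ->
    exists2 k : word -> K, LC N S k &
      forall x, FixF N S F x -> \sum_(i < q) k (iter i (actN N) x) = 1.
  move=> nS; have [||l lR hl] := orbit_trace (@eqc_refl _ N S) (@eqc_sym _ N S)
    (@eqc_trans _ N S) (@actN_eqc N S) q_pr (h := fun=> 1 : K) => //.
  exists l; first exact: LC_of_eqc.
  by move=> x hx; apply: hl; [exact: periodicF|move=> h; case: (nS x hx)].
have [kA kA_LC sA] := unit_trace A nA; have [kB kB_LC sB] := unit_trace B nB.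
pose h x := kB x - kA x.
have hLC : LC N C h.
  apply: (LC_comp2 (fun a b => a - b)); first exact: LC_sub (subsetIr A B) kB_LC.
  exact: LC_sub (subsetIl A B) kA_LC.
have [l lR hl] := orbit_hilbert90 (@eqc_refl _ N C) (@eqc_sym _ N C) (@eqc_trans _ N C)
  (@actN_eqc N C) q_pr (fun x y e => LC_eqc hLC e).
have lN : LC N C l by apply: LC_of_eqc.
have hC x : FixF N C F x -> l x - l (actN N x) = h x.
  move=> hx; have hxA := FixF_sub (subsetIl A B) hx; have hxB := FixF_sub (subsetIr A B) hx.
  apply: hl; last by rewrite sumrB sA // sB // subrr.
  by split; [exact: periodicF|move=> /(Fix_sub (subsetIl A B)); apply: nA].
have [M [pA [pB [MN pA_LC pB_LC lp]]]] := LC_primitive cover edges lN.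
pose g (k p : word -> K) x := k x - (p x - p (actN M x)).
have g_LC S (k p : word -> K) : LC N S k -> LC M S p -> LC M S (g k p).
  move=> kL pL; apply: (LC_comp2 (fun a b => a - b)); first exact: LC_finer kL.
  apply: (LC_comp2 (fun a b => a - b)) => //.
  exact: (LC_iter_LC 1).
have gAB x : FixF M C F x -> g kA pA x = g kB pB x.
  move=> hx; apply: subr_swap; rewrite -[RHS](hC x (FixF_finer MN hx)).
  rewrite -(LC_act _ MN lN) !lp; rewrite !opprD !opprK !addrA.
  by congr (_ + _); apply: addrAC.
have [c [L [LM hL]]] := fix_connected_fin treeF (g_LC _ _ _ kA_LC pA_LC)
  (g_LC _ _ _ kB_LC pB_LC) gAB.
have LN := finer_trans LM MN.
have absurd S (k p : word -> K) x : LC N S k -> LC M S p ->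
    (forall x, FixF N S F x -> \sum_(i < q) k (iter i (actN N) x) = 1) ->
    (forall y, FixF L S F y -> g k p y = c) -> FixF L S F x -> False.
  move=> kL pL sk gc hx.
  have : \sum_(i < q) g k p (iter i (actN L) x) = 0.
    rewrite (eq_bigr (fun=> c)) => [|i _]; last exact/gc/FixF_iter.
    by rewrite sumr_const card_ord q_char.
  rewrite sumrB (eq_bigr (fun i : 'I_q => k (iter i (actN N) x))); last first.
    by move=> i _; rewrite (LC_iter _ _ LN kL).
  rewrite sk; last exact: FixF_finer hx.
  rewrite (eq_bigr (fun i : 'I_q => - (p (iter i.+1 (actN L) x) - p (iter i (actN L) x)))).
    rewrite sumrN -(big_mkord xpredT (fun i => p (iter i.+1 (actN L) x) - p (iter i (actN L) x))).
    rewrite telescope_sumr // opprK.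
    have <- : p x = p (iter q (actN L) x).
      by apply: (LC_eqc pL); apply: eqc_finer LM _; exact: periodicF.
    by rewrite subrr addr0 => /eqP; rewrite oner_eq0.
  by move=> i _; rewrite opprB iterS (LC_act _ LM pL).
have [x [hx|hx]] := treeF.1 L.
  by apply: (absurd A kA pA x) => // y /(proj1 (hL y)).
by apply: (absurd B kB pB x) => // y /(proj2 (hL y)).
Qed.

Lemma smith : fix_tree (s :: F).
Proof. by split; [exact: smith_nonempty|exact: smith_connected]. Qed.

End SmithStep.

End Smith.

(** * A common fixed vertex *)

Section CommonFixedPoint.
Variables G G' : coxeter_graph.
Local Notation V := (cox_V G).
Local Notation V' := (cox_V G').
Local Notation word := (seq (cox_V G)).
Local Notation word' := (seq (cox_V G')).
Local Notation "x =c y" := (@cox_eq _ x y) (at level 70).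
Local Notation level := (fin_normal (cox_gops G)).
Implicit Types (x y z : word) (p r : word') (N M L : level).

Variable phi : level -> word' -> word.
Hypothesis phi_cat : forall N p r, phi N (p ++ r) = phi N p ++ phi N r.
Hypothesis phi_nil : forall N, phi N [::] = [::].
Hypothesis phi_ce : forall N p r, p =c r -> eqN N (phi N p) (phi N r).
Hypothesis phi_finer : forall M N p, finer M N -> eqN N (phi M p) (phi N p).

Variables A B : {set V}.
Hypothesis sepAB : separation A B.
Local Notation C := (A :&: B).
Local Notation Fix := (@Fix G G' phi).
Local Notation FixF := (@FixF G G' phi).
Local Notation fix_tree := (@fix_tree G G' phi A B).

Lemma coverAB : A :|: B = setT. Proof. by case: sepAB. Qed.
Lemma edgesAB (u v : V) : cox_E u v -> (u \in A /\ v \in A) \/ (u \in B /\ v \in B).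
Proof. by case: sepAB => _ h _ _ _; apply: h. Qed.

Let smith' := smith phi_cat phi_nil phi_ce phi_finer coverAB edgesAB.

Lemma FixF1 N S p x : FixF N S [:: p] x <-> Fix N S x p.
Proof.
split=> [h|h r]; first by apply: h; rewrite mem_head.
by rewrite mem_seq1 => /eqP->.
Qed.

Lemma FixF2 N S p r x : FixF N S [:: p; r] x <-> Fix N S x p /\ Fix N S x r.
Proof.
split=> [h|[h1 h2] t]; first by split; apply: h; rewrite !inE eqxx ?orbT.
by rewrite !inE => /orP[]/eqP->.
Qed.

Lemma gen_tree (v : V') : fix_tree [:: [:: v]].
Proof.
apply: (@smith' [::] [:: v] 2) => //; first exact/fix_tree_nil/coverAB.
move=> N S x _; apply: (Fix_ce phi_ce (ce_sym (ce_vv v))); exact: Fix_nil.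
Qed.

Section Dihedral.
Variables u v : V'.
Hypothesis uv : cox_E u v.
Let rho : word' := [:: u; v].

(** Induction on m / d, from rho^m = 1 downwards: rho^d acts with prime order q, or trivially, on
    the fixed tree of rho^(dq). *)
Lemma rotation_tree d : d %| cox_m u v -> fix_tree [:: pow rho d].
Proof.
have m0 : 0 < cox_m u v := ltnW (cox_m_ge2 uv).
have [n] : exists n, cox_m u v %/ d <= n by exists (cox_m u v %/ d).
elim: n d => [|n IH] d + dm; have d0 := dvdn_gt0 m0 dm.
  by rewrite leqn0 eqn0Ngt divn_gt0 // dvdn_leq.
have [md|md] := eqVneq (cox_m u v %/ d) 1; last first.
  set q := pdiv (cox_m u v %/ d) => le.
  have gt1 : 1 < cox_m u v %/ d.
    by rewrite ltn_neqAle eq_sym md divn_gt0 // dvdn_leq.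
  have q_pr : prime q := pdiv_prime gt1.
  have dqm : d * q %| cox_m u v.
    by rewrite -(divnK dm) mulnC dvdn_pmul2r // pdiv_dvd.
  have T : fix_tree [:: pow rho (d * q)].
    apply: IH dqm; rewrite -ltnS; apply: leq_trans le.
    by rewrite divnMA ltn_Pdiv ?prime_gt1 // (ltnW gt1).
  have T' : fix_tree [:: pow rho d; pow rho (d * q)].
    apply: (@smith' _ (pow rho d) q T q_pr) => N S x /FixF1 hx; last by rewrite -pow_mul.
    apply/FixF1/(Fix_conj phi_cat phi_nil phi_ce).
    apply: (Fix_ce phi_ce _ hx); apply: ce_sym.
    apply: ce_trans (ce_catl _ _) (ce_revKl (pow rho d) _).
    by rewrite -!pow_add addnC; apply: ce_refl.
  apply: FixF_weaken T' => N S x; last by move=> /FixF2[hx _]; apply/FixF1.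
  move=> /FixF1 hx; apply/FixF2; split=> //; rewrite pow_mul.
  exact: (Fix_pow phi_cat phi_nil).
move=> _; have -> : d = cox_m u v by rewrite -(divnK dm) md mul1n.
apply: (FixF_weaken _ _ (fix_tree_nil phi coverAB)) => N S x _ //.
apply/FixF1; apply: (Fix_ce phi_ce _ (Fix_nil phi_nil N S x)); apply: ce_sym.
by have := ce_braid [::] [::] uv; rewrite cats0.
Qed.

(** The reflection u inverts rho, so it preserves the fixed tree of rho; a last step with q = 2
    applies, and u and rho generate v. *)
Lemma edge_fixed N : exists x,
  (Fix N A x [:: u] /\ Fix N A x [:: v]) \/ (Fix N B x [:: u] /\ Fix N B x [:: v]).
Proof.
have T : fix_tree [:: rho] by apply: (@rotation_tree 1); rewrite dvd1n.
have T' : fix_tree [:: [:: u]; rho].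
  apply: (@smith' _ [:: u] 2 T) => // M S x /FixF1 hx; last first.
    apply: (Fix_ce phi_ce (ce_sym (ce_vv u))); exact: Fix_nil.
  apply/FixF1/(Fix_conj phi_cat phi_nil phi_ce).
  apply: (Fix_ce phi_ce _ (Fix_rev phi_cat phi_nil phi_ce hx)).
  exact: ce_sym (ce_inv [::] [:: v; u] u).
have both S x : Fix N S x [:: u] /\ Fix N S x rho -> Fix N S x [:: u] /\ Fix N S x [:: v].
  move=> [h1 h2]; split=> //.
  exact: (Fix_ce phi_ce (ce_inv [::] [:: v] u) (Fix_cat phi_cat h1 h2)).
have [x [] /FixF2 /both h] := T'.1 N; exists x; [by left|by right].
Qed.

End Dihedral.

Hypothesis nsep' : ~ separable G'.
Hypothesis inf' : ~ spherical [set: V'].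
Hypothesis phi_inj : forall p, (forall N, eqN N (phi N p) [::]) -> p =c [::].

Lemma spherical_sub (S S' : {set V'}) : S \subset S' -> spherical S' -> spherical S.
Proof.
move=> /subsetP sub [l hl]; exists l => p pS; apply: hl.
by apply/allP => v /(allP pS) /=; apply: sub.
Qed.

Lemma Fix_word N S x p : (forall v, v \in p -> Fix N S x [:: v]) -> Fix N S x p.
Proof.
elim: p => [|v p IH] h; first exact: Fix_nil.
rewrite -cat1s; apply: (Fix_cat phi_cat); first by apply: h; rewrite mem_head.
by apply: IH => w wp; apply: h; rewrite in_cons wp orbT.
Qed.

Lemma nonspherical_seq (S : {set V'}) : ~ spherical S ->
  exists f : nat -> word', (forall i, all (mem S) (f i)) /\
    (forall i j, i < j -> ~ f i =c f j).
Proof.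
move=> nS; have /choice[F hF] : forall l : seq word',
    exists p, all (mem S) p /\ forall r, r \in l -> ~ p =c r.
  move=> l; apply: contrapT => no; apply: nS; exists l => p pS.
  by apply: contrapT => nor; apply: no; exists p; split=> // r rl pr; apply: nor; exists r.
pose L := fix L n := if n is n'.+1 then F (L n') :: L n' else [::].
exists (fun i => F (L i)); split=> [i|i j ij fij]; first by case: (hF (L i)).
suff inL : F (L i) \in L j by case: (hF (L j)) => _ /(_ _ inL); apply; apply: ce_sym.
elim: j ij {fij} => // j IH; rewrite ltnS leq_eqVlt => /orP[/eqP->|/IH h].
  by rewrite mem_head.
by rewrite in_cons h orbT.
Qed.

Lemma phi_separates p r : ~ p =c r -> exists N, ~ eqN N (phi N p) (phi N r).
Proof.
move=> pr; apply: contrapT => no; apply: pr; apply/ce_rev1/phi_inj => N.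
apply: contrapT => h; apply: no; exists N => e; apply: h.
have /(eqN_catr (phi N (rev r))) := e; rewrite -!phi_cat => h; apply: eqN_trans h _.
by rewrite -(phi_nil N); apply/phi_ce/ce_revr.
Qed.

(* Edge stabilisers are conjugates of the finite group W_C. *)
Lemma edge_stabiliser_spherical :
  exists N, forall x, spherical [set v | `[< Fix N C x [:: v] >]].
Proof.
have [l hl] : spherical C by case: sepAB.
have [N0 _] := ex_level G.
have one (S : {set V'}) : ~ spherical S ->
    exists N, forall x, ~ forall v, v \in S -> Fix N C x [:: v].
  move=> /nonspherical_seq[f [fS finj]]; set n := size l.
  have /choice[Nij hN] : forall ij : 'I_n.+1 * 'I_n.+1, exists N,
      ij.1 < ij.2 -> ~ eqN N (phi N (f ij.1)) (phi N (f ij.2)).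
    move=> [i j] /=; case: (boolP (i < j)) => ij; last by exists N0.
    by have [N h] := phi_separates (finj _ _ ij); exists N.
  (* At this level the size l + 1 elements f i stay distinct. If all of S fixed the edge of x, the
     products f i x would take at most size l values modulo N. *)
  have [N _ hNij] := level_inters Nij N0; exists N => x hx.
  have /choice[g hg] : forall i, exists r : word, r \in l /\ eqN N (phi N (f i) ++ x) (x ++ r).
    move=> i; have [|u uC e] := @Fix_word N C x (f i).
      by move=> v /(allP (fS i)); apply: hx.
    have [r rl ur] := hl u uC; exists r; split=> //.
    exact: eqN_trans e (ce_eqN N (ce_catl x ur)).
  have gl : {subset [seq g i | i <- iota 0 n.+1] <= l}.
    by move=> z /mapP[i _ ->]; case: (hg i).
  suff gu : uniq [seq g i | i <- iota 0 n.+1].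
    by have := uniq_leq_size gu gl; rewrite size_map size_iota ltnn.
  have clash i j : i < j -> j < n.+1 -> g i = g j -> False.
    move=> ij jn gij; have i_n := ltn_trans ij jn.
    apply: (hN (Ordinal i_n, Ordinal jn)) => //=.
    apply: (eqN_trans (eqN_sym (phi_finer (f i) (hNij (Ordinal i_n, Ordinal jn))))).
    apply: eqN_trans (phi_finer (f j) (hNij (Ordinal i_n, Ordinal jn))).
    apply: (eqN_finer (hNij _)); apply: (@eqN_cancelr _ _ x).
    by apply: eqN_trans (hg i).2 _; rewrite gij; apply/eqN_sym; case: (hg j).
  rewrite map_inj_in_uniq ?iota_uniq // => i j; rewrite !mem_iota !add0n /= => iN jN gij.
  by case: (ltngtP i j) => // lt; [case: (clash i j)|case: (clash j i)].
have /choice[NS hNS] : forall S : {set V'}, exists N,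
    ~ spherical S -> forall x, ~ forall v, v \in S -> Fix N C x [:: v].
  move=> S; have [sS|nS] := pselect (spherical S); first by exists N0.
  by have [N h] := one S nS; exists N.
have [N _ hN] := level_inters NS N0; exists N => x; apply: contrapT => nS.
apply: (hNS _ nS x) => v; rewrite inE => /asboolP.
exact: (Fix_finer phi_finer (hN _)).
Qed.

Local Open Scope ring_scope.
Local Notation K := ('F_2 : finFieldType).

Definition edge_type N x : {set V'} := [set v | `[< Fix N C x [:: v] >]].

Definition vanishes M (kA kB : word -> K) (u : V') := forall x,
  (Fix M A x [:: u] -> kA x = 0) /\ (Fix M B x [:: u] -> kB x = 0).

(* A function supported on edges of type S has a primitive that is constant on each
   fixed tree of u outside S; these trees meet along edges, and the complement of S
   is connected, so the constants agree and can be normalised to 0. *)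
Lemma normalised_primitive N (S : {set V'}) (h : word -> K) :
  LC N C h -> spherical S -> (forall x, h x <> 0 -> edge_type N x = S) ->
  exists M (kA kB : word -> K), [/\ finer M N, LC M A kA, LC M B kB,
    forall x, h x = kB x - kA x & forall u, u \notin S -> vanishes M kA kB u].
Proof.
move=> hLC sphS hS; have [M [kA [kB [MN kA_LC kB_LC hk]]]] :=
  LC_primitive coverAB edgesAB hLC.
have /choice[cM hcM] : forall u, exists cL : K * level, u \notin S ->
    finer cL.2 M /\ forall x, (FixF cL.2 A [:: [:: u]] x -> kA x = cL.1) /\
                              (FixF cL.2 B [:: [:: u]] x -> kB x = cL.1).
  move=> u; case: (boolP (u \in S)) => uS; first by exists (0, M).
  have [x /FixF1 hx|c [L hL]] := fix_connected_fin phi_finer (gen_tree u) kA_LC kB_LC; last first.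
    by exists (c, L).
  apply/esym/eqP; rewrite -subr_eq0 -hk; apply/eqP; apply: contrapT => nh; have e := hS _ nh.
  move: uS; rewrite -e inE => /asboolP; apply; exact: (Fix_finer phi_finer MN).
have [L LM hL] := level_inters (fun u => (cM u).2) M.
have valA u x : u \notin S -> Fix L A x [:: u] -> kA x = (cM u).1.
  move=> uS hx; have [_ /(_ x)[hA _]] := hcM u uS; apply: hA.
  by apply/FixF1; apply: (Fix_finer phi_finer (hL u)).
have valB u x : u \notin S -> Fix L B x [:: u] -> kB x = (cM u).1.
  move=> uS hx; have [_ /(_ x)[_ hB]] := hcM u uS; apply: hB.
  by apply/FixF1; apply: (Fix_finer phi_finer (hL u)).
have cst : forall u v, u \notin S -> v \notin S -> (cM u).1 = (cM v).1.
  apply: (unseparable_const (c := fun u => (cM u).1) nsep' sphS) => u v uS vS uv.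
  have [x [[h1 h2]|[h1 h2]]] := edge_fixed uv L.
    by rewrite -(valA u x) // -(valA v x).
  by rewrite -(valB u x) // -(valB v x).
have [u0 u0S] : exists u, u \notin S.
  apply: contrapT => no; apply: inf'; apply: spherical_sub sphS; apply/subsetP => u _.
  by apply/negPn/negP => uS; apply: no; exists u.
exists L, (fun x => kA x - (cM u0).1), (fun x => kB x - (cM u0).1); split.
- exact: finer_trans LM MN.
- exact: (LC_comp (fun k : K => k - (cM u0).1) (LC_finer LM kA_LC)).
- exact: (LC_comp (fun k : K => k - (cM u0).1) (LC_finer LM kB_LC)).
- by move=> x; rewrite hk opprD opprK addrA addrAC addrNK addrC.
- move=> u uS x; split=> hx; first by rewrite (valA u x) // (cst u u0) // subrr.
  by rewrite (valB u x) // (cst u u0) // subrr.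
Qed.

(** One generator that moves the vertex is singled out. If no vertex is fixed by all generators, the
    indicators of [moved] = v form a partition of unity, and v fixes no vertex in the support of its
    own term. *)
Definition moved N S x : option V' := [pick v | ~~ `[< Fix N S x [:: v] >]].

Lemma moved_LC N S : LC N S (moved N S).
Proof.
apply: LC_of_eqc => x y e; apply: eq_pick => v; congr (~~ _).
by apply/asboolP/asboolP; apply: Fix_eqc => //; apply: eqc_sym.
Qed.

Lemma moved_fix N S x v : Fix N S x [:: v] -> moved N S x != Some v.
Proof.
move=> h; rewrite /moved; case: pickP => [u /asboolP hu|//].
by apply: contra_notN hu => /eqP[->].
Qed.

Lemma finset_sum_eq (S : {set V'}) (c : K) : \sum_(T : {set V'}) c *+ (S == T) = c.
Proof.
rewrite (bigD1 S) //= eqxx mulr1n big1 ?addr0 // => T.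
by rewrite eq_sym => /negbTE->.
Qed.

(* If no vertex is fixed by all generators, 1 = sum_v f_v where f_v is supported on
   vertices moved by v. Splitting d f_v by edge type gives f_v = sum_S k_(v,S) with
   k_(v,S) normalised, while sum_v k_(v,S) is a normalised primitive of 0. *)
Lemma common_fixed_point N0 : exists x,
  (forall v, Fix N0 A x [:: v]) \/ (forall v, Fix N0 B x [:: v]).
Proof.
apply: contrapT => no.
have [N1 hN1] := edge_stabiliser_spherical; have [N [NN0 NN1]] := level_inter N0 N1.
have sphE x : spherical (edge_type N x).
  apply: spherical_sub (hN1 x); apply/subsetP => v; rewrite !inE => /asboolP h.
  by apply/asboolP; apply: Fix_finer h.
pose f S v x : K := (moved N S x == Some v)%:R.
have f_LC S v : LC N S (f S v).
  exact: (LC_comp (fun o : option V' => (o == Some v)%:R : K) (moved_LC N S)).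
have f_fix S v x : Fix N S x [:: v] -> f S v x = 0.
  by move=> /moved_fix/negbTE h; rewrite /f h.
have f_sum S x : S = A \/ S = B -> \sum_v f S v x = 1.
  move=> hS; case E : (moved N S x) => [v|].
    rewrite (bigD1 v) //= {1}/f E eqxx big1 ?addr0 // => u uv.
    by rewrite /f E; case: eqP => // -[vu]; rewrite vu eqxx in uv.
  move: E; rewrite /moved; case: pickP => // none _; case: no; exists x.
  have all_fix v : Fix N0 S x [:: v].
    by have /negbFE/asboolP := none v; apply: Fix_finer.
  by case: hS all_fix => ->; [left|right].
pose h (vS : V' * {set V'}) x := (f B vS.1 x - f A vS.1 x) *+ (edge_type N x == vS.2).
have E_LC : LC N C (edge_type N).
  apply: LC_of_eqc => x y e; apply/setP => v; rewrite !inE.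
  by apply/asboolP/asboolP; apply: Fix_eqc => //; apply: eqc_sym.
have d_LC v : LC N C (fun x => f B v x - f A v x).
  apply: (LC_comp2 (fun a b : K => a - b)).
    exact: LC_sub (subsetIr A B) (f_LC B v).
  exact: LC_sub (subsetIl A B) (f_LC A v).
have h_LC vS : LC N C (h vS).
  exact: (LC_comp2 (fun (a : K) (T : {set V'}) => a *+ (T == vS.2)) (d_LC vS.1) E_LC).
have /choice[P hP] : forall vS, exists P : level * ((word -> K) * (word -> K)),
    [/\ LC P.1 A P.2.1, LC P.1 B P.2.2, forall x, h vS x = P.2.2 x - P.2.1 x,
      (forall x, h vS x = 0) -> forall x, P.2.1 x = 0 /\ P.2.2 x = 0 &
      forall u, u \notin vS.2 -> vanishes P.1 P.2.1 P.2.2 u].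
  (* An edge type that does not occur may fail to be spherical; its h is zero and receives the zero
     primitive. *)
  move=> vS; have [h0|h0] := pselect (forall x, h vS x = 0).
    exists (N, (fun=> 0, fun=> 0)); split=> //= x; by rewrite h0 subrr.
  have hS x : h vS x <> 0 -> edge_type N x = vS.2.
    by rewrite /h; case: eqP => // _; rewrite mulr0n.
  have sphS : spherical vS.2.
    have /existsNP[x /hS <-] := h0; exact: sphE.
  have [M [kA [kB [MN kA_LC kB_LC hk van]]]] := normalised_primitive (h_LC vS) sphS hS.
  by exists (M, (kA, kB)).
pose k S vS := if S == A then (P vS).2.1 else (P vS).2.2.
have AB : (B == A) = false.
  by case: sepAB => _ _ [a aA aB] _ _; apply/negbTE; apply: contraNneq aB => ->.
have [M MN hM] := level_inters (fun vS => (P vS).1) N.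
have k_LC S vS : S = A \/ S = B -> LC M S (k S vS).
  have [PA PB _ _ _] := hP vS; rewrite /k => -[] ->; rewrite ?eqxx ?AB.
    exact: LC_finer (hM vS) PA.
  exact: LC_finer (hM vS) PB.
have k_diff vS x : k B vS x - k A vS x = h vS x.
  by have [_ _ -> _ _] := hP vS; rewrite /k eqxx AB.
have k0 S vS x : (forall x, h vS x = 0) -> k S vS x = 0.
  have [_ _ _ /(_ _ x) z _] := hP vS; move=> /z[zA zB].
  by rewrite /k; case: ifP.
have k_van S (vS : V' * {set V'}) u x :
    S = A \/ S = B -> u \notin vS.2 -> Fix M S x [:: u] -> k S vS x = 0.
  move=> hS uS hx; have [_ _ _ _ /(_ u uS x)[zA zB]] := hP vS.
  have hx' : Fix (P vS).1 S x [:: u] by apply: Fix_finer hx.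
  by rewrite /k; case: hS hx' => -> hx'; rewrite ?eqxx ?AB; [apply: zA|apply: zB].
(* A function without coboundary is constant, and a vertex fixed by u at level M gives its value. *)
have const (g : {set V} -> word -> K) u : rinvar A (g A) -> rinvar B (g B) ->
    (forall x, g A x = g B x) ->
    (forall S x, S = A \/ S = B -> Fix M S x [:: u] -> g S x = 0) -> forall x, g A x = 0.
  move=> gA gB e z x; rewrite (rinvar_const coverAB gA gB e x).
  have [y [] /FixF1 hy] := (gen_tree u).1 M.
    by rewrite -(rinvar_const coverAB gA gB e y); apply: z hy; left.
  by rewrite -(rinvar_const coverAB gA gB e y) e; apply: z hy; right.
(* Both sides have the same coboundary. At a vertex fixed by v the left side is 0, and so is each
   k_(v,T): for v outside T by normalisation, for v in T because f_v vanishes at both ends of every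
   edge of type T. *)
have step1 v x : f A v x = \sum_T k A (v, T) x.
  apply/eqP; rewrite -subr_eq0; apply/eqP.
  apply: (const (fun S x => f S v x - \sum_T k S (v, T) x) v).
  - by apply: (LC_comp2 (fun a b : K => a - b) (LC_finer MN (f_LC A v)) _).2;
      apply: LC_sum => T; apply: k_LC; left.
  - by apply: (LC_comp2 (fun a b : K => a - b) (LC_finer MN (f_LC B v)) _).2;
      apply: LC_sum => T; apply: k_LC; right.
  - move=> y; apply: subr_swap; rewrite -sumrB.
    by under eq_bigr do rewrite k_diff /h /=; rewrite finset_sum_eq.
  - move=> S y hS hy; rewrite f_fix; last exact: Fix_finer hy.
    rewrite big1 ?subrr // => T _; have [vT|vT] := boolP (v \in T); last exact: k_van hy.
    apply: k0 => z; rewrite /h /=; case: eqP => [e|_]; last by rewrite mulr0n.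
    have fz : Fix N C z [:: v] by move: vT; rewrite -e inE => /asboolP.
    rewrite !f_fix ?subrr //; [exact: Fix_sub (subsetIl A B) fz|exact: Fix_sub (subsetIr A B) fz].
(* If T occurs as an edge type it is spherical, and W' is infinite, so some u lies outside T; every
   k_(v,T) vanishes at the vertices fixed by u. *)
have step2 T x : \sum_v k A (v, T) x = 0.
  have [[u uT]|full] := pselect (exists u, u \notin T); last first.
    rewrite big1 // => v _; apply: k0 => z; rewrite /h; case: eqP => [e|_]; last by rewrite mulr0n.
    case: inf'; apply: spherical_sub (sphE z); rewrite e; apply/subsetP => u _.
    by apply/negPn/negP => uT; apply: full; exists u.
  apply: (const (fun S x => \sum_v k S (v, T) x) u).
  - by apply: (LC_sum _ _).2 => v; apply: k_LC; left.
  - by apply: (LC_sum _ _).2 => v; apply: k_LC; right.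
  - move=> y; apply/esym/eqP; rewrite -subr_eq0 -sumrB; apply/eqP.
    under eq_bigr do rewrite k_diff /h /=.
    by rewrite sumrMnl sumrB !f_sum ?subrr ?mul0rn //; [left|right].
  - by move=> S y hS hy; rewrite big1 // => v _; apply: k_van hy.
have := f_sum A [::] (or_introl erefl); under eq_bigr do rewrite step1.
rewrite exchange_big /= big1 => [/eqP|T _]; last exact: step2.
by rewrite eq_sym oner_eq0.
Qed.

Hypothesis phi_dense : forall N x, exists p, eqN N (phi N p) x.

(** If W' fixes xW_A, a word of W' approximating x b x^-1 fixes it as well, so b lies in W_A modulo
    N. The level N is chosen to exclude this, and likewise a in W_B. *)
Lemma no_dense_unseparable : False.
Proof.
have [cov edges [a aA aB] [b bB bA] _] := sepAB.
have [NA hNA sA] := special_separable bA; have [NB hNB sB] := special_separable aB.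
have [N [finA finB]] := level_inter (exist _ NA hNA) (exist _ NB hNB).
have key S (t : V) x : (forall v, Fix N S x [:: v]) ->
    exists2 u, all (mem S) u & eqN N u [:: t].
  move=> hx; have [p hp] := phi_dense N (x ++ ([:: t] ++ rev x)).
  have [|u uS e] := @Fix_word N S x p; first by move=> v _; apply: hx.
  exists u => //; apply: eqN_sym; apply: (@eqN_cancell _ _ x); apply: eqN_trans e.
  apply: eqN_trans (eqN_catr x (eqN_sym hp)).
  by apply/eqN_sym/ce_eqN; rewrite -!catA; apply: ce_catl;
    rewrite -[X in _ =c X]cats0; apply/ce_catl/ce_revl.
have [x [/(key A b)[u uA e]|/(key B a)[u uB e]]] := common_fixed_point N.
  exact: (sA u uA (finA _ e)).
exact: (sB u uB (finB _ e)).
Qed.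

End CommonFixedPoint.

(** * The profinite isomorphism *)

Section Transfer.
Variables G G' : coxeter_graph.
Local Notation V := (cox_V G).
Local Notation V' := (cox_V G').
Local Notation word := (seq (cox_V G)).
Local Notation word' := (seq (cox_V G')).
Local Notation "x =c y" := (@cox_eq _ x y) (at level 70).
Local Notation level := (fin_normal (cox_gops G)).
Local Notation level' := (fin_normal (cox_gops G')).
Local Notation pf := (profin (cox_gops G)).
Local Notation pf' := (profin (cox_gops G')).
Implicit Types (x y z : word) (p r : word') (N M : level).

Definition pf_const (H : coxeter_graph) (w : seq (cox_V H)) : profin (cox_gops H) :=
  @Profin (cox_gops H) (fun _ => w) (fun _ L _ => eqN_refl L w).

Lemma pf_const_prod (H : coxeter_graph) (v w : seq (cox_V H)) :
  pf_is_prod (pf_const v) (pf_const w) (pf_const (v ++ w)).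
Proof. by move=> N; apply: eqN_refl. Qed.

Lemma pf_hom_const1 (H K : coxeter_graph) (f : profin (cox_gops H) -> profin (cox_gops K)) :
  pf_hom f -> pf_eq (f (pf_const [::])) (pf_const [::]).
Proof.
move=> [_ fM] N; have e := fM _ _ _ (pf_const_prod [::] [::]) N.
by apply: (@eqN_cancell _ _ (pf_fun (f (pf_const [::])) N)); rewrite cats0; apply: eqN_sym.
Qed.

Variables (f : pf' -> pf) (g : pf -> pf').
Hypotheses (f_hom : pf_hom f) (f_cont : pf_cont f) (g_hom : pf_hom g).
Hypotheses (gfK : forall xi, pf_eq (g (f xi)) xi) (fgK : forall xi, pf_eq (f (g xi)) xi).

(** Built letter by letter, so that it is multiplicative on the nose, whereas the components of f
    are multiplicative only modulo N. *)
Definition lift N p : word := flatten [seq pf_fun (f (pf_const [:: v])) N | v <- p].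

Lemma lift_cat N p r : lift N (p ++ r) = lift N p ++ lift N r.
Proof. by rewrite /lift map_cat flatten_cat. Qed.

Lemma lift_nil N : lift N [::] = [::]. Proof. by []. Qed.

Lemma liftE N p : eqN N (lift N p) (pf_fun (f (pf_const p)) N).
Proof.
elim: p => [|v p IH]; first exact/eqN_sym/(pf_hom_const1 f_hom).
rewrite -cat1s lift_cat; apply: eqN_sym.
apply: eqN_trans (f_hom.2 _ _ _ (pf_const_prod [:: v] p) N) _.
by rewrite /lift /= cats0; apply/eqN_catl/eqN_sym.
Qed.

Lemma lift_ce N p r : p =c r -> eqN N (lift N p) (lift N r).
Proof.
move=> e; apply: eqN_trans (liftE N p) (eqN_trans _ (eqN_sym (liftE N r))).
by apply: f_hom.1 => M; apply: ce_eqN.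
Qed.

Lemma lift_finer M N p : finer M N -> eqN N (lift M p) (lift N p).
Proof.
move=> h; apply: eqN_trans (eqN_finer h (liftE M p)) _.
apply: eqN_trans (eqN_sym (liftE N p)).
exact: (pf_compat (f (pf_const p)) h).
Qed.

(** Let p be the component of g x at the level N' that continuity of f provides. Then g x = xi p
    with xi in the kernel at N', and f xi is trivial at N. *)
Lemma lift_dense N x : exists p, eqN N (lift N p) x.
Proof.
have [N' hN'] := f_cont N; pose y := g (pf_const x); pose p := pf_fun y N'.
have shift (M M' : level') (h : finer M M') :
    proj1_sig M' ((pf_fun y M ++ rev p) ++ rev (pf_fun y M' ++ rev p)).
  exact: (eqN_catr (rev p) (pf_compat y h)).
pose xi := @Profin (cox_gops G') (fun L => pf_fun y L ++ rev p) shift.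
have xi1 : pf_ker N (f xi) by apply: hN'; apply: eqN_refl.
have prod : pf_is_prod xi (pf_const p) y.
  by move=> M; apply/eqN_sym/ce_eqN/ce_rrevK.
exists p; apply: eqN_trans (liftE N p) _; apply: eqN_trans _ (fgK (pf_const x) N).
apply: eqN_sym; apply: eqN_trans (f_hom.2 _ _ _ prod N) _.
rewrite -[X in eqN _ _ X]cat0s; apply: eqN_catr.
by rewrite /eqN cats0.
Qed.

(** Applying g turns the hypothesis into triviality of p in the completion of W', and W' is
    residually finite. *)
Lemma lift_inj p : (forall N, eqN N (lift N p) [::]) -> p =c [::].
Proof.
move=> h; apply: contrapT => /residually_finite[N hN Np]; apply: Np.
have e : pf_eq (f (pf_const p)) (pf_const [::]).
  by move=> M; apply: eqN_trans (eqN_sym (liftE M p)) (h M).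
have e1 : pf_eq (f (pf_const p)) (f (pf_const [::])).
  by move=> M; apply: eqN_trans (e M) _; apply/eqN_sym/(pf_hom_const1 f_hom).
have e2 := g_hom.1 _ _ e1; pose L := exist _ N hN : level'.
have : eqN L p [::].
  apply: eqN_trans (eqN_sym (gfK (pf_const p) L)) _.
  exact: eqN_trans (e2 L) (gfK (pf_const [::]) L).
by rewrite /eqN cats0.
Qed.

Lemma eqN_pow N x y k : eqN N x y -> eqN N (pow x k) (pow y k).
Proof.
move=> h; elim: k => [|k IH]; first exact: eqN_refl.
by rewrite !powS; apply: eqN_cat.
Qed.

Lemma lift_pow N p k : lift N (pow p k) = pow (lift N p) k.
Proof. by elim: k => // k IH; rewrite !powS lift_cat IH. Qed.

Lemma separate x y : ~ x =c y -> exists N, ~ eqN N x y.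
Proof.
move=> xy; have [|N hN nN] := @residually_finite G (x ++ rev y).
  by move=> /ce_rev1.
by exists (exist _ N hN).
Qed.

(** Modulo each N all elements of W are images of elements of W', so the law holds modulo N;
    residual finiteness of W removes N. *)
Lemma law_transfer k : (forall p r, ce_commute (pow p k) (pow r k)) ->
  forall x y, ce_commute (pow x k) (pow y k).
Proof.
move=> law x y; apply: contrapT => /separate[N]; apply.
have [p px] := lift_dense N x; have [r ry] := lift_dense N y.
have ex := eqN_pow k px; have ey := eqN_pow k ry.
apply: (eqN_trans (eqN_sym (eqN_cat ex ey))); apply: eqN_trans (eqN_cat ey ex).
by rewrite -!lift_pow -!lift_cat; apply: lift_ce; apply: law.
Qed.

(** A finite W' would bound every finite quotient of W by the size of l, yet size l + 1 distinct
    elements of W are separated at a single level. *)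
Lemma infinite_transfer : ~ spherical [set: V] -> ~ spherical [set: V'].
Proof.
move=> /nonspherical_seq[u [_ uinj]] [l hl]; set n := size l.
have [N0 _] := ex_level G.
have /choice[Nij hN] : forall ij : 'I_n.+1 * 'I_n.+1, exists N,
    ij.1 < ij.2 -> ~ eqN N (u ij.1) (u ij.2).
  move=> [i j] /=; case: (boolP (i < j)) => ij; last by exists N0.
  by have [N h] := separate (uinj _ _ ij); exists N.
have [N _ hNij] := level_inters Nij N0.
have /choice[c hc] : forall i, exists r, r \in l /\ eqN N (lift N r) (u i).
  move=> i; have [p pu] := lift_dense N (u i).
  have [|r rl pr] := hl p; first by apply/allP => v _; rewrite /= inE.
  by exists r; split=> //; apply: eqN_trans (lift_ce N (ce_sym pr)) pu.
have cl : {subset [seq c i | i <- iota 0 n.+1] <= l}.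
  by move=> z /mapP[i _ ->]; case: (hc i).
suff cu : uniq [seq c i | i <- iota 0 n.+1].
  by have := uniq_leq_size cu cl; rewrite size_map size_iota ltnn.
have clash i j : i < j -> j < n.+1 -> c i = c j -> False.
  move=> ij jn cij; have i_n := ltn_trans ij jn.
  apply: (hN (Ordinal i_n, Ordinal jn)) => //=; apply: (eqN_finer (hNij _)).
  by apply: eqN_trans (eqN_sym (hc i).2) _; rewrite cij; case: (hc j).
rewrite map_inj_in_uniq ?iota_uniq // => i j; rewrite !mem_iota !add0n /= => iN jN cij.
by case: (ltngtP i j) => // lt; [case: (clash i j)|case: (clash j i)].
Qed.

Lemma ends_infinite n : 0 < n -> ends_ge G n -> ~ spherical [set: V].
Proof.
move=> n0 [K [xs [sx inf _]]] [l hl].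
have x0 : In (nth [::] xs 0) xs by apply/InP/mem_nth; rewrite sx.
have [_ /(_ l)[y [_ yl]]] := inf _ x0.
have [|r /InP rl yr] := hl y; last exact: (yl r).
by apply/allP => v _; rewrite /= inE.
Qed.

Lemma infinite_ends1 : ~ spherical [set: V'] -> ends_ge G' 1.
Proof.
move=> inf; exists [::], [:: [::]]; split=> //; last by move=> i j; lia.
move=> x [<-|[]]; split=> // L; apply: contrapT => no; apply: inf.
exists L => p _; apply: contrapT => nop; apply: no; exists p.
split; first by exists p; split=> [i _ k []|]; apply: ce_refl.
by move=> r /InP rL pr; apply: nop; exists r.
Qed.

(** The case n > 2 remains once W' splits: if the tree of W' were a line, its law would pass to W,
    whose tree would then be a line as well, against [degenerate_ends]. So one side of the splitting
    of W' allows ping-pong and gives every n. *)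
Lemma ends_transfer n : ends_ge G n -> ends_ge G' n.
Proof.
case: n => [|n] hn; first by exists [::], [::]; split=> // i j; rewrite ltn0 andbF.
have inf := ends_infinite (ltn0Sn n) hn; have inf' := infinite_transfer inf.
case: n hn => [|n] hn; first exact: infinite_ends1.
have [A [B sep]] : separable G.
  by apply: contrapT => /unseparable_ends /(_ hn).
have sep' : separable G'.
  apply: contrapT => nsep'.
  exact: (no_dense_unseparable lift_cat lift_nil lift_ce lift_finer sep nsep' inf'
    lift_inj lift_dense).
case: n hn => [|n] hn; first exact: separable_ends2.
have [A' [B' sepAB']] := sep'; have sepBA' := separation_sym sepAB'.
have [dA'|] := pselect (half_degenerate A' B'); last exact: not_degenerate_ends.
have [dB'|] := pselect (half_degenerate B' A'); last exact: not_degenerate_ends.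
have [k k0 law'] := half_degenerate_law sepAB' dA' dB'.
have law := law_transfer law'; have sepBA := separation_sym sep.
have [dA|nd] := pselect (half_degenerate A B); last first.
  by case: (not_degenerate_no_law sep nd k0).
have [dB|nd] := pselect (half_degenerate B A); last first.
  by case: (not_degenerate_no_law sepBA nd k0).
by have := half_degenerate_ends sep dA dB hn.
Qed.

End Transfer.

Theorem theorem6p11 (G G' : coxeter_graph) :
  profinite_iso (cox_gops G) (cox_gops G') -> same_num_ends G G'.
Proof.
move=> [f [g [f_hom [g_hom [f_cont [g_cont [gfK fgK]]]]]]] n; split.
  exact: (ends_transfer g_hom g_cont f_hom fgK gfK).
exact: (ends_transfer f_hom f_cont g_hom gfK fgK).
Qed.
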